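(* Let $N>1$ and let $(X,d,\mathsf m)$ be a $\mathsf{CD}(0,N)$ metric measure space with $\mathsf{AVR}_{\mathsf m}>0$. Let $t_0>0$ and $x_0\in X$ be fixed. Then for every $p>1$, $0<\alpha\le\beta$, $t\in(0,t_0)$ and $u\in\mathcal F_{t_0,x_0}(X)$ with $(1+d^{p'}(x_0,\cdot))e^{\alpha u}\in L^1(X,\mathsf m)$ and $e^{\frac{\alpha u}{p}}\in W^{1,p}(X,d,\mathsf m)$, we have $$\|e^{\mathbf Q_tu}\|_{L^\beta(X,\mathsf m)}\le\|e^u\|_{L^\alpha(X,\mathsf m)}\left(\frac{\beta-\alpha}{t}\right)^{\frac Np\frac{\beta-\alpha}{\alpha\beta}}\frac{\alpha^{\frac N{\alpha\beta}\left(\frac\alpha p+\frac\beta{p'}\right)}}{\beta^{\frac N{\alpha\beta}\left(\frac\beta p+\frac\alpha{p'}\right)}}\left(\mathcal L_{p,N}\,\mathsf{AVR}_{\mathsf m}^{-\frac pN}\,\frac{Ne^{p-1}}{p^p}\right)^{\frac Np\frac{\beta-\alpha}{\alpha\beta}}.$$ In addition, the constant $K_0:=\mathcal L_{p,N}\,\mathsf{AVR}_{\mathsf m}^{-\frac pN}\frac{Ne^{p-1}}{p^p}$ is sharp in the range $\alpha<\beta$: for every $p>1$, if $K>0$ is such that $$\|e^{\mathbf Q_tu}\|_{L^\beta(X,\mathsf m)}\le\|e^u\|_{L^\alpha(X,\mathsf m)}\left(\frac{\beta-\alpha}{t}\right)^{\frac Np\frac{\beta-\alpha}{\alpha\beta}}\frac{\alpha^{\frac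 N{\alpha\beta}\left(\frac\alpha p+\frac\beta{p'}\right)}}{\beta^{\frac N{\alpha\beta}\left(\frac\beta p+\frac\alpha{p'}\right)}}K^{\frac Np\frac{\beta-\alpha}{\alpha\beta}}$$ for all $0<\alpha<\beta$, all $t\in(0,t_0)$ and all $u\in\mathcal F_{t_0,x_0}(X)$ with $(1+d^{p'}(x_0,\cdot))e^{\alpha u}\in L^1(X,\mathsf m)$ and $e^{\frac{\alpha u}p}\in W^{1,p}(X,d,\mathsf m)$, then $K\ge K_0$.
   Context: Metric measure space $(X,d,\mathsf m)$: $(X,d)$ is a complete separable metric space and $\mathsf m$ is a locally finite measure on the Borel $\sigma$-algebra of $X$, with $\operatorname{supp}\mathsf m=X$. $\mathsf{CD}(0,N)$ (Lott--Sturm--Villani): let $P_2(X,d)$ be the $L^2$-Wasserstein space of probability measures and $P_2(X,d,\mathsf m)$ its subspace of $\mathsf m$-absolutely continuous measures. For $N'>1$ the Rényi entropy is $\mathrm{Ent}_{N'}(\nu|\mathsf m)=-\int_X\rho^{1-\frac1{N'}}\,d\mathsf m$, where $\rho$ is the density of the absolutely continuous part of $\nu$ with respect to $\mathsf m$. The space is $\mathsf{CD}(0,N)$ if for all $N'\ge N$ and all $\mathsf m_0,\mathsf m_1\in P_2(X,d,\mathsf m)$ there is a (Wasserstein) geodesic $\Gamma:[0,1]\to P_2(X,d,\mathsf m)$ from $\mathsf m_0$ to $\mathsf m_1$ with $\mathrm{Ent}_{N'}(\Gamma(s)|\mathsf m)\le(1-s)\mathrm{Ent}_{N'}(\mathsf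 m_0|\mathsf m)+s\,\mathrm{Ent}_{N'}(\mathsf m_1|\mathsf m)$ for all $s\in[0,1]$. Let $\sigma_N=\frac{\pi^{N/2}}{\Gamma(\frac N2+1)}$ ($\Gamma(\cdot)$ the Euler Gamma function), and $\mathsf{AVR}_{\mathsf m}=\lim_{r\to\infty}\frac{\mathsf m(B(x,r))}{\sigma_N r^N}$, where $B(x,r)$ is the open ball; in a $\mathsf{CD}(0,N)$ space the limit exists and is independent of $x\in X$. With $p'=\frac p{p-1}$, $$\mathcal L_{p,N}=\frac pN\left(\frac{p-1}{e}\right)^{p-1}\left(\sigma_N\,\Gamma\left(\frac N{p'}+1\right)\right)^{-\frac pN}.$$ Sobolev space: for a locally Lipschitz $u$, $|Du|(x)=\limsup_{y\to x}\frac{|u(y)-u(x)|}{d(x,y)}$. The $p$-Cheeger energy of $u\in L^p(X,\mathsf m)$ is $\mathsf{Ch}_p(u)=\inf\{\liminf_{n}\int_X|Du_n|^p\,d\mathsf m:\ u_n\in \mathrm{Lip}(X)\cap L^p(X,\mathsf m),\ u_n\to u\text{ in }L^p(X,\mathsf m)\}$, and $W^{1,p}(X,d,\mathsf m)=\{u\in L^p(X,\mathsf m):\mathsf{Ch}_p(u)<\infty\}$. Hopf--Lax formula: for $t>0$ and $u:X\to\mathbb R$, $\mathbf Q_tu(x)=\inf_{y\in X}\left\{u(y)+\frac{d(x,y)^{p'}}{p't^{p'-1}}\right\}$, $x\in X$; $\mathbf Q_0u=u$. The class $\mathcal F_{t_0,x_0}(X)$ (depending on $p$) consists of the functions $u:X\to\mathbb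 R$ such that: (A1) $u$ is locally Lipschitz and the set $u^{-1}([0,\infty))\subset X$ is bounded; (A2) $\mathbf Q_{t_0}u(x_0)>-\infty$; (A3) there exist $M\in\mathbb R$ and $C_0>p't_0^{p'-1}$ such that $u(x)\ge M-\frac{d^{p'}(x,x_0)}{C_0}$ for all $x\in X$. For $\gamma>0$, $\|f\|_{L^\gamma(X,\mathsf m)}=\left(\int_X|f|^\gamma\,d\mathsf m\right)^{1/\gamma}$ (also when $\gamma<1$). When $\alpha=\beta$, the factors with exponent $0$ are interpreted as $1$. *)

(* Defs.v *)
From HB Require Import structures.
From mathcomp Require Import all_boot all_order all_algebra.
From mathcomp Require Import all_classical all_reals all_analysis.

Set Implicit Arguments.
Unset Strict Implicit.
Unset Printing Implicit Defensive.

Import Order.TTheory GRing.Theory Num.Theory.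
Import numFieldNormedType.Exports.

Local Open Scope classical_set_scope.
Local Open Scope ring_scope.

#[short(type="completeMetricType")]
HB.structure Definition CompleteMetric (K : numDomainType) :=
  { T of CompletePseudoMetric K T & Metric K T }.

Notation borel X := (g_sigma_algebraType (@open X)).

Section constants.
Context {R : realType}.
Implicit Types (x p N : R).

Definition euler_gamma x : R :=
  \int[lebesgue_measure]_(t in `]0, +oo[) (t `^ (x - 1) * expR (- t)).

Definition sigma_const N : R := pi `^ (N / 2) / euler_gamma (N / 2 + 1).

Definition conj_exp p : R := p / (p - 1).

Definition L_const p N : R :=
  p / N * ((p - 1) / expR 1) `^ (p - 1)
  * (sigma_const N * euler_gamma (N / conj_exp p + 1)) `^ (- (p / N)).

End constants.

Section metric_measure_space.
Context {R : realType} {X : completeMetricType R}.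
Variable m : {measure set (borel X) -> \bar R}.

Definition separable : Prop := exists2 D : set X, countable D & dense D.

Definition locally_finite : Prop :=
  forall x : X, exists2 r : R, 0 < r & (m (ball x r) < +oo)%E.

Definition msupport : set X :=
  [set x | forall U : set X, open U -> U x -> (0 < m U)%E].

Definition metric_measure_space : Prop :=
  [/\ separable, locally_finite & msupport = setT].

(* In a CD(0,N) space the limit exists and does not depend on [x]. *)
Definition AVR (N : R) (x : X) : \bar R :=
  lim ((m (ball x r) * ((sigma_const N * r `^ N)^-1)%:E)%E @[r --> +oo]).

End metric_measure_space.

Section wasserstein.
Context {R : realType} {X : completeMetricType R}.
Implicit Types mu nu : probability (borel X) R.

(* Measures are functions on all sets of which only the values on measurable
   sets matter, so they are not compared with Leibniz equality. *)
Definition eq_measure mu nu : Prop :=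
  forall A : set (borel X), measurable A -> mu A = nu A.

Definition P2 : set (probability (borel X) R) :=
  [set mu : probability (borel X) R | exists x0 : X,
     (\int[mu]_x ((mdist (x : X) x0 ^+ 2)%:E) < +oo)%E].

Definition coupling mu nu : set (probability (borel X * borel X)%type R) :=
  [set q : probability (borel X * borel X)%type R | forall A : set (borel X), measurable A ->
     q (A `*` setT) = mu A /\ q (setT `*` A) = nu A].

Definition W2 mu nu : \bar R :=
  (ereal_inf [set \int[q]_z ((mdist (z.1 : X) (z.2 : X) ^+ 2)%:E)
             | q in coupling mu nu] `^ 2^-1)%E.

Definition W2_geodesic (G : R -> probability (borel X) R) : Prop :=
  forall s t, s \in `[0, 1] -> t \in `[0, 1] ->
    W2 (G s) (G t) = (`|s - t|%:E * W2 (G 0%R) (G 1%R))%E.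

End wasserstein.

Section curvature_dimension.
Context {R : realType} {X : completeMetricType R}.
Variable m : {measure set (borel X) -> \bar R}.
Implicit Types nu : probability (borel X) R.

Definition P2_ac : set (probability (borel X) R) :=
  P2 `&` [set nu : probability (borel X) R | nu `<< m].

(* [rho] is the density of the absolutely continuous part in the Lebesgue
   decomposition of [nu]; the singular part is the restriction of [nu] to the
   [m]-null set [S]. *)
Definition ac_density nu : set (borel X -> R) :=
  [set rho : borel X -> R | [/\ measurable_fun setT rho, forall x, 0 <= rho x &
     exists S, [/\ measurable S, m S = 0%E &
       forall A, measurable A ->
         nu A = (\int[m]_(x in A) (rho x)%:E + nu (A `&` S))%E]]].

(* [ac_density nu] determines [rho] up to [m]-null sets, so the choice made by
   [xget] is immaterial. *)
Definition renyi_entropy (N' : R) nu : \bar R :=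
  let rho := xget (cst 0) (ac_density nu) in
  (- \int[m]_x (rho x `^ (1 - N'^-1))%:E)%E.

Definition CD0 (N : R) : Prop :=
  forall N' : R, N <= N' -> forall m0 m1, P2_ac m0 -> P2_ac m1 ->
  exists G : R -> probability (borel X) R,
    [/\ eq_measure (G 0) m0, eq_measure (G 1) m1, W2_geodesic G,
        forall s, s \in `[0, 1] -> P2_ac (G s) &
        forall s, s \in `[0, 1] ->
          (renyi_entropy N' (G s) <=
           (1 - s)%:E * renyi_entropy N' m0 + s%:E * renyi_entropy N' m1)%E].

End curvature_dimension.

Section sobolev.
Context {R : realType} {X : completeMetricType R}.
Variable m : {measure set (borel X) -> \bar R}.
Implicit Types u v : X -> R.

Definition locally_lipschitz u : Prop :=
  forall x : X, exists r L : R, 0 < r /\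
    forall y z, ball x r y -> ball x r z -> `|u y - u z| <= L * mdist y z.

Definition lipschitz_fun u : Prop :=
  exists L : R, forall y z, `|u y - u z| <= L * mdist y z.

(* The limsup is over full neighborhoods: the value at [y = x] is [0 / 0 = 0]
   and the other quotients are nonnegative, so this is the limsup over
   [y != x], with value 0 at isolated points. *)
Definition slope u (x : X) : \bar R :=
  limf_esup (fun y : X => (`|u y - u x| / mdist x y)%:E) (nbhs x).

Definition Lp (p : R) : set (X -> R) :=
  [set u | (u : borel X -> R) \in Lfun m p%:E].

Definition cvg_Lp (p : R) (un : nat -> X -> R) u : Prop :=
  'N[m]_(p%:E)[(fun x : borel X => (un n x - u x)%:E)]%E @[n --> \oo] --> 0%E.

Definition lip_approx (p : R) u : set (nat -> X -> R) :=
  [set un | (forall n, lipschitz_fun (un n) /\ Lp p (un n)) /\ cvg_Lp p un u].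

Definition cheeger (p : R) u : \bar R :=
  ereal_inf
    [set limn_einf (fun n => \int[m]_x (slope (un n) x `^ p)%E)%E
    | un in lip_approx p u].

Definition W1p (p : R) : set (X -> R) :=
  [set u | Lp p u /\ (cheeger p u < +oo)%E].

End sobolev.

Section hopf_lax.
Context {R : realType} {X : completeMetricType R}.
Variable m : {measure set (borel X) -> \bar R}.
Implicit Types (u : X -> R) (p alpha beta t K N : R).

Definition hopf_lax p t u (x : X) : \bar R :=
  if t == 0 then (u x)%:E else
  ereal_inf (range (fun y : X =>
    (u y + mdist x y `^ conj_exp p
             / (conj_exp p * t `^ (conj_exp p - 1)))%:E)).

Definition metric_bounded (A : set X) : Prop :=
  exists (x : X) (r : R), A `<=` ball x r.

Definition class_F p (t0 : R) (x0 : X) : set (X -> R) :=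
  [set u |
    [/\ locally_lipschitz u /\ metric_bounded (u @^-1` `[0, +oo[),
        (-oo < hopf_lax p t0 u x0)%E &
        exists M C0 : R, conj_exp p * t0 `^ (conj_exp p - 1) < C0 /\
          forall x, M - mdist x x0 `^ conj_exp p / C0 <= u x]].

Definition admissible p alpha (x0 : X) u : Prop :=
  m.-integrable setT (fun x : borel X =>
    ((1 + mdist x0 (x : X) `^ conj_exp p) * expR (alpha * u x))%:E)
  /\ W1p m p (fun x => expR (alpha * u x / p)).

Definition hc_factor N p alpha beta t K : R :=
  ((beta - alpha) / t) `^ (N / p * ((beta - alpha) / (alpha * beta)))
  * (alpha `^ (N / (alpha * beta) * (alpha / p + beta / conj_exp p))
     / beta `^ (N / (alpha * beta) * (beta / p + alpha / conj_exp p)))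
  * K `^ (N / p * ((beta - alpha) / (alpha * beta))).

Definition hypercontractive N p alpha beta t u K : Prop :=
  ('N[m]_(beta%:E)[(fun x : borel X => expeR (hopf_lax p t u x))] <=
   'N[m]_(alpha%:E)[(fun x : borel X => (expR (u x))%:E)]
     * (hc_factor N p alpha beta t K)%:E)%E.

Definition K0_const N p (x0 : X) : R :=
  L_const p N * fine (AVR m N x0) `^ (- (p / N))
  * (N * expR (p - 1) / p `^ p).

End hopf_lax.

(* Main.v *)
From HB Require Import structures.
Require Import Defs.
From mathcomp Require Import all_boot all_order all_algebra.
From mathcomp Require Import all_classical all_reals all_analysis.
From mathcomp Require Import measurable_realfun ring lra.

Set Implicit Arguments.
Unset Strict Implicit.
Unset Printing Implicit Defensive.

Import Order.TTheory GRing.Theory Num.Theory.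
Import numFieldNormedType.Exports.

Local Open Scope classical_set_scope.
Local Open Scope ring_scope.

(** In the sequel w is AVR times sigma_N, q is the exponent p' conjugate to p,
and phi(l) = l^q / (q t^(q-1)), so that Q_t u(x) is the infimum of u(y) + phi(d(x,y)).

The inequality. The CD(0,N) condition is only used through a Brunn-Minkowski
inequality (brunn_minkowski_CD). The Wasserstein geodesic between the uniform
measures on A and B is at time s concentrated on points whose distance to A
is at most s times the largest distance between A and B
(geodesic_intermediate_support), and among measures concentrated on a set Z the
Renyi entropy is at least -m(Z)^(1/N); convexity of the entropy along the geodesic
then bounds the measure of a neighbourhood of A from below. With A a
small ball this gives the Bishop-Gromov monotonicity of m(B_r)/r^N, hence
m(B_r) >= w r^N. With B a ball of radius tending to infinity and s = lam / r it gives
the growth of neighbourhoods with the sharp constant,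
  m(A_lam)^(1/N) >= m(A)^(1/N) + lam w^(1/N)     (enlargement_measure).
If Q_t u(x) > c and d(x,z) < lam then u(z) > c - phi(lam). Therefore the functions
b(c) = m(u > c) and a(c) = m(Q_t u > c) satisfy
  b(c - phi(lam))^(1/N) >= a(c)^(1/N) + lam w^(1/N)     (level_enlargement).
The arithmetic-geometric inequality with weights 1 - s = al / be and s turns the sum
into a product, and the result is the hypothesis of the Prekopa-Leindler
inequality on the real line, in the level variable c, for e^(be c) a(c),
e^(al c) b(c) and an explicit kernel. By the layer cake formula the
integrals of these functions are those of e^(be Q_t u) and e^(al u) and a Gamma integral
(integral_hypercontractivity). On a cone, Gaussian potentials give equality in
every step, so the constant that comes out is the sharp one (hc_constant).

Sharpness. Take u = -d(x0,.)^q / (q tau^(q-1)), for which Q_t u is at least the same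
expression with tau - t instead of tau (hopf_lax_gaussian_ge). By Bishop-Gromov the
integral of e^(-k d^q) is at least its value w k^(-N/q) Gamma(N/q+1) on a cone of
density w, and this is asymptotically exact as k tends to 0, when only large
balls matter (dist_integral_bounds). For tau = t be / (be - al) the values on the cone
realize equality with the constant K0 (hc_extremal). Letting al and be tend to 0
with a fixed ratio, the inequality with a constant K becomes K0 <= K. *)

(** * Lebesgue measure on the line: affine maps and Brunn-Minkowski *)

Section real_line.
Context {R : realType}.
Notation leb := (@lebesgue_measure R).
Implicit Types (A B C : set (measurableTypeR R)) (k c : R).

Lemma measurable_affine k c :
  measurable_fun setT (fun x : measurableTypeR R => k * x + c : measurableTypeR R).
Proof. by apply: measurable_funD => //; exact: measurable_funM. Qed.

Lemma lebesgue_measure_affine k c A : 0 < k -> measurable A ->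
  leb ((fun x => k * x + c) @^-1` A) = (k^-1%:E * leb A)%E.
Proof.
move=> k0 mA.
pose phi := (fun x : measurableTypeR R => k * x + c : measurableTypeR R).
have mphi : measurable_fun setT phi := measurable_affine k c.
have k0' : 0 <= k by exact: ltW.
pose nu0 : {measure set (measurableTypeR R) -> \bar R} :=
  measure_function_pushforward__canonical__measure_function_Measure leb mphi.
pose nu := mscale (NngNum k0') nu0.
have nuE B : nu B = (k%:E * leb (phi @^-1` B))%E by [].
have H : leb A = nu A.
  apply: lebesgue_measure_unique => // _ [[a b]] _ <-.
  change (leb `]a, b]%classic = k%:E * leb (phi @^-1` `]a, b]%classic))%E.
  rewrite (_ : phi @^-1` _ = `](a - c) / k, (b - c) / k]%classic); last first.
    apply/seteqP; split => x; rewrite /phi /= !in_itv/= ltr_pdivrMr// ler_pdivlMr//.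
      by move=> /andP[h1 h2]; apply/andP; split; lra.
    by move=> /andP[h1 h2]; apply/andP; split; lra.
  rewrite !lebesgue_measure_itv/= !lte_fin ltr_pM2r ?invr_gt0// ltrD2r.
  case: ifP => _; last by rewrite mule0.
  by rewrite -!EFinD -EFinM; congr EFin; field; rewrite lt0r_neq0.
rewrite H nuE muleA -EFinM mulVf ?mul1e//; exact: lt0r_neq0.
Qed.

Lemma ge0_integral_affine k c (f : R -> \bar R) : 0 < k ->
  measurable_fun [set: measurableTypeR R] f -> (forall x, 0 <= f x)%E ->
  (\int[leb]_x f (k * x + c)%R = k^-1%:E * \int[leb]_x f x)%E.
Proof.
move=> k0 mf f0.
have k0' : 0 <= k^-1 by rewrite invr_ge0 ltW.
rewrite -(ge0_integral_mscale leb measurableT (NngNum k0'))//=.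
rewrite -(setTI setT) -[in LHS](preimage_setT (fun x => k * x + c)).
have := @ge0_integral_pushforward _ _ _ _ R _ (measurable_affine k c) leb setT f measurableT mf (fun _ _ => f0 _).
rewrite setTI => <-.
apply: (eq_measure_integral (mscale (NngNum k0') leb)) => [|? A mA _].
  exact: measurable_affine.
exact: (lebesgue_measure_affine c k0 mA).
Qed.

Lemma ge0_integral_opp (f : R -> \bar R) :
  measurable_fun [set: measurableTypeR R] f -> (forall x, 0 <= f x)%E ->
  (\int[leb]_x f (- x)%R = \int[leb]_x f x)%E.
Proof.
move=> mf f0.
have mo : measurable_fun setT (fun x : measurableTypeR R => - x : measurableTypeR R) by exact: oppr_measurable.
rewrite -(setTI setT) -[in LHS](preimage_setT (fun x : measurableTypeR R => - x)).
have := @ge0_integral_pushforward _ _ _ _ R _ mo leb setT f measurableT mf (fun _ _ => f0 _).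
rewrite setTI => <-.
apply: (eq_measure_integral leb) => A mA _.
exact: lebesgue_measureN.
Qed.

(** By inner regularity A and B may be replaced by compact subsets K and L;
then max K + L and K + min L lie in C and meet in a single point. *)
Lemma brunn_minkowski_R A B C : measurable A -> measurable B -> measurable C ->
  A !=set0 -> B !=set0 -> (forall a b, A a -> B b -> C (a + b)) ->
  (leb A + leb B <= leb C)%E.
Proof.
move=> mA mB mC [a1 Aa1] [b1 Bb1] ABC.
have trans D c : measurable D -> leb ((fun x => 1 * x + c) @^-1` D) = leb D.
  by move=> mD; rewrite lebesgue_measure_affine// invr1 mul1e.
have mtrans D c : measurable D -> measurable ((fun x => 1 * x + c) @^-1` D : set (measurableTypeR R)).
  by move=> mD; rewrite -[X in measurable X]setTI; apply: measurable_affine.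
rewrite (lebesgue_regularity_inner_sup mA).
have K1 K L : compact K -> K `<=` A -> compact L -> L `<=` B ->
    (leb K + leb L <= leb C)%E.
  move=> cK KA cL LB.
  have mK := compact_measurable cK.
  have mL := compact_measurable cL.
  have [->|K0] := eqVneq K set0.
    rewrite measure0 add0e -(trans L (- a1))// le_measure ?inE//; first exact: mtrans.
    by move=> x /= /LB /(ABC a1 _ Aa1); congr C; lra.
  have [->|L0] := eqVneq L set0.
    rewrite measure0 adde0 -(trans K (- b1))// le_measure ?inE//; first exact: mtrans.
    by move=> x /= /KA /(fun h => ABC _ _ h Bb1); congr C; lra.
  have id_cont D : {within D, continuous (id : R -> R)}.
    by apply: continuous_subspaceT => x; exact: cvg_id.
  have /set0P K0' := K0; have /set0P L0' := L0.
  have [a0 Ka0 a0max] := @compact_EVT_max R R idfun K K0' cK (id_cont K).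
  have [b0 Lb0 b0min] := @compact_EVT_min R R idfun L L0' cL (id_cont L).
  have [/= Ka0' Lb0'] := (set_mem Ka0, set_mem Lb0).
  have Aa0 := KA _ Ka0'; have Bb0 := LB _ Lb0'.
  (* the common point a0 + b0 of the two translates is removed from one of them *)
  pose K' := (fun x => 1 * x + (- b0)) @^-1` K.
  pose L' := (fun x => 1 * x + (- a0)) @^-1` L `\ (a0 + b0).
  have mK' : measurable (K' : set (measurableTypeR R)) by exact: mtrans.
  have mL' : measurable (L' : set (measurableTypeR R)) by apply: measurableD => //; exact: mtrans.
  have -> : leb K = leb K' by rewrite trans.
  have -> : leb L = leb L'.
    rewrite -(trans L (- a0))//.
    have -> : (fun x => 1 * x + - a0) @^-1` L = L' `|` [set a0 + b0].
      rewrite setUC setDUK// => x -> /=.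
      by rewrite mul1r addrAC subrr add0r.
    rewrite measureU//; [|by apply/seteqP; split => x []// [_ ?]].
    by rewrite /= lebesgue_measure_set1 adde0.
  rewrite -measureU//; last first.
    apply/seteqP; split => x // [] K'x [L'x] /= xab; apply: xab.
    have := a0max _ (mem_set K'x); have := b0min _ (mem_set L'x) => /=.
    by move=> h1 h2; apply/eqP; rewrite eq_le; apply/andP; split; lra.
  rewrite le_measure ?inE//; first exact: measurableU.
  move=> x [/= /KA h|[/= /LB h _]].
    by have := ABC _ _ h Bb0; congr C; lra.
  by have := ABC _ _ Aa0 h; congr C; lra.
have C0 : (0 <= leb C)%E by [].
have [Cfin|] := ltP (leb C) +oo%E; last by rewrite leye_eq => /eqP ->; rewrite leey.
have Bfin K : compact K -> K `<=` A -> (leb K + leb B <= leb C)%E.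
  move=> cK KA.
  have Kfin : leb K \is a fin_num.
    rewrite ge0_fin_numE//; exact: compact_finite_measure.
  rewrite addeC -leeBrDr//.
  rewrite (lebesgue_regularity_inner_sup mB).
  apply: ge_ereal_sup => _ [L [cL LB] <-].
  by rewrite leeBrDr// addeC; exact: K1.
have Bf : leb B \is a fin_num.
  rewrite ge0_fin_numE//; apply: le_lt_trans Cfin.
  by have := Bfin set0 (@compact0 _) (@sub0set _ _); rewrite measure0 add0e.
rewrite -leeBrDr//; apply: ge_ereal_sup => _ [K [cK KA] <-].
by rewrite leeBrDr//; exact: Bfin.
Qed.

End real_line.

(** * Layer cake formulas *)

Lemma measurable_expeR {R : realType} : measurable_fun [set: \bar R] (@expeR R).
Proof.
rewrite (_ : @expeR R = fun x => maxe 0%E (er_map (@expR R) x)); last first.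
  apply/funext => -[r| |] /=; first by rewrite max_r// lee_fin expR_ge0.
    by rewrite max_r// leey.
  by rewrite max_l.
have me : measurable_fun [set: \bar R] (er_map expR).
  exact: (@measurable_er_map _ (measurableTypeR R) R expR (@measurable_expR R)).
exact: (@measurable_maxe _ (\bar R) R setT (cst 0%E) (er_map expR) (measurable_cst _) me).
Qed.

Section layer_cake.
Context {R : realType} d (T : measurableType d) (mu : {sigma_finite_measure set T -> \bar R}).
Notation leb := (@lebesgue_measure R).
Local Open Scope ereal_scope.

Lemma measurable_superlevel_measure (f : T -> \bar R) : measurable_fun setT f ->
  measurable_fun [set: measurableTypeR R] (fun v : R => mu [set x | v%:E < f x]).
Proof.
move=> mf.
pose S := [set z : T * measurableTypeR R | (z.2)%:E < f z.1].
have mS : measurable S.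
  rewrite -[S]setTI /S; apply: measurable_lte => //.
    by apply/measurable_EFinP; exact: measurable_snd.
  by apply: measurableT_comp => //; exact: measurable_fst.
rewrite (_ : (fun v : R => _) = mu \o ysection S); first exact: measurable_fun_ysection.
by apply/funext => v /=; congr (mu _); apply/seteqP; split => x; rewrite /S/= /ysection/= ?inE.
Qed.

(** Tonelli on the region below the graph of f. The values of f may be
infinite, as those of a Hopf-Lax transform may be. *)
Lemma layer_cake (f : T -> \bar R) (k : measurableTypeR R -> \bar R) :
  measurable_fun setT f -> measurable_fun setT k -> (forall v, 0 <= k v) ->
  \int[mu]_x \int[leb]_(v in [set v | v%:E < f x]) k v =
  \int[leb]_v (k v * mu [set x | v%:E < f x]).
Proof.
move=> mf mk k0.
pose S := [set z : T * measurableTypeR R | (z.2)%:E < f z.1].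
have mS : measurable S.
  rewrite -[S]setTI /S; apply: measurable_lte => //.
    by apply/measurable_EFinP; exact: measurable_snd.
  by apply: measurableT_comp => //; exact: measurable_fst.
pose F (z : T * measurableTypeR R) := k z.2 * (\1_S z)%:E.
have F0 z : 0 <= F z by rewrite mule_ge0// lee_fin.
have mF : measurable_fun setT F.
  apply: emeasurable_funM; first by apply: measurableT_comp => //; exact: measurable_snd.
  by apply/measurable_EFinP; exact: measurable_indic.
transitivity (\int[mu]_x \int[leb]_v F (x, v)).
  apply: eq_integral => x _; rewrite integral_mkcond; apply: eq_integral => v _.
  rewrite /F patchE /= indicE /S.
  case: ifPn => [/set_mem /= h|/negP h].
    by rewrite mem_set// mule1.
  by rewrite memNset ?mule0//= => h'; apply: h; exact: mem_set.
rewrite (@fubini_tonelli _ _ _ _ _ mu leb F mF F0).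
apply: eq_integral => v _; rewrite /F/=.
have mSv : measurable [set x | v%:E < f x].
  by rewrite -[X in measurable X]setTI; apply: measurable_lte => //.
rewrite ge0_integralZl//; last first.
  apply/measurable_EFinP.
  rewrite (_ : (fun x => _) = \1_[set x | v%:E < f x])//; exact: measurable_indic.
congr (_ * _).
rewrite (_ : (fun x => _) = EFin \o \1_[set x | v%:E < f x])//.
by rewrite integral_indic// setIT.
Qed.

Lemma layer_cake_ge0 (f : T -> R) : measurable_fun setT f -> (forall x, 0 <= f x)%R ->
  \int[mu]_x (f x)%:E =
  \int[leb]_v ((\1_`]0%R, +oo[%classic v : R)%:E * mu [set x | (v < f x)%R]).
Proof.
move=> mf f0.
have mk : measurable_fun [set: measurableTypeR R] (fun v : R => (\1_`]0%R, +oo[%classic v : R)%:E).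
  by apply/measurable_EFinP; exact: measurable_indic.
have mf' : measurable_fun setT (EFin \o f) by exact/measurable_EFinP.
rewrite -(@layer_cake (EFin \o f) _ mf' mk)//.
apply: eq_integral => x _ /=.
rewrite (_ : [set v | v%:E < (f x)%:E] = `]-oo, f x[%classic); last first.
  by apply/seteqP; split => v /=; rewrite lte_fin in_itv.
rewrite (_ : (fun v : R => _) = EFin \o \1_`]0%R, +oo[%classic)// integral_indic//.
rewrite (_ : _ `&` _ = `]0%R, f x[%classic); last first.
  by apply/seteqP; split => v /=; rewrite !in_itv/= andbT; [move=> [-> ->]|move=> /andP[-> ->]].
rewrite /= lebesgue_measure_itv/= lte_fin; case: ltP => [_|f0']; first by rewrite oppr0 adde0.
by have -> : f x = 0%R by apply/eqP; rewrite eq_le f0' f0.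
Qed.

Lemma integral_expRNM (k : R) : (0 < k)%R ->
  \int[leb]_v ((\1_`]0%R, +oo[%classic v : R) * expR (- k * v))%R%:E = k^-1%:E.
Proof.
move=> k0; have k0' : (0 <= k)%R by exact: ltW.
have mg : measurable_fun [set: measurableTypeR R] (fun v : R => ((\1_`[0%R, +oo[%classic v : R) * expR (- k * v))%R%:E).
  apply/measurable_EFinP; apply: measurable_funM => //.
    by apply: measurableT_comp => //; exact: measurable_funM.
have := integral_exponential_pdf k0.
have -> : \int[leb]_v (exponential_pdf k v)%:E =
    k%:E * \int[leb]_v ((\1_`[0%R, +oo[%classic v : R) * expR (- k * v))%R%:E.
  rewrite -ge0_integralZl_EFin//.
  apply: eq_integral => v _; rewrite -EFinM /exponential_pdf patchE indicE.
  by case: ifP => _; rewrite ?mul1r// !mul0r mulr0.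
rewrite (_ : \int[leb]_v ((\1_`[0%R, +oo[%classic v : R) * expR (- k * v))%R%:E =
   \int[leb]_v ((\1_`]0%R, +oo[%classic v : R) * expR (- k * v))%R%:E).
  move=> /(congr1 (fun x => k^-1%:E * x)).
  by rewrite muleA -EFinM mulVf ?gt_eqF// mul1e mule1.
transitivity (\int[leb]_(v in `[0%R, +oo[) (expR (- k * v))%R%:E).
  rewrite [RHS]integral_mkcond; apply: eq_integral => v _.
  by rewrite patchE indicE; case: ifP => _; rewrite ?mul1r ?mul0r.
rewrite -integral_itv_obnd_cbnd; last first.
  by apply/measurable_funTS/measurable_EFinP; apply: measurableT_comp => //; exact: measurable_funM.
rewrite integral_mkcond; apply: eq_integral => v _.
by rewrite patchE indicE; case: ifP => _; rewrite ?mul1r ?mul0r.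
Qed.

Lemma integral_expRM_itv (k w : R) : (0 < k)%R ->
  \int[leb]_(v in [set v | (v < w)%R]) (expR (k * v))%:E = (expR (k * w) / k)%:E.
Proof.
move=> k0.
pose g v := ((\1_`]0%R, +oo[%classic v : R) * expR (- k * v))%R%:E.
have mg : measurable_fun [set: measurableTypeR R] g.
  by apply/measurable_EFinP; apply: measurable_funM => //; apply: measurableT_comp => //; exact: measurable_funM.
have g0 v : 0 <= g v by rewrite lee_fin mulr_ge0// expR_ge0.
pose h v := g (- v)%R.
have mh : measurable_fun [set: measurableTypeR R] h.
  by apply: measurableT_comp => //; exact: oppr_measurable.
transitivity ((expR (k * w))%:E * \int[leb]_v h (1 * v + (- w))%R).
  have mh' : measurable_fun [set: measurableTypeR R] (fun v : R => h (1 * v + (- w))%R).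
    exact: (measurableT_comp mh (measurable_affine 1 (- w))).
  rewrite -(ge0_integralZl_EFin leb measurableT (fun _ _ => g0 _) mh')//.
  rewrite [LHS]integral_mkcond; apply: eq_integral => v _.
  rewrite patchE /h /g mul1r indicE.
  case: ifPn => [/set_mem /= vw|/negP vw].
    rewrite mem_set/= ?in_itv/= ?andbT ?oppr_gt0 ?subr_lt0//.
    by rewrite mul1r -EFinM -expRD; congr (expR _)%:E; ring.
  rewrite memNset ?mul0r ?mule0//= in_itv/= andbT oppr_gt0 subr_lt0 => h'.
  by apply: vw; exact: mem_set.
rewrite (ge0_integral_affine (- w) ltr01 mh)//; last by move=> v; exact: g0.
rewrite invr1 mul1e ge0_integral_opp// integral_expRNM//.
Qed.

(** The level v is weighted by exp(k v), an antiderivative of which vanishes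
at -oo: no sign condition on f is needed, and the value exp(k f) appears with
the conventions exp(-oo) = 0 and exp(+oo) = +oo. *)
Lemma layer_cake_exp (f : T -> \bar R) (k : R) : (0 < k)%R -> measurable_fun setT f ->
  \int[leb]_v ((expR (k * v))%:E * mu [set x | v%:E < f x]) =
  k^-1%:E * \int[mu]_x expeR (k%:E * f x).
Proof.
move=> k0 mf.
have mk : measurable_fun [set: measurableTypeR R] (fun v : R => (expR (k * v))%:E).
  by apply/measurable_EFinP; apply: measurableT_comp => //; exact: measurable_funM.
rewrite -(@layer_cake f _ mf mk)//.
have mexp : measurable_fun setT (fun x => expeR (k%:E * f x)).
  by apply: measurableT_comp; [exact: measurable_expeR|exact: measurable_funeM].
have k0' : (0 <= k^-1)%R by rewrite invr_ge0 ltW.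
rewrite -(ge0_integralZl_EFin mu measurableT (fun _ _ => expeR_ge0 _) mexp k0')//.
apply: eq_integral => x _.
case: (f x) => [r| |].
- rewrite (_ : [set v | v%:E < r%:E] = [set v | (v < r)%R]).
    by rewrite integral_expRM_itv// mulrC.
  by apply/seteqP; split => v /=; rewrite lte_fin.
- rewrite gt0_muley ?lte_fin//= gt0_muley ?lte_fin ?invr_gt0//.
  apply/eqyP => M M0.
  (* on the set f = +oo both sides are infinite: the inner integral exceeds any M *)
  have [w wM] : exists w, (M <= expR (k * w) / k)%R.
    exists (ln (k * M) / k)%R; rewrite (mulrC k (_ / _)%R) divfK ?gt_eqF// lnK ?posrE ?mulr_gt0//.
    by rewrite mulrAC divff ?mul1r// gt_eqF.
  apply: (@le_trans _ _ (\int[leb]_(v in [set v | (v < w)%R]) (expR (k * v))%:E)).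
    by rewrite integral_expRM_itv// lee_fin.
  apply: ge0_subset_integral => //.
  + rewrite (_ : [set v | _] = `]-oo, w[%classic)//.
  + rewrite (_ : [set v | _] = setT)//; apply/seteqP; split => v //= _; exact: ltry.
  + apply/measurable_funTS/measurable_EFinP; apply: measurableT_comp => //; exact: measurable_funM.
  + by move=> v _ /=; exact: ltry.
- rewrite gt0_muleNy ?lte_fin//= mule0.
  rewrite (_ : [set v | _] = set0) ?integral_set0//.
  by apply/seteqP; split => v.
Qed.

End layer_cake.

(** * The Prekopa-Leindler inequality on the line *)

Section prekopa_leindler.
Context {R : realType}.
Notation leb := (@lebesgue_measure R).

Lemma powR_div (r a b : R) : 0 < b -> 0 <= a -> (a / b) `^ r = a `^ r / b `^ r.
Proof.
move=> b0 a0; have bi : 0 <= b^-1 by rewrite invr_ge0 ltW.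
rewrite (powRM _ a0 bi).
by rewrite -(powR_inv1 (ltW b0)) -powRrM mulN1r powRN.
Qed.

(** Young's inequality for the conjugate exponents 1/(1-s) and 1/s. *)
Lemma weighted_AMGM (s a b : R) : 0 < s -> s < 1 -> 0 <= a -> 0 <= b ->
  a `^ (1 - s) * b `^ s <= (1 - s) * a + s * b.
Proof.
move=> s0 s1 a0 b0.
have s1' : 0 < 1 - s by rewrite subr_gt0.
have := @conjugate_powR R (a `^ (1 - s)) (b `^ s) (1 - s)^-1 s^-1.
rewrite !powR_ge0 !invr_gt0 s0 s1' !invrK subrK => /(_ isT isT isT isT erefl).
by rewrite -!powRrM !mulfV ?gt_eqF// !powRr1// (mulrC a) (mulrC b).
Qed.

Lemma sup_range_gt (T : Type) (F : T -> R) (M theta : R) (x : T) :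
  (forall y, F y <= M) -> 0 < F x -> theta < 1 ->
  exists y, theta * sup (range F) < F y.
Proof.
move=> FM Fx t1.
have hs : has_sup (range F).
  by split; [exists (F x), x | exists M => _ [y _ <-]].
have S0 : 0 < sup (range F).
  by apply: (lt_le_trans Fx); apply: sup_upper_bound => //; exists x.
have : theta * sup (range F) < sup (range F) by rewrite gtr_pMl.
by move=> /(sup_gt (ex_intro _ _ (ex_intro2 _ _ x I erefl)))[_ [y _ <-]] h; exists y.
Qed.

(** Once F and G are divided by their suprema, the superlevel sets of F and G
at every height v < 1 are nonempty and their sum lies in that of H, so
one-dimensional Brunn-Minkowski applies at each height. The normalization
makes the two ranges of heights coincide; this is what turns the additive
inequality into the multiplicative one. *)
Lemma prekopa_leindler_normalized (s : R) (F G H : measurableTypeR R -> R) (MF MG : R) :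
  0 < s -> s < 1 ->
  measurable_fun setT F -> measurable_fun setT G -> measurable_fun setT H ->
  (forall x, 0 <= F x) -> (forall x, 0 <= G x) -> (forall x, 0 <= H x) ->
  0 < MF -> 0 < MG -> (forall x, F x <= MF) -> (forall x, G x <= MG) ->
  (forall theta, theta < 1 -> exists x, theta * MF < F x) ->
  (forall theta, theta < 1 -> exists x, theta * MG < G x) ->
  (forall x y, F x `^ (1 - s) * G y `^ s <= H (x + y)) ->
  (\int[leb]_x (F x / MF)%:E + \int[leb]_x (G x / MG)%:E <=
   \int[leb]_x (H x / (MF `^ (1 - s) * MG `^ s))%:E)%E.
Proof.
move=> s0 s1 mF mG mH F0 G0 H0 MF0 MG0 FM GM Fsup Gsup FGH.
set M := MF `^ (1 - s) * MG `^ s.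
have M0 : 0 < M by rewrite mulr_gt0// powR_gt0.
have mdiv (K : measurableTypeR R -> R) c : measurable_fun setT K -> measurable_fun setT (fun x => K x / c).
  by move=> mK; apply: measurable_funM.
have ge0div (K : measurableTypeR R -> R) c : (forall x, 0 <= K x) -> 0 < c -> forall x, 0 <= K x / c.
  by move=> K0 c0 x; rewrite divr_ge0// ltW.
rewrite !layer_cake_ge0//; [|exact: mdiv|exact: ge0div|exact: mdiv|exact: ge0div|exact: mdiv|exact: ge0div].
pose L (K : measurableTypeR R -> R) c (v : R) := leb [set x | v < K x / c].
have mL K c : measurable_fun setT K -> measurable_fun [set: measurableTypeR R] (L K c).
  move=> mK; have := @measurable_superlevel_measure R _ _ leb (fun x => (K x / c)%:E).
  by apply; apply/measurable_EFinP; exact: mdiv.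
have mLM K c : measurable_fun setT K -> measurable_fun [set: measurableTypeR R]
    (fun v : R => (\1_(`]0, +oo[%classic : set R) v : R)%:E * L K c v)%E.
  by move=> mK; apply: emeasurable_funM; [apply/measurable_EFinP; exact: measurable_indic|exact: mL].
have L0 K c v : (0 <= (\1_(`]0%R, +oo[%classic : set R) v : R)%:E * L K c v)%E by rewrite mule_ge0// lee_fin.
change (\int[leb]_v ((\1_(`]0%R, +oo[%classic : set R) v : R)%:E * L F MF v) + 
  \int[leb]_v ((\1_(`]0%R, +oo[%classic : set R) v : R)%:E * L G MG v) <=
  \int[leb]_v ((\1_(`]0%R, +oo[%classic : set R) v : R)%:E * L H M v))%E.
rewrite -(ge0_integralD leb measurableT (fun v _ => L0 F MF v) (mLM F MF mF) (fun v _ => L0 G MG v) (mLM G MG mG)).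
apply: ge0_le_integral => [//| | | |].
- by move=> v _; rewrite adde_ge0// L0.
- by apply: emeasurable_funD; exact: mLM.
- exact: mLM.
move=> v _; rewrite indicE.
have [v0|] := boolP (v \in _); last by rewrite !mul0e adde0.
rewrite !mul1e.
have {}v0 : 0 < v by move: v0; rewrite inE/= in_itv/= andbT.
have mlev (K : measurableTypeR R -> R) c : measurable_fun setT K -> measurable [set x | v < K x / c].
  move=> mK; rewrite -[X in measurable X]setTI.
  by have := @measurable_fun_ltr _ _ R setT (cst v) (fun x => K x / c) (measurable_cst _) (mdiv _ _ mK) measurableT [set true] I.
have [v1|v1] := ltP v 1; last first.
  have lev0 (K : measurableTypeR R -> R) c : 0 < c -> (forall x, K x <= c) -> [set x | v < K x / c] = set0.
    move=> c0 Kc; apply/seteqP; split => x //= h; have : v < v.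
      by apply: (lt_le_trans h); rewrite (le_trans _ v1)// ler_pdivrMr// mul1r.
    by rewrite ltxx.
  by rewrite /L (lev0 F)// (lev0 G)// !measure0 add0e measure_ge0. 
apply: brunn_minkowski_R; [exact: mlev|exact: mlev|exact: mlev| | |].
- by have [x hx] := Fsup v v1; exists x; rewrite /= ltr_pdivlMr.
- by have [x hx] := Gsup v v1; exists x; rewrite /= ltr_pdivlMr.
move=> x y; rewrite /= !ltr_pdivlMr// => hx hy.
apply: lt_le_trans (FGH x y).
have -> : v = v `^ (1 - s) * v `^ s.
  by rewrite -powRD ?subrK ?powRr1 ?ltW// oner_eq0.
rewrite /M mulrACA -!powRM ?ltW//.
have s1' : 0 < 1 - s by rewrite subr_gt0.
by apply: ltr_pM; rewrite ?powR_ge0//; apply: gt0_ltr_powR => //;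
  rewrite nnegrE ?F0 ?G0// mulr_ge0// ltW.
Qed.

(** The normalized inequality bounds a weighted arithmetic mean; the geometric
mean is smaller, and in it the suprema of F and G cancel. The conclusion is
solved for the integral of F, the only one not known to be finite. *)
Lemma prekopa_leindler_bounded (s : R) (F G H : measurableTypeR R -> R) (MF MG g h : R) :
  0 < s -> s < 1 ->
  measurable_fun setT F -> measurable_fun setT G -> measurable_fun setT H ->
  (forall x, 0 <= F x) -> (forall x, 0 <= G x) -> (forall x, 0 <= H x) ->
  (forall x, F x <= MF) -> (forall x, G x <= MG) ->
  (forall x y, F x `^ (1 - s) * G y `^ s <= H (x + y)) ->
  (\int[leb]_x (G x)%:E = g%:E)%E -> 0 < g -> (\int[leb]_x (H x)%:E = h%:E)%E ->
  (\int[leb]_x (F x)%:E <= ((1 - s) * (h / (g / s) `^ s) `^ (1 - s)^-1)%:E)%E.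
Proof.
move=> s0 s1 mF mG mH F0 G0 H0 FM GM FGH gE g0 hE.
have s1' : 0 < 1 - s by rewrite subr_gt0.
have [[x Fx]|] := pselect (exists x, 0 < F x); last first.
  move=> nF; rewrite (_ : (fun x => (F x)%:E) = cst 0%E); last first.
    apply/funext => x /=; congr EFin; apply/eqP; rewrite eq_le F0 andbT leNgt.
    by apply/negP => h'; apply: nF; exists x.
  rewrite integral0 lee_fin mulr_ge0 ?powR_ge0 ?ltW//.
have [[y Gy]|] := pselect (exists x, 0 < G x); last first.
  move=> nG; move: gE; rewrite (_ : (fun x => (G x)%:E) = cst 0%E); last first.
    apply/funext => z /=; congr EFin; apply/eqP; rewrite eq_le G0 andbT leNgt.
    by apply/negP => h'; apply: nG; exists z.
  by rewrite integral0 => -[] g0'; move: g0; rewrite -g0' ltxx.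
set SF := sup (range F); set SG := sup (range G).
have hsF : has_sup (range F) by split; [exists (F x), x | exists MF => _ [z _ <-]].
have hsG : has_sup (range G) by split; [exists (G y), y | exists MG => _ [z _ <-]].
have FS z : F z <= SF by apply: sup_upper_bound => //; exists z.
have GS z : G z <= SG by apply: sup_upper_bound => //; exists z.
have SF0 : 0 < SF := lt_le_trans Fx (FS _).
have SG0 : 0 < SG := lt_le_trans Gy (GS _).
have := @prekopa_leindler_normalized s F G H SF SG s0 s1 mF mG mH F0 G0 H0 SF0 SG0 FS GS
  (fun t t1 => sup_range_gt FM Fx t1) (fun t t1 => sup_range_gt GM Gy t1) FGH.
set M := _ * _.
have M0 : 0 < M by rewrite mulr_gt0// powR_gt0.
have idiv (K : measurableTypeR R -> R) c : measurable_fun setT K -> (forall x, 0 <= K x) -> 0 < c ->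
   (\int[leb]_x (K x / c)%:E = c^-1%:E * \int[leb]_x (K x)%:E)%E.
  move=> mK K0 c0; have c0' : 0 <= c^-1 by rewrite invr_ge0 ltW.
  have mK' : measurable_fun setT (fun x => (K x)%:E) by exact/measurable_EFinP.
  rewrite -(ge0_integralZl_EFin leb measurableT _ mK' c0')//; last by move=> x0 _; rewrite lee_fin.
  by apply: eq_integral => z _; rewrite -EFinM mulrC.
rewrite !idiv// gE hE.
have : (0 <= \int[leb]_x (F x)%:E)%E by apply: integral_ge0 => z _; rewrite lee_fin.
case: (integral _ _ _) => [f| |] //; last first.
  by move=> _; rewrite gt0_muley ?lte_fin ?invr_gt0//.
rewrite !lee_fin => f0 A.
have B : (f / (1 - s)) `^ (1 - s) * (g / s) `^ s <= h.
  have := @weighted_AMGM s (f / (1 - s) / SF) (g / s / SG) s0 s1.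
  have fs0 : 0 <= f / (1 - s) / SF by rewrite !divr_ge0// ltW.
  have gs0 : 0 <= g / s / SG by rewrite !divr_ge0// ltW.
  move=> /(_ fs0 gs0).
  have -> : (1 - s) * (f / (1 - s) / SF) + s * (g / s / SG) = SF^-1 * f + SG^-1 * g.
    by field; rewrite !gt_eqF.
  move=> /le_trans/(_ A).
  have fs1 : 0 <= f / (1 - s) by rewrite divr_ge0// ltW.
  have gs1 : 0 <= g / s by rewrite divr_ge0// ltW.
  rewrite (powR_div _ SF0 fs1) (powR_div _ SG0 gs1).
  rewrite mulrACA -invfM -/M -[leRHS]mulrC => h'.
  by move: h'; rewrite ler_pM2r ?invr_gt0.
have C : (f / (1 - s)) `^ (1 - s) <= h / (g / s) `^ s.
  by rewrite ler_pdivlMr// powR_gt0 ?divr_gt0.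
have D : f / (1 - s) <= (h / (g / s) `^ s) `^ (1 - s)^-1.
  have fs1 : 0 <= f / (1 - s) by rewrite divr_ge0// ltW.
  have -> : f / (1 - s) = ((f / (1 - s)) `^ (1 - s)) `^ (1 - s)^-1.
    by rewrite -powRrM mulfV ?powRr1// gt_eqF.
  apply: ge0_ler_powR; [by rewrite invr_ge0 ltW|by rewrite nnegrE powR_ge0| |exact: C].
  by rewrite nnegrE (le_trans _ C)// powR_ge0.
by rewrite mulrC -ler_pdivrMr.
Qed.

(** Truncating F at height n gives the unbounded case by monotone convergence.
The roles of F, G, H will be played by the level functions of the Hopf-Lax
transform, of the kernel and of the initial datum; the first of them need
not be bounded. *)
Lemma prekopa_leindler (s : R) (F G H : measurableTypeR R -> R) (MG g h : R) :
  0 < s -> s < 1 ->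
  measurable_fun setT F -> measurable_fun setT G -> measurable_fun setT H ->
  (forall x, 0 <= F x) -> (forall x, 0 <= G x) -> (forall x, 0 <= H x) ->
  (forall x, G x <= MG) ->
  (forall x y, F x `^ (1 - s) * G y `^ s <= H (x + y)) ->
  (\int[leb]_x (G x)%:E = g%:E)%E -> 0 < g -> (\int[leb]_x (H x)%:E = h%:E)%E ->
  (\int[leb]_x (F x)%:E <= ((1 - s) * (h / (g / s) `^ s) `^ (1 - s)^-1)%:E)%E.
Proof.
move=> s0 s1 mF mG mH F0 G0 H0 GM FGH gE g0 hE.
pose Fn n x := Num.min (F x) n%:R.
have mFn n : measurable_fun setT (Fn n) by exact: measurable_minr.
have Fn0 n x : 0 <= Fn n x by rewrite le_min F0 ler0n.
have mFn' n : measurable_fun setT (fun x => (Fn n x)%:E) by exact/measurable_EFinP.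
have Fn0' n (x : measurableTypeR R) : setT x -> (0 <= (Fn n x)%:E)%E by rewrite lee_fin.
have ndF (x : measurableTypeR R) : setT x -> nondecreasing_seq (fun n => (Fn n x)%:E).
  by move=> _ a b ab; rewrite lee_fin le_min !ge_min lexx/= ler_nat ab orbT.
have cv := cvg_monotone_convergence measurableT mFn' Fn0' ndF (mu := leb).
have FE x : limn (fun n => (Fn n x)%:E) = (F x)%:E.
  apply: cvg_lim => //; apply: cvg_near_cst.
  near=> n; congr EFin; rewrite /Fn; apply/min_idPl.
  by near: n; exact: nbhs_infty_ger.
rewrite (eq_integral _ _ (fun x _ => FE x)) in cv.
rewrite -(cvg_lim _ cv)//; apply: lime_le; first by apply/cvg_ex; eexists; exact: cv.
apply: nearW => n.
apply: (@prekopa_leindler_bounded s (Fn n) G H n%:R MG g h) => //.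
  by move=> x; rewrite /Fn ge_min lexx orbT.
move=> x y; apply: le_trans (FGH x y); rewrite ler_wpM2r ?powR_ge0//.
apply: ge0_ler_powR; rewrite ?nnegrE//; first by rewrite subr_ge0 ltW.
by rewrite /Fn ge_min lexx.
Unshelve. all: by end_near. Qed.

End prekopa_leindler.

(** * Borel structure of a metric space, and gluing of couplings *)

Section metric_preliminaries.
Context {R : realType} {X : completeMetricType R}.
Implicit Types (x y z : X) (r c : R).

Lemma open_mdist_lt x r : open [set y : X | mdist x y < r].
Proof.
rewrite openE => y /= xyr; rewrite /interior.
apply/nbhs_ballP; exists (r - mdist x y) => /=; first by rewrite subr_gt0.
move=> z; rewrite ballEmdist /= => yz; apply: le_lt_trans (metric_triangle x y z) _.
by rewrite -ltrBrDl.
Qed.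

Lemma open_ball x r : open (ball x r).
Proof. by rewrite ballEmdist; exact: open_mdist_lt. Qed.

Lemma open_measurable_borel (U : set X) : open U -> measurable (U : set (borel X)).
Proof. by move=> oU; exact: sub_sigma_algebra. Qed.

Lemma measurable_ball_borel x r : measurable (ball x r : set (borel X)).
Proof. by apply: open_measurable_borel; exact: open_ball. Qed.

(** Upper semicontinuity suffices, and is what an infimum of continuous
functions provides. *)
Lemma usc_measurable (f : X -> \bar R) :
  (forall c, open [set x | (f x < c%:E)%E]) -> measurable_fun setT (f : borel X -> \bar R).
Proof.
move=> of_; apply: (measurability _ (ErealGenInftyO.measurableE R)) => _ /= -[_ [c ->] <-].
rewrite setTI; apply: open_measurable_borel.
by rewrite (_ : _ @^-1` _ = [set x | (f x < c%:E)%E])//; apply/seteqP; split => x /=; rewrite in_itv.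
Qed.

Lemma continuous_measurable_borel (f : X -> R) : continuous f -> measurable_fun setT (f : borel X -> R).
Proof.
move=> cf; apply/measurable_EFinP; apply: usc_measurable => c.
rewrite (_ : [set x | _] = f @^-1` [set y | y < c]); last first.
  by apply/seteqP; split => x /=; rewrite lte_fin.
by apply: open_comp => [x _|]; [exact: cf|exact: open_lt].
Qed.

Lemma mdist_lip x y z : `|mdist x y - mdist x z| <= mdist y z.
Proof.
rewrite ler_norml; have := metric_triangle x y z; have := metric_triangle x z y.
by rewrite (metric_sym z y) => h1 h2; apply/andP; split; lra.
Qed.

Lemma measurable_mdistr x : measurable_fun setT (fun y : borel X => mdist (x : X) (y : X)).
Proof.
apply/measurable_EFinP; apply: usc_measurable => c.
rewrite (_ : [set _ | _] = [set y | mdist x y < c]); first exact: open_mdist_lt.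
by apply/seteqP; split => y /=; rewrite lte_fin.
Qed.

Lemma measurable_mdistl y : measurable_fun setT (fun x : borel X => mdist (x : X) (y : X)).
Proof.
rewrite (_ : (fun _ => _) = (fun x : borel X => mdist (y : X) (x : X))); first exact: measurable_mdistr.
by apply/funext => x; exact: metric_sym.
Qed.

Lemma dense_sequence (x0 : X) : separable (X := X) ->
  exists e : nat -> X, forall x eps, 0 < eps -> exists n, mdist (e n) x < eps.
Proof.
move=> [D /countable_injP[f injf] dD].
pose e n := xget x0 (D `&` [set d | f d = n]).
exists e => x eps eps0.
have [d [xd Dd]] : ball x eps `&` D !=set0.
  by apply: dD; [exists x; exact: ballxx|exact: open_ball].
exists (f d).
have [De fe] : (D `&` [set d' | f d' = f d]) (e (f d)) by apply: (xgetPex x0); exists d.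
have <- : d = e (f d) by apply: injf; rewrite ?inE.
by move: xd; rewrite ballEmdist/= metric_sym.
Qed.

(** The sigma-algebra on the product is generated by rectangles, so the set
d(x,y) < c must be written as a countable union of rectangles; the balls
around a dense sequence do it. *)
Lemma measurable_mdist (x0 : X) : separable (X := X) ->
  measurable_fun setT (fun z : borel X * borel X => mdist (z.1 : X) (z.2 : X)).
Proof.
move=> /(dense_sequence x0)[e eP].
apply: (measurability _ (RGenInftyO.measurableE R)) => _ /= -[_ [c ->] <-].
rewrite setTI.
rewrite (_ : _ @^-1` _ = \bigcup_n \bigcup_k
   ([set y : borel X | mdist (e n) (y : X) < k.+1%:R^-1] `*`
    [set y : borel X | mdist (e n) (y : X) < c - k.+1%:R^-1])).
  apply: bigcupT_measurable => n; apply: bigcupT_measurable => k.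
  by apply: measurableX; apply: open_measurable_borel; exact: open_mdist_lt.
apply/seteqP; split => -[x y] /=; rewrite in_itv/=.
- move=> xyc.
  have [k hk] : exists k, k.+1%:R^-1 < (c - mdist (x : X) y) / 3.
    have h : 0 < (c - mdist (x : X) y) / 3 by rewrite divr_gt0// subr_gt0.
    by have [k _ hk] := near_infty_natSinv_lt (PosNum h); exists k; have := hk k (leqnn k).
  have k0 : 0 < k.+1%:R^-1 :> R by rewrite invr_gt0 ltr0n.
  have [n hn] := eP x _ k0.
  exists n => //; exists k => //=; split => //.
  have := metric_triangle (e n) x y.
  move: hk hn k0; rewrite ltr_pdivlMr//.
  have aux (a b d dl c' : R) : dl * 3 < c' - a -> b < dl -> 0 < dl -> d <= b + a -> d < c' - dl by lra.
  exact: aux.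
- move=> [n _ [k _ [/= h1 h2]]].
  have := metric_triangle (x : X) (e n) y; rewrite (metric_sym x (e n)); move: h1 h2.
  have aux (a b d dl c' : R) : b < dl -> d < c' - dl -> a <= b + d -> a < c' by lra.
  exact: aux.
Qed.

End metric_preliminaries.

Lemma measure_bigcupT {R : realType} d (T : measurableType d) (mu : {measure set T -> \bar R})
    (F : nat -> set T) : (forall i, measurable (F i)) -> trivIset setT F ->
  mu (\bigcup_i F i) = (\sum_(i <oo) mu (F i))%E.
Proof.
move=> mF tF; rewrite measure_bigcup//.
by apply: eq_eseriesl => i; rewrite in_setT.
Qed.

Section slices.
Context {R : realType} d1 d2 (T1 : measurableType d1) (T2 : measurableType d2).
Local Open Scope ereal_scope.

Lemma ge0_integral_mrestr d (T : measurableType d) (mu : {measure set T -> \bar R})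
    (D : set T) (mD : measurable D) (f : T -> \bar R) :
  measurable_fun setT f -> (forall x, 0 <= f x) ->
  \int[mrestr mu mD]_x f x = \int[mu]_(x in D) f x.
Proof.
move=> mf f0; have mDc := measurableC mD.
rewrite -(setUv D) ge0_integral_setU//; last 2 first.
- by rewrite setUv.
- by apply/disj_setPCl.
rewrite (eq_measure_integral mu); last first.
  by move=> A mA AD; congr (mu _); apply/setIidPl.
rewrite [X in _ + X](eq_measure_integral mzero) ?integral_measure_zero ?adde0//.
move=> A mA AD; change (mu (A `&` D) = 0).
by rewrite (_ : A `&` D = set0) ?measure0//; apply/disj_set2P/disj_setPLR.
Qed.

(** The normalized image of the restriction of q to D. The defining identity is
multiplied by the mass w of D so that it also makes sense for w = 0, where
the arbitrary probability P0 is used. *)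
Lemma slice_probability d (T : measurableType d) (P0 : probability T1 R) (q : probability T R)
    (phi : T -> T1) (D : set T) (w : R) :
  measurable_fun setT phi -> measurable D -> q D = w%:E ->
  exists P : probability T1 R, forall A, measurable A -> w%:E * P A = q (phi @^-1` A `&` D).
Proof.
move=> mphi mD qD.
have w0 : (0 <= w)%R by rewrite -lee_fin -qD measure_ge0.
have [w00|w0'] := eqVneq w 0%R.
  exists P0 => A mA; rewrite w00 mul0e; apply/esym/eqP; rewrite eq_le measure_ge0 andbT.
  rewrite -[leRHS]/(0%R%:E) -w00 -qD le_measure// ?inE//.
  by apply: measurableI => //; rewrite -[X in measurable X]setTI; exact: mphi.
pose nu0 : {measure set T1 -> \bar R} :=
  measure_function_pushforward__canonical__measure_function_Measure (mrestr q mD) mphi.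
exists (mnormalize nu0 P0) => A mA.
have nuE B : nu0 B = q (phi @^-1` B `&` D) by [].
rewrite /= /mnormalize/= -/nu0 nuE preimage_setT setTI qD.
have -> : ((w%:E == 0) || (w%:E == +oo)) = false.
  by apply/negbTE; rewrite negb_or eqe w0'.
by rewrite muleC nuE -muleA -EFinM mulVf// mule1.
Qed.

Lemma ge0_integral_slice d (T : measurableType d) (P : probability T1 R) (q : probability T R)
    (phi : T -> T1) (D : set T) (w : R) (f : T1 -> \bar R) : (0 <= w)%R ->
  measurable_fun setT phi -> measurable D ->
  (forall A, measurable A -> w%:E * P A = q (phi @^-1` A `&` D)) ->
  measurable_fun setT f -> (forall x, 0 <= f x) ->
  w%:E * \int[P]_x f x = \int[q]_(z in D) f (phi z).
Proof.
move=> w0 mphi mD PE mf f0.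
have mf1 : measurable_fun setT (fun z => f (phi z)) by exact: measurableT_comp.
rewrite -(ge0_integral_mrestr q mD)//.
rewrite -(ge0_integral_mscale P measurableT (NngNum w0) mf (fun x _ => f0 x)).
have := @ge0_integral_pushforward _ _ _ _ R _ mphi (mrestr q mD) setT f measurableT mf (fun _ _ => f0 _).
rewrite preimage_setT => <-.
apply/esym; apply: (eq_measure_integral (mscale (NngNum w0) P)) => A mA _.
exact: esym (PE _ mA).
Qed.

End slices.

Section gluing.
Context {R : realType} {X : completeMetricType R}.
Local Open Scope ereal_scope.
Implicit Types mu nu : probability (borel X) R.

Lemma probability_mixture d (T : measurableType d) (P : nat -> probability T R) (w : nat -> R) :
  (forall i, (0 <= w i)%R) -> \sum_(i <oo) (w i)%:E = 1 ->
  exists Q : probability T R,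
    (forall A, measurable A -> Q A = \sum_(i <oo) (w i)%:E * P i A) /\
    (forall f : T -> \bar R, measurable_fun setT f -> (forall x, 0 <= f x) ->
      \int[Q]_x f x = \sum_(i <oo) (w i)%:E * \int[P i]_x f x).
Proof.
move=> w0 w1.
pose m_ i : {measure set T -> \bar R} := mscale (NngNum (w0 i)) (P i).
pose Q0 : {measure set T -> \bar R} := mseries m_ 0.
have Q1 : Q0 setT = 1.
  rewrite /Q0/= /mseries -w1; apply: eq_eseriesr => i _.
  by rewrite /m_/= /mscale/= [X in _ * X]probability_setT mule1.
pose Qm := Measure_isProbability.Build _ _ _ Q0 Q1.
pose Q : probability T R := HB.pack (Measure.sort Q0) Qm.
exists Q; split => [A mA|f mf f0].
  by [].
transitivity (\int[mseries m_ 0]_x f x); first by [].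
rewrite ge0_integral_measure_series//; apply: eq_eseriesr => i _.
by rewrite /m_ ge0_integral_mscale.
Qed.

(** Gluing q1 and q2 along their common marginal nu would require to
disintegrate them with respect to nu. Here nu is cut into countably many cells
C i, and on each cell the two conditional measures are coupled independently;
this only needs the slices of q1 and q2 over C i. The functions a i and b i are
upper bounds for the two costs seen from the cell i, and c i is a gain collected
when the cell i is used to go from A to B. *)
Lemma discrete_gluing (A B : set (borel X)) mu0 nu mu1 (q1 q2 : probability (borel X * borel X)%type R)
  (C : nat -> set (borel X)) (a b : nat -> borel X -> \bar R) (F : borel X * borel X -> \bar R) (c : nat -> R) :
  coupling mu0 nu q1 -> coupling nu mu1 q2 ->
  measurable A -> measurable B -> mu0 A = 1 -> mu1 B = 1 ->
  (forall i, measurable (C i)) -> trivIset setT C -> \bigcup_i C i = setT ->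
  (forall i, measurable_fun setT (a i)) -> (forall i, measurable_fun setT (b i)) ->
  (forall i x, 0 <= a i x) -> (forall i x, 0 <= b i x) ->
  measurable_fun setT F -> (forall z, 0 <= F z) -> (forall i, (0 <= c i)%R) ->
  (forall i x y, F (x, y) + (c i)%:E * ((\1_A x : R)%:E * (\1_B y : R)%:E) <= a i x + b i y) ->
  exists2 pi, coupling mu0 mu1 pi &
   \int[pi]_z F z + \sum_(i <oo) (c i)%:E * nu (C i) <=
   \sum_(i <oo) \int[q1]_(z in setT `*` C i) a i z.1 +
   \sum_(i <oo) \int[q2]_(z in C i `*` setT) b i z.2.
Proof.
move=> q1P q2P mA mB mu0A mu1B mC tC CT ma mb a0 b0 mF F0 c0 Fab.
pose w i := fine (nu (C i)).
have wE i : (w i)%:E = nu (C i) by rewrite fineK// fin_num_measure.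
have w0 i : (0 <= w i)%R by rewrite fine_ge0.
have w1 : \sum_(i <oo) (w i)%:E = 1.
  rewrite (eq_eseriesr (fun i _ => wE i)) -(probability_setT nu) -CT.
  exact/esym/measure_bigcupT.
have mTC i : measurable ([set: borel X] `*` C i) by exact: measurableX.
have mCT i : measurable (C i `*` [set: borel X]) by exact: measurableX.
have /choice[P PE] i : exists P : probability (borel X) R,
   forall E, measurable E -> (w i)%:E * P E = q1 (fst @^-1` E `&` (setT `*` C i)).
  apply: (slice_probability mu0) => //.
  by rewrite (q1P _ (mC i)).2 wE.
have /choice[Q QE] i : exists P : probability (borel X) R,
   forall E, measurable E -> (w i)%:E * P E = q2 (snd @^-1` E `&` (C i `*` setT)).
  apply: (slice_probability mu0) => //.
  by rewrite (q2P _ (mC i)).1 wE.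
have [pi [piE piI]] := probability_mixture (fun i => (P i \x Q i)%E) w0 w1.
have cov y : exists i, C i y.
  by have : setT y by []; rewrite -[X in X y]CT => -[i _ Ciy]; exists i.
exists pi.
  move=> E mE; split.
  - rewrite piE; last exact: measurableX.
    transitivity (\sum_(i <oo) q1 (fst @^-1` E `&` (setT `*` C i))).
      apply: eq_eseriesr => i _; rewrite -PE//.
      congr (_ * _); apply: etrans (product_measure1E _ _ mE measurableT) _.
      by rewrite [X in _ * X]probability_setT mule1.
    rewrite -(q1P _ mE).1 -measure_bigcupT//=.
    + congr (q1 _); apply/seteqP; split => -[x y] /=; first by move=> [i _ [Ex _]]; split.
      by move=> [Ex _]; have [i Ciy] := cov y; exists i.
    + by move=> i; apply: measurableI => //; rewrite -[X in measurable X]setTI; exact: measurable_fst.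
    + move=> i j _ _ [[x y] [[_ [_ Ciy]] [_ [_ Cjy]]]]; apply: tC => //; by exists y.
  - rewrite piE; last exact: measurableX.
    transitivity (\sum_(i <oo) q2 (snd @^-1` E `&` (C i `*` setT))).
      apply: eq_eseriesr => i _; rewrite -QE//.
      congr (_ * _); apply: etrans (product_measure1E _ _ measurableT mE) _.
      by rewrite [X in X * _]probability_setT mul1e.
    rewrite -(q2P _ mE).2 -measure_bigcupT//=.
    + congr (q2 _); apply/seteqP; split => -[x y] /=; first by move=> [i _ [Ey _]]; split.
      by move=> [_ Ey]; have [i Ciy] := cov x; exists i.
    + by move=> i; apply: measurableI => //; rewrite -[X in measurable X]setTI; exact: measurable_snd.
    + move=> i j _ _ [[x y] [[_ [Ciy _]] [_ [Cjy _]]]]; apply: tC => //; by exists x.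
(* every slice with positive mass starts in A and ends in B almost surely *)
have PA i : (w i)%:E * P i A = (w i)%:E.
  apply/eqP; rewrite eq_le; apply/andP; split.
    by rewrite -[leRHS]mule1 lee_wpmul2l ?lee_fin// probability_le1.
  have q1A : q1 (~` A `*` setT) = 0.
    by rewrite (q1P _ (measurableC mA)).1 probability_setC// mu0A subee.
  have mfA : measurable (fst @^-1` A : set (borel X * borel X)).
    by rewrite -[X in measurable X]setTI; exact: measurable_fst.
  rewrite PE// {1}wE -(q1P _ (mC i)).2.
  rewrite -[leRHS]adde0 -q1A.
  apply: le_trans (measureU2 _ _ _) => //; last 2 first.
  - exact: measurableI.
  - by apply: measurableX => //; exact: measurableC.
  rewrite le_measure ?inE//.
    by apply: measurableU; [exact: measurableI|apply: measurableX => //; exact: measurableC].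
  by move=> [x y] [_ /= Ciy]; have [Ax|nAx] := pselect (A x); [left|right].
have QB i : (w i)%:E * Q i B = (w i)%:E.
  apply/eqP; rewrite eq_le; apply/andP; split.
    by rewrite -[leRHS]mule1 lee_wpmul2l ?lee_fin// probability_le1.
  have q2B : q2 (setT `*` ~` B) = 0.
    by rewrite (q2P _ (measurableC mB)).2 probability_setC// mu1B subee.
  have mfB : measurable (snd @^-1` B : set (borel X * borel X)).
    by rewrite -[X in measurable X]setTI; exact: measurable_snd.
  rewrite QE// {1}wE -(q2P _ (mC i)).1.
  rewrite -[leRHS]adde0 -q2B.
  apply: le_trans (measureU2 _ _ _) => //; last 2 first.
  - exact: measurableI.
  - by apply: measurableX => //; exact: measurableC.
  rewrite le_measure ?inE//.
    by apply: measurableU; [exact: measurableI|apply: measurableX => //; exact: measurableC].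
  by move=> [x y] [/= Ciy _]; have [By|nBy] := pselect (B y); [left|right].
have P1 i : P i setT = 1 := probability_setT (P i).
have Q1 i : Q i setT = 1 := probability_setT (Q i).
rewrite piI//.
rewrite -nneseriesD; last 2 first.
- by move=> i _ _; rewrite mule_ge0 ?lee_fin// integral_ge0.
- by move=> i _ _; rewrite mule_ge0 ?lee_fin.
rewrite -nneseriesD; last 2 first.
- by move=> i _ _; rewrite integral_ge0.
- by move=> i _ _; rewrite integral_ge0.
apply: lee_nneseries => [i _ _|i _].
  by rewrite adde_ge0 ?mule_ge0 ?lee_fin// integral_ge0.
rewrite -(ge0_integral_slice (w0 i) measurable_fst (mTC i) (PE i) (ma i) (a0 i)).
rewrite -(ge0_integral_slice (w0 i) measurable_snd (mCT i) (QE i) (mb i) (b0 i)).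
rewrite -wE.
have ma1 : measurable_fun setT (fun z : borel X * borel X => a i z.1).
  by apply: measurableT_comp => //; exact: measurable_fst.
have mb1 : measurable_fun setT (fun z : borel X * borel X => b i z.2).
  by apply: measurableT_comp => //; exact: measurable_snd.
have mA1 : measurable_fun setT (fun z : borel X * borel X => (\1_A z.1 : R)%:E).
  by apply/measurable_EFinP; apply: measurableT_comp; [exact: measurable_indic|exact: measurable_fst].
have mB1 : measurable_fun setT (fun z : borel X * borel X => (\1_B z.2 : R)%:E).
  by apply/measurable_EFinP; apply: measurableT_comp; [exact: measurable_indic|exact: measurable_snd].
have mAB : measurable_fun setT (fun z : borel X * borel X => (\1_A z.1 : R)%:E * (\1_B z.2 : R)%:E).
  exact: emeasurable_funM.
have AB0 (z : borel X * borel X) : 0 <= (\1_A z.1 : R)%:E * (\1_B z.2 : R)%:E by rewrite mule_ge0// lee_fin.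
have main : \int[P i \x Q i]_z F z + (c i)%:E * (P i A * Q i B) <= \int[P i]_x a i x + \int[Q i]_x b i x.
  have -> : \int[P i]_x a i x = \int[P i \x Q i]_z a i z.1.
    rewrite (fubini_tonelli1 (fun z : borel X * borel X => a i z.1))//.
    by apply: eq_integral => x _; rewrite /fubini_F/= integral_cst// [X in _ * X]Q1 mule1.
  have -> : \int[Q i]_x b i x = \int[P i \x Q i]_z b i z.2.
    rewrite (fubini_tonelli2 (fun z : borel X * borel X => b i z.2))//.
    by apply: eq_integral => x _; rewrite /fubini_G/= integral_cst// [X in _ * X]P1 mule1.
  have -> : (c i)%:E * (P i A * Q i B) = \int[P i \x Q i]_z ((c i)%:E * ((\1_A z.1 : R)%:E * (\1_B z.2 : R)%:E)).
    rewrite ge0_integralZl//; last by rewrite lee_fin.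
    congr (_ * _); rewrite -product_measure1E// -[X in _ X = _]setIT.
    have mABs : measurable (A `*` B) by exact: measurableX.
    rewrite -(integral_indic (P i \x Q i)%E measurableT mABs).
    apply: eq_integral => -[x y] _ /=; rewrite -EFinM !indicE in_setX/=.
    by case: (x \in A); rewrite ?mul1r ?mul0r.
  rewrite -ge0_integralD//; last 2 first.
  - by move=> z _; rewrite mule_ge0// lee_fin.
  - exact: measurable_funeM.
  rewrite -ge0_integralD//.
  apply: ge0_le_integral => //.
  - by move=> z _; rewrite adde_ge0// mule_ge0// lee_fin.
  - by apply: emeasurable_funD => //; exact: measurable_funeM.
  - exact: emeasurable_funD.
  - by move=> [x y] _; exact: Fab.
have key : (w i)%:E * ((c i)%:E * (P i A * Q i B)) = (w i)%:E * (c i)%:E.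
  by rewrite muleCA (muleA (w i)%:E) PA QB muleC.
rewrite (muleC (c i)%:E) -key.
rewrite -ge0_muleDr; last 2 first.
- by rewrite integral_ge0.
- by rewrite !mule_ge0 ?lee_fin.
rewrite -ge0_muleDr ?integral_ge0//.
by apply: lee_wpmul2l; rewrite ?lee_fin.
Qed.

End gluing.

(** * Intermediate points of Wasserstein geodesics *)

Section midpoint_inequalities.
Context {R : realType}.
Implicit Types (a b D s l : R).

(** The convexity inequality behind the fact that a Wasserstein geodesic
moves mass at constant speed: equality holds for a = s D and b = (1 - s) D. *)
Lemma intermediate_sqr a b D s : 0 < s -> s < 1 -> 0 <= D -> D <= a + b ->
  D ^+ 2 <= a ^+ 2 / s + b ^+ 2 / (1 - s).
Proof.
move=> s0 s1 D0 Dab.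
have s1' : 0 < 1 - s by rewrite subr_gt0.
have h : D ^+ 2 <= (a + b) ^+ 2 by rewrite ler_sqr ?nnegrE// (le_trans D0).
apply: (le_trans h); rewrite -subr_ge0.
have -> : a ^+ 2 / s + b ^+ 2 / (1 - s) - (a + b) ^+ 2 =
    ((1 - s) * a - s * b) ^+ 2 / (s * (1 - s)).
  by field; rewrite !gt_eqF.
by rewrite divr_ge0 ?sqr_ge0// mulr_ge0 ?ltW.
Qed.

(** A quantitative form: an intermediate point at distance a >= l > s Dm from
the starting point costs a fixed amount more than an optimal one. *)
Lemma intermediate_sqr_gap a b D Dm l s : 0 < s -> s < 1 -> 0 <= a -> 0 <= b -> 0 <= D ->
  D <= a + b -> D <= Dm -> s * Dm <= l -> l <= a ->
  D ^+ 2 + (1 - s) / s * (l - s * Dm) ^+ 2 <= a ^+ 2 / s + b ^+ 2 / (1 - s).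
Proof.
move=> s0 s1 a0 b0 D0 Dab DDm sl la.
have s1' : 0 < 1 - s by rewrite subr_gt0.
have key : s * (1 - s) * D ^+ 2 + (1 - s) ^+ 2 * (l - s * Dm) ^+ 2 <=
    (1 - s) * a ^+ 2 + s * b ^+ 2.
  set g := l - s * Dm.
  have g0 : 0 <= g by rewrite subr_ge0.
  have sDm : s * D <= s * Dm by rewrite ler_pM2l.
  have [aD|Da] := leP a D.
    have hb : (D - a) ^+ 2 <= b ^+ 2 by rewrite ler_sqr ?nnegrE; lra.
    have hg : g ^+ 2 <= (a - s * D) ^+ 2 by rewrite ler_sqr ?nnegrE /g; lra.
    have hs : (1 - s) ^+ 2 * g ^+ 2 <= g ^+ 2.
      by rewrite ler_piMl ?sqr_ge0// expr_le1//; lra.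
    have hsb : s * (D - a) ^+ 2 <= s * b ^+ 2 by rewrite ler_pM2l.
    have E : (1 - s) * a ^+ 2 + s * (D - a) ^+ 2 = s * (1 - s) * D ^+ 2 + (a - s * D) ^+ 2 by ring.
    lra.
  have hD : s * (1 - s) * D ^+ 2 <= s * (1 - s) * a ^+ 2.
    by rewrite ler_pM2l ?mulr_gt0// ler_sqr ?nnegrE// ltW.
  have Dm0 : 0 <= s * Dm by apply: mulr_ge0; [exact: ltW|exact: le_trans D0 DDm].
  have hg : (1 - s) ^+ 2 * g ^+ 2 <= (1 - s) ^+ 2 * a ^+ 2.
    by rewrite ler_wpM2l ?sqr_ge0// ler_sqr ?nnegrE// /g; lra.
  have hb : 0 <= s * b ^+ 2 by rewrite mulr_ge0 ?sqr_ge0// ltW.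
  have E : s * (1 - s) * a ^+ 2 + (1 - s) ^+ 2 * a ^+ 2 = (1 - s) * a ^+ 2 by ring.
  lra.
have ss : 0 < s * (1 - s) by rewrite mulr_gt0.
rewrite -(ler_pM2l ss).
have -> : s * (1 - s) * (D ^+ 2 + (1 - s) / s * (l - s * Dm) ^+ 2) =
   s * (1 - s) * D ^+ 2 + (1 - s) ^+ 2 * (l - s * Dm) ^+ 2.
  by field; rewrite gt_eqF.
have -> // : s * (1 - s) * (a ^+ 2 / s + b ^+ 2 / (1 - s)) = (1 - s) * a ^+ 2 + s * b ^+ 2.
by field; rewrite !gt_eqF.
Qed.

End midpoint_inequalities.

Section intermediate_points.
Context {R : realType} {X : completeMetricType R}.
Implicit Types (A B : set X) (mu nu : probability (borel X) R).

Definition enlargement A (l : R) : set X := \bigcup_(x in A) ball x l.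

Lemma open_enlargement A l : open (enlargement A l).
Proof. by apply: bigcup_open => x _; exact: open_ball. Qed.

Lemma measurable_enlargement A l : measurable (enlargement A l : set (borel X)).
Proof. by apply: open_measurable_borel; exact: open_enlargement. Qed.

Hypothesis sepX : separable (X := X).
Variable x0 : X.

Let d2 (z : borel X * borel X) : \bar R := (mdist (z.1 : X) (z.2 : X) ^+ 2)%:E.

Let d2_ge0 z : (0 <= d2 z)%E. Proof. by rewrite lee_fin sqr_ge0. Qed.

Let measurable_d2 : measurable_fun setT d2.
Proof. by apply/measurable_EFinP; apply: measurable_funX; exact: (measurable_mdist x0 sepX). Qed.

Let cost mu nu := ereal_inf [set (\int[q]_z d2 z)%E | q in coupling mu nu].

Let cost_ge0 mu nu : (0 <= cost mu nu)%E.
Proof. by apply: le_ereal_inf_tmp => _ [q _ <-]; exact: integral_ge0. Qed.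

Let product_coupling mu nu : coupling mu nu (mu \x nu)%E.
Proof.
move=> E mE; split.
  apply: etrans (product_measure1E _ _ mE measurableT) _.
  by rewrite [X in (_ * X)%E]probability_setT mule1.
apply: etrans (product_measure1E _ _ measurableT mE) _.
by rewrite [X in (X * _)%E]probability_setT mul1e.
Qed.

Let cost_bounded mu nu A B (D : R) : measurable (A : set (borel X)) -> measurable (B : set (borel X)) ->
  mu A = 1%E -> nu B = 1%E ->
  (forall x y, A x -> B y -> mdist x y <= D) -> (cost mu nu <= (D ^+ 2)%:E)%E.
Proof.
move=> mA mB muA nuB AB.
pose q : probability (borel X * borel X)%type R := (mu \x nu)%E.
have mAB : measurable (A `*` B : set (borel X * borel X)) by exact: measurableX.
have qAB : q (A `*` B) = 1%E.
  by apply: etrans (product_measure1E _ _ mA mB) _; rewrite [X in (X * _)%E]muA [X in (_ * X)%E]nuB mule1.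
have qABc : q (~` (A `*` B)) = 0%E by rewrite probability_setC// qAB subee.
apply: (@le_trans _ _ (\int[q]_z d2 z)%E).
  by apply: ereal_inf_lbound; exists q => //; exact: product_coupling.
rewrite -(setUv (A `*` B)) ge0_integral_setU//; last 3 first.
- exact: measurableC.
- by rewrite setUv.
- by apply/disj_setPCl.
rewrite [X in (_ + X)%E](_ : _ = 0%E) ?adde0; last first.
  apply: null_set_integral => //; first exact: measurableC.
  exact: measurable_funTS.
apply: (@le_trans _ _ (\int[q]_(z in A `*` B) (cst (D ^+ 2)%:E) z)%E).
  apply: ge0_le_integral => //.
  - exact: measurable_funTS.
  move=> [x y] [/= Ax By]; rewrite lee_fin ler_sqr ?nnegrE ?mdist_ge0 ?AB//.
  by apply: le_trans (AB _ _ Ax By); exact: mdist_ge0.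
by rewrite integral_cst// [X in (_ * X)%E](_ : _ = 1%E) ?mule1//.
Qed.

(** If a positive mass of the intermediate measure G s were at distance at least
l > s D from A, then gluing almost optimal couplings of (G 0, G s) and (G s, G 1)
would give a coupling of (G 0, G 1) cheaper than the Wasserstein distance, by
the gap of the previous inequality. The gluing is done over cells of
radius dl, whose error tends to 0 with dl while the gap does not. *)
Lemma geodesic_intermediate_support (G : R -> probability (borel X) R) A B (D s l : R) :
  W2_geodesic G -> measurable (A : set (borel X)) -> measurable (B : set (borel X)) ->
  G 0 A = 1%E -> G 1 B = 1%E ->
  (forall x y, A x -> B y -> mdist x y <= D) ->
  0 < s -> s < 1 -> s * D < l ->
  G s (~` enlargement A l) = 0%E.
Proof.
move=> geoG mA mB GA GB AB s0 s1 sDl.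
have s1' : 0 < 1 - s by rewrite subr_gt0.
have c01 := cost_bounded mA mB GA GB AB.
have [i iE] : exists i, cost (G 0) (G 1) = i%:E.
  exists (fine (cost (G 0) (G 1))); rewrite fineK// ge0_fin_numE//.
  by apply: le_lt_trans c01 _; rewrite ltry.
have i0 : 0 <= i by rewrite -lee_fin -iE.
have sqrt2 (j : R) : 0 <= j -> (j `^ 2^-1) ^+ 2 = j.
  by move=> j0; rewrite -powR_mulrn ?powR_ge0// -powRrM mulVf ?powRr1.
have W2E u v : u \in `[0, 1] -> v \in `[0, 1] -> cost (G u) (G v) = (`|u - v| ^+ 2 * i)%:E.
  move=> u01 v01; have := geoG u v u01 v01.
  rewrite /W2 -/(cost (G u) (G v)) -/(cost (G 0) (G 1)) iE poweR_EFin -EFinM.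
  have := cost_ge0 (G u) (G v); case: (cost _ _) => [j| |] // j0.
    rewrite poweR_EFin => -[] /(congr1 (fun x => x ^+ 2)).
    by rewrite exprMn !sqrt2// => ->.
  by rewrite poweRyr.
have in0 : (0 : R) \in `[0, 1] by rewrite in_itv/= lexx ler01.
have in1 : (1 : R) \in `[0, 1] by rewrite in_itv/= lexx ler01.
have ins : s \in `[0, 1] by rewrite in_itv/= (ltW s0) (ltW s1).
have c0s : cost (G 0) (G s) = (s ^+ 2 * i)%:E by rewrite W2E// sub0r normrN gtr0_norm.
have cs1 : cost (G s) (G 1) = ((1 - s) ^+ 2 * i)%:E.
  by rewrite W2E// distrC gtr0_norm.
(* the middle level leaves room for the error made by replacing a cell by its centre *)
pose l' := (l + s * D) / 2.
have l'1 : s * D < l' by rewrite /l'; lra.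
have l'2 : l' < l by rewrite /l'; lra.
pose c := (1 - s) / s * (l' - s * D) ^+ 2.
have c0 : 0 < c by rewrite /c mulr_gt0 ?divr_gt0// exprn_gt0// subr_gt0.
pose kappa := s^-1 + (1 - s)^-1.
have kappa0 : 0 < kappa by rewrite addr_gt0 ?invr_gt0.
set Bad := ~` _.
have mBad : measurable (Bad : set (borel X)) by apply: measurableC; exact: measurable_enlargement.
have main dl : 0 < dl -> dl <= 1 -> dl <= l - l' ->
    (c%:E * G s Bad <= (dl * (i + 4 * kappa))%:E)%E.
  move=> dl0 dl1 dll.
  have [e eP] := dense_sequence x0 sepX.
  pose U n : set (borel X) := ball (e n) dl.
  pose C := seqDU U.
  have mU n : measurable (U n) by exact: measurable_ball_borel.
  have mC n : measurable (C n).
    by apply: measurableD => //; apply: bigsetU_measurable => k _.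
  have tC : trivIset setT C := @trivIset_seqDU _ U.
  have CT : \bigcup_n C n = setT.
    rewrite -seqDU_bigcup_eq; apply/seteqP; split => x // _.
    by have [n hn] := eP x _ dl0; exists n => //; rewrite /U ballEmdist.
  have Cdist n (z : X) : C n z -> mdist (e n) z < dl.
    by rewrite /C /seqDU /U ballEmdist => -[].
  have adh mu nu (j : R) : cost mu nu = j%:E ->
     exists2 q, coupling mu nu q & (\int[q]_z d2 z <= (j + dl)%:E)%E.
    move=> jE.
    have [|_ [q qP <-] hq] := @lb_ereal_inf_adherent _ [set (\int[q]_z d2 z)%E | q in coupling mu nu] dl dl0.
      by rewrite -/(cost mu nu) jE.
    by exists q => //; apply: ltW; move: hq; rewrite -/(cost mu nu) jE -EFinD.
  have [q1 q1P q1c] := adh _ _ _ c0s.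
  have [q2 q2P q2c] := adh _ _ _ cs1.
  (* cells whose centre is far from A; they cover the set under consideration *)
  pose bad n := `[< forall x, A x -> l' <= mdist x (e n) >].
  pose cc n : R := if bad n then c else 0.
  pose a n (x : borel X) : \bar R := (mdist (x : X) (e n) ^+ 2 / s)%:E.
  pose b n (y : borel X) : \bar R := (mdist (e n) (y : X) ^+ 2 / (1 - s))%:E.
  have [||||||||pi piP] := @discrete_gluing R X A B (G 0) (G s) (G 1) q1 q2 C a b d2 cc q1P q2P mA mB GA GB mC tC CT.
  - move=> n; apply/measurable_EFinP; apply: measurable_funM => //.
    by apply: measurable_funX; exact: measurable_mdistl.
  - move=> n; apply/measurable_EFinP; apply: measurable_funM => //.
    by apply: measurable_funX; exact: measurable_mdistr.
  - by move=> n x; rewrite lee_fin divr_ge0 ?sqr_ge0// ltW.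
  - by move=> n x; rewrite lee_fin divr_ge0 ?sqr_ge0// ltW.
  - exact: measurable_d2.
  - exact: d2_ge0.
  - by move=> n; rewrite /cc; case: ifP => // _; exact: ltW.
  - move=> n x y; rewrite /d2 /a /b /= -!EFinM -!EFinD lee_fin !indicE /cc.
    have tri := metric_triangle (x : X) (e n) (y : X).
    have base := intermediate_sqr s0 s1 (mdist_ge0 _ _) tri.
    case: ifP => [/asboolP badn|_]; last by rewrite mul0r addr0.
    have [Ax|nAx] := boolP (x \in A); last by rewrite mul0r mulr0 addr0.
    have [By|nBy] := boolP (y \in B); last by rewrite !mulr0 addr0.
    rewrite !mulr1; move: Ax By; rewrite !inE => Ax By.
    apply: intermediate_sqr_gap => //; rewrite ?mdist_ge0//.
    - exact: AB.
    - exact: ltW.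
    - exact: badn.
  move=> glue.
  have lower : (i%:E + c%:E * G s Bad <= \int[pi]_z d2 z + \sum_(n <oo) (cc n)%:E * G s (C n))%E.
    apply: leeD.
      by rewrite -iE; apply: ereal_inf_lbound; exists pi.
    pose C' n := if bad n then C n else set0.
    have mC' n : measurable (C' n) by rewrite /C'; case: ifP.
    have -> : (\sum_(n <oo) (cc n)%:E * G s (C n) = c%:E * \sum_(n <oo) G s (C' n))%E.
      rewrite -nneseriesZl//.
      apply: eq_eseriesr => n _; rewrite /cc /C'; case: ifP => // _.
      by rewrite mul0e measure0 mule0.
    rewrite -measure_bigcupT//; last first.
      move=> n k _ _ [z]; rewrite /C'; case: ifP => _ [] //; case: ifP => _ // Cz Cz'.
      by apply: tC => //; exists z.
    apply: lee_wpmul2l; first by rewrite lee_fin ltW.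
    rewrite le_measure ?inE//; first exact: bigcupT_measurable.
    move=> z; rewrite /Bad => badz.
    have : setT z by []; rewrite -CT => -[n _ Cnz]; exists n => //.
    rewrite /C' ifT//; apply/asboolP => x Ax.
    have : l <= mdist x z.
      rewrite leNgt; apply/negP => xz; apply: badz; exists x => //.
      by rewrite ballEmdist.
    have := metric_triangle x (e n) z; have := Cdist _ _ Cnz.
    move=> h1 h2 h3; lra.
  (* replacing points by cell centres changes the squared cost by O(dl) only *)
  have upper (q : probability (borel X * borel X)%type R) (j r : R) (V : nat -> set (borel X * borel X))
      (f : nat -> borel X * borel X -> R) :
      0 < r -> (\int[q]_z d2 z <= (j + dl)%:E)%E -> (forall n, measurable (V n)) ->
      trivIset setT V -> (forall n, measurable_fun setT (f n)) -> (forall n z, 0 <= f n z) ->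
      (forall n z, V n z -> f n z <= mdist (z.1 : X) (z.2 : X) + dl) ->
      (\sum_(n <oo) \int[q]_(z in V n) (f n z ^+ 2 / r)%:E <= (((1 + dl) * (j + dl) + 2 * dl) / r)%:E)%E.
    move=> r0 qj mV tV mf f0 fV.
    pose h (z : borel X * borel X) : R := ((1 + dl) * mdist (z.1 : X) (z.2 : X) ^+ 2 + 2 * dl) / r.
    have h0 z : 0 <= h z.
      have dl0' := ltW dl0.
      by rewrite divr_ge0 ?(ltW r0)// addr_ge0// mulr_ge0 ?sqr_ge0// addr_ge0.
    have mh : measurable_fun setT h.
      apply: measurable_funM => //; apply: measurable_funD => //; apply: measurable_funM => //.
      by apply: measurable_funX; exact: (measurable_mdist x0 sepX).
    apply: (@le_trans _ _ (\sum_(n <oo) \int[q]_(z in V n) (h z)%:E)%E).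
      apply: lee_nneseries => [n _ _|n _].
        by apply: integral_ge0 => z _; rewrite lee_fin divr_ge0 ?sqr_ge0// ltW.
      apply: ge0_le_integral => //.
      + by move=> z _; rewrite lee_fin divr_ge0 ?sqr_ge0// ltW.
      + apply/measurable_funTS/measurable_EFinP; apply: measurable_funM => //.
        exact: measurable_funX.
      + exact/measurable_funTS/measurable_EFinP.
      move=> z Vz; rewrite lee_fin /h ler_pM2r ?invr_gt0//.
      apply: (@le_trans _ _ ((mdist (z.1 : X) (z.2 : X) + dl) ^+ 2)).
        by rewrite ler_sqr ?nnegrE ?f0 ?fV// addr_ge0 ?mdist_ge0// ltW.
      move: (mdist (z.1 : X) (z.2 : X)) => t.
      have : 0 <= dl * (t - 1) ^+ 2 by rewrite mulr_ge0 ?sqr_ge0// ltW.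
      have : dl ^+ 2 <= dl by rewrite expr2 ler_piMl// ltW.
      have -> : dl * (t - 1) ^+ 2 = dl * t ^+ 2 - 2 * (dl * t) + dl by ring.
      have -> : (t + dl) ^+ 2 = t ^+ 2 + 2 * (dl * t) + dl ^+ 2 by ring.
      have -> : (1 + dl) * t ^+ 2 = t ^+ 2 + dl * t ^+ 2 by ring.
      by move=> H1 H2; lra.
    rewrite -ge0_integral_bigcup//; last 2 first.
    - exact/measurable_funTS/measurable_EFinP.
    - by move=> z _; rewrite lee_fin.
    apply: (@le_trans _ _ (\int[q]_z (h z)%:E)%E).
      apply: ge0_subset_integral => //; first exact: bigcupT_measurable.
      - exact/measurable_EFinP.
      - by move=> z _; rewrite lee_fin.
    have -> : (\int[q]_z (h z)%:E = ((1 + dl) / r)%:E * \int[q]_z d2 z + (2 * dl / r)%:E)%E.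
      rewrite -ge0_integralZl//; last by rewrite lee_fin divr_ge0 ?addr_ge0 ?(ltW dl0) ?(ltW r0).
      have <- : (\int[q]_z (cst (2 * dl / r)%:E) z = (2 * dl / r)%:E)%E.
        by rewrite integral_cst// [X in (_ * X)%E]probability_setT mule1.
      rewrite -ge0_integralD//; last 3 first.
      - by move=> z _; rewrite mule_ge0// lee_fin divr_ge0 ?addr_ge0 ?(ltW dl0) ?(ltW r0).
      - exact: measurable_funeM.
      - by move=> z _; rewrite lee_fin !mulr_ge0 ?invr_ge0// ltW.
      apply: eq_integral => z _; rewrite /h /d2 /= -EFinM -EFinD; congr EFin.
      by field; rewrite gt_eqF.
    apply: (@le_trans _ _ (((1 + dl) / r)%:E * (j + dl)%:E + (2 * dl / r)%:E)%E).
      by rewrite leeD2r// lee_wpmul2l// lee_fin divr_ge0 ?addr_ge0 ?(ltW dl0) ?(ltW r0).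
    rewrite -EFinM -EFinD lee_fin le_eqVlt; apply/orP; left; apply/eqP.
    by field; rewrite gt_eqF.
  have u1 := upper q1 (s ^+ 2 * i) s (fun n => setT `*` C n) (fun n z => mdist (z.1 : X) (e n)) s0 q1c.
  have u2 := upper q2 ((1 - s) ^+ 2 * i) (1 - s) (fun n => C n `*` setT) (fun n z => mdist (e n) (z.2 : X)) s1' q2c.
  have {}u1 := u1 _ _ _ _ _.
  have {}u2 := u2 _ _ _ _ _.
  have rest : (i%:E + c%:E * G s Bad <= (((1 + dl) * (s ^+ 2 * i + dl) + 2 * dl) / s)%:E +
       (((1 + dl) * ((1 - s) ^+ 2 * i + dl) + 2 * dl) / (1 - s))%:E)%E.
    apply: (le_trans lower); apply: (le_trans glue); apply: leeD.
      apply: u1.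
      - by move=> n; exact: measurableX.
      - by move=> n k _ _ [[x y] [[_ /= C1] [_ /= C2]]]; apply: tC => //; exists y.
      - move=> n; apply: (@measurableT_comp _ _ _ _ _ _ (fun x : borel X => mdist (x : X) (e n))).
          exact: measurable_mdistl.
        exact: measurable_fst.
      - by move=> n z; exact: mdist_ge0.
      - move=> n [x y] [_ /= Cy]; apply: (le_trans (metric_triangle _ y _)).
        by rewrite lerD2l (metric_sym y) ltW// Cdist.
    apply: u2.
    - by move=> n; exact: measurableX.
    - by move=> n k _ _ [[x y] [[/= C1 _] [/= C2 _]]]; apply: tC => //; exists x.
    - move=> n; apply: (@measurableT_comp _ _ _ _ _ _ (fun y : borel X => mdist (e n) (y : X))).
        exact: measurable_mdistr.
      exact: measurable_snd.
    - by move=> n z; exact: mdist_ge0.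
    - move=> n [x y] [/= Cx _]; apply: (le_trans (metric_triangle _ x _)).
      by rewrite addrC lerD2l ltW// Cdist.
  move: rest; have [g gE] : exists g, G s Bad = g%:E.
    by exists (fine (G s Bad)); rewrite fineK// fin_num_measure.
  rewrite gE -!EFinM -!EFinD !lee_fin => rest.
  have E : ((1 + dl) * (s ^+ 2 * i + dl) + 2 * dl) / s + ((1 + dl) * ((1 - s) ^+ 2 * i + dl) + 2 * dl) / (1 - s)
     = i + dl * i + dl * (3 + dl) * kappa.
    by rewrite /kappa; field; rewrite !gt_eqF.
  have E2 : dl * (3 + dl) * kappa <= dl * 4 * kappa.
    by rewrite ler_pM2r// ler_pM2l//; lra.
  lra.
have [g gE] : exists g, G s Bad = g%:E.
  by exists (fine (G s Bad)); rewrite fineK// fin_num_measure.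
have g0 : 0 <= g by rewrite -lee_fin -gE.
rewrite gE; congr EFin; apply/eqP; rewrite eq_le g0 andbT.
rewrite leNgt; apply/negP => gpos.
pose K := i + 4 * kappa.
have K0 : 0 < K by rewrite ltr_wpDl// mulr_gt0.
pose dl := Num.min (Num.min 1 (l - l')) (c * g / K / 2).
have dl0 : 0 < dl.
  by rewrite !lt_min ltr01 subr_gt0 l'2 !divr_gt0// mulr_gt0.
have := main dl dl0.
rewrite !ge_min !lexx ?orbT/= => /(_ isT isT).
rewrite gE -EFinM lee_fin leNgt => /negP; apply.
apply: (@le_lt_trans _ _ (c * g / K / 2 * K)).
  by rewrite ler_pM2r// /dl ge_min lexx orbT.
have -> : c * g / K / 2 * K = c * g / 2 by field; rewrite gt_eqF.
have cg : 0 < c * g by rewrite mulr_gt0.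
lra.
Qed.

End intermediate_points.

(** * Renyi entropy and Brunn-Minkowski in CD(0,N) spaces *)

Section entropy.
Context {R : realType} {X : completeMetricType R}.
Variable m : {measure set (borel X) -> \bar R}.
Variable x0 : X.
Implicit Types (A B Z : set (borel X)) (nu : probability (borel X) R) (N a s : R).

Lemma uniform_probability A a : measurable A -> m A = a%:E -> 0 < a ->
  exists nu : probability (borel X) R, forall E, measurable E -> nu E = (a^-1%:E * m (E `&` A))%E.
Proof.
move=> mA mAa a0.
exists (mnormalize (mrestr m mA) (\d_(x0 : borel X))) => E mE.
rewrite /= /mnormalize/= /mrestr setTI mAa.
have -> : ((a%:E == 0) || (a%:E == +oo))%E = false.
  by apply/negbTE; rewrite negb_or eqe gt_eqF.
by rewrite muleC.
Qed.

Lemma uniform_P2_ac A a (x1 : X) (r : R) nu : measurable A -> m A = a%:E -> 0 < a ->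
  A `<=` ball x1 r ->
  (forall E, measurable E -> nu E = (a^-1%:E * m (E `&` A))%E) -> P2_ac m nu.
Proof.
move=> mA mAa a0 Ar nuE; split.
  exists x1.
  have nuA : nu A = 1%E by rewrite nuE// setIid mAa -EFinM mulVf ?gt_eqF.
  have nuAc : nu (~` A) = 0%E by rewrite probability_setC// nuA subee.
  have md : measurable_fun setT (fun x : borel X => ((mdist (x : X) x1 ^+ 2)%:E : \bar R)).
    by apply/measurable_EFinP; apply: measurable_funX; exact: measurable_mdistl.
  rewrite -(setUv A) ge0_integral_setU//; last 4 first.
  - exact: measurableC.
  - by rewrite setUv.
  - by move=> x _; rewrite lee_fin sqr_ge0.
  - by apply/disj_setPCl.
  rewrite [X in (_ + X)%E](_ : _ = 0%E) ?adde0; last first.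
    by apply: null_set_integral => //; [exact: measurableC|exact: measurable_funTS].
  apply: (@le_lt_trans _ _ (\int[nu]_(x in A) (cst (r ^+ 2)%:E) x)%E); last first.
    by rewrite integral_cst// [X in (_ * X)%E](_ : _ = 1%E)// mule1 ltry.
  apply: ge0_le_integral => //.
  - by move=> x _; rewrite lee_fin sqr_ge0.
  - exact: measurable_funTS.
  move=> x Ax; rewrite lee_fin.
  have := Ar _ Ax; rewrite ballEmdist/= metric_sym => /ltW h.
  by rewrite ler_sqr ?nnegrE ?mdist_ge0// (le_trans _ h)// mdist_ge0.
apply/null_content_dominatesP.
move=> E mE mE0; rewrite nuE//.
rewrite (_ : m (E `&` A) = 0%E) ?mule0//.
apply/eqP; rewrite eq_le measure_ge0 andbT -mE0 le_measure ?inE//; exact: measurableI.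
Qed.

(** The density chosen in the definition of the entropy is only determined up
to a null set; uniqueness is read off from the equality of integrals over all
measurable sets. *)
Lemma uniform_entropy A a N nu : 1 < N -> measurable A -> m A = a%:E -> 0 < a ->
  (forall E, measurable E -> nu E = (a^-1%:E * m (E `&` A))%E) ->
  renyi_entropy m N nu = (- (a `^ N^-1))%:E.
Proof.
move=> N1 mA mAa a0 nuE; rewrite /renyi_entropy.
have N0 : 0 < N by rewrite (lt_trans _ N1).
have r0 : 0 < 1 - N^-1 by rewrite subr_gt0 invf_lt1.
pose rho0 (x : borel X) : R := a^-1 * \1_A x.
have mrho0 : measurable_fun setT rho0 by apply: measurable_funM => //.
have rho00 x : 0 <= rho0 x by rewrite mulr_ge0// invr_ge0 ltW.
have irho0 E : measurable E -> (\int[m]_(x in E) (rho0 x)%:E = nu E)%E.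
  move=> mE; rewrite nuE// /rho0.
  under eq_integral do rewrite EFinM.
  rewrite ge0_integralZl//; last 2 first.
  - by apply/measurable_EFinP; exact: measurable_indic.
  - by rewrite lee_fin invr_ge0 ltW.
  by rewrite integral_indic// setIC.
have rho0in : ac_density m nu rho0.
  split => //; exists set0; split => // E mE.
  by rewrite setI0 measure0 adde0 irho0.
have [] := xgetPex (cst 0) (ex_intro (ac_density m nu) rho0 rho0in).
set rho := xget _ _ => mrho rho_ge0 [S [mS mS0 rhoE]].
have nuS E : measurable E -> nu (E `&` S) = 0%E.
  move=> mE; rewrite nuE; last exact: measurableI.
  rewrite (_ : m _ = 0%E) ?mule0//.
  apply/eqP; rewrite eq_le measure_ge0 andbT -mS0 le_measure ?inE//.
    by apply: measurableI => //; exact: measurableI.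
  by move=> x [[]].
have aeE : ae_eq m setT (EFin \o rho0) (EFin \o rho).
  apply: integral_ae_eq => //.
  - apply/integrableP; split; first exact/measurable_EFinP.
    under eq_integral do rewrite /= ger0_norm//.
    by rewrite irho0// probability_setT ltry.
  - exact/measurable_EFinP.
  - by move=> E _ mE; rewrite /= irho0// rhoE// nuS// adde0.
rewrite EFinN; congr (- _)%E.
transitivity (\int[m]_x (rho0 x `^ (1 - N^-1))%:E)%E.
  apply: ge0_ae_eq_integral => //.
  - by apply/measurable_EFinP; apply: (measurableT_comp (@measurable_powR R (1 - N^-1))).
  - by apply/measurable_EFinP; apply: (measurableT_comp (@measurable_powR R (1 - N^-1))).
  - by move=> x _; rewrite lee_fin powR_ge0.
  - by move=> x _; rewrite lee_fin powR_ge0.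
  by apply: filterS aeE => x /(_ I) [->].
transitivity (\int[m]_x ((a^-1 `^ (1 - N^-1))%:E * (\1_A x : R)%:E))%E.
  apply: eq_integral => x _; rewrite /rho0 -EFinM indicE; congr EFin.
  by case: (x \in A); rewrite ?mulr1// !mulr0 powR0// gt_eqF.
rewrite ge0_integralZl//; last 2 first.
- by apply/measurable_EFinP; exact: measurable_indic.
- by rewrite lee_fin powR_ge0.
rewrite integral_indic// setIT mAa -EFinM; congr EFin.
rewrite -(powR_inv1 (ltW a0)) -powRrM mulN1r -{2}(powRr1 (ltW a0)) -powRD; last first.
  by apply/implyP => _; rewrite gt_eqF.
by congr (_ `^ _); ring.
Qed.

(** Jensen's inequality for the concave function r^(1-1/N) on Z. It is obtained
pointwise from the tangent line at the constant density 1/M, which avoids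
discussing integrability of the density. *)
Lemma entropy_support_le Z M N nu : 1 < N -> measurable Z -> m Z = M%:E -> 0 < M ->
  nu (~` Z) = 0%E -> ((- (M `^ N^-1))%:E <= renyi_entropy m N nu)%E.
Proof.
move=> N1 mZ mZM M0 nuZ.
have N0 : 0 < N by rewrite (lt_trans _ N1).
have s0 : 0 < N^-1 by rewrite invr_gt0.
have s1 : N^-1 < 1 by rewrite invf_lt1.
have r0 : 0 < 1 - N^-1 by rewrite subr_gt0.
rewrite /renyi_entropy EFinN leeN2.
have [[rho1 rho1P]|nex] := pselect (exists rho, ac_density m nu rho); last first.
  rewrite xgetPN; last by move=> rho h; apply: nex; exists rho.
  rewrite (_ : (fun _ => _) = cst 0%E) ?integral0 ?lee_fin ?powR_ge0//.
  by apply/funext => x /=; rewrite powR0// gt_eqF.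
have [] := xgetPex (cst 0) (ex_intro (ac_density m nu) rho1 rho1P).
set rho := xget _ _ => mrho rho_ge0 [S [mS mS0 rhoE]].
have mErho : measurable_fun setT (EFin \o rho) by exact/measurable_EFinP.
have mpow : measurable_fun setT (fun x => (rho x `^ (1 - N^-1))%:E).
  by apply/measurable_EFinP; apply: (measurableT_comp (@measurable_powR R (1 - N^-1))).
have mZc : measurable (~` Z) by exact: measurableC.
have int_le E : measurable E -> (\int[m]_(x in E) (rho x)%:E <= nu E)%E.
  by move=> mE; rewrite rhoE// leeDl.
rewrite -(setUv Z) ge0_integral_setU//; last 3 first.
- by rewrite setUv.
- by move=> x _; rewrite lee_fin powR_ge0.
- by apply/disj_setPCl.
rewrite [X in (_ + X)%E](_ : _ = 0%E) ?adde0; last first.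
  have ae0 : ae_eq m (~` Z) (EFin \o rho) (cst 0%E).
    apply/ae_eq_integral_abs => //; first exact: measurable_funTS.
    under eq_integral do rewrite /= ger0_norm//.
    by apply/eqP; rewrite eq_le -{1}nuZ int_le// integral_ge0// => x _; rewrite lee_fin.
  transitivity (\int[m]_(x in ~` Z) (cst 0%E x))%E; last exact: integral0.
  apply: ge0_ae_eq_integral => //.
  - exact: measurable_funTS.
  - by move=> x _; rewrite lee_fin powR_ge0.
  by apply: filterS ae0 => x h Zx; have [->] := h Zx; rewrite powR0// gt_eqF.
pose c1 := (1 - N^-1) * M `^ N^-1.
pose c2 := N^-1 * M `^ (N^-1 - 1).
have c10 : 0 <= c1 by rewrite mulr_ge0 ?powR_ge0// ltW.
have c20 : 0 <= c2 by rewrite mulr_ge0 ?powR_ge0// ltW.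
apply: (@le_trans _ _ (\int[m]_(x in Z) (c1%:E * (rho x)%:E + c2%:E))%E).
  apply: ge0_le_integral => //.
  - by move=> x _; rewrite lee_fin powR_ge0.
  - exact: measurable_funTS.
  - apply: measurable_funTS; apply: emeasurable_funD => //; exact: measurable_funeM.
  move=> x _; rewrite -EFinM -EFinD lee_fin.
  have := @weighted_AMGM R N^-1 (rho x * M `^ N^-1) (M `^ (N^-1 - 1)) s0 s1.
  rewrite powR_ge0 mulr_ge0 ?powR_ge0// => /(_ isT isT).
  have -> : (rho x * M `^ N^-1) `^ (1 - N^-1) * (M `^ (N^-1 - 1)) `^ N^-1 = rho x `^ (1 - N^-1).
    rewrite powRM ?powR_ge0// -mulrA -!powRrM -powRD; last by apply/implyP => _; rewrite gt_eqF.
    have -> : N^-1 * (1 - N^-1) + (N^-1 - 1) * N^-1 = 0 by ring.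
    by rewrite powRr0 mulr1.
  by rewrite /c1 /c2 mulrCA mulrC -mulrA (mulrC (M `^ N^-1)).
have mErhoZ : measurable_fun Z (EFin \o rho) by exact: measurable_funTS.
have mcrho : measurable_fun Z (fun x => (c1%:E * (rho x)%:E)%E) by exact: measurable_funeM.
rewrite ge0_integralD//; last by move=> x _; rewrite mule_ge0// lee_fin.
rewrite ge0_integralZl//; last by move=> x _; rewrite lee_fin.
rewrite integral_cst// mZM.
apply: (@le_trans _ _ (c1%:E * 1%E + c2%:E * M%:E)%E).
  rewrite leeD2r// lee_wpmul2l ?lee_fin//; apply: (le_trans (int_le _ mZ)).
  exact: probability_le1.
have MM : M `^ (N^-1 - 1) * M = M `^ N^-1.
  rewrite -[X in _ * X](powRr1 (ltW M0)) -powRD ?subrK//.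
  by apply/implyP => _; rewrite gt_eqF.
by rewrite mule1 -EFinM -EFinD lee_fin /c1 /c2 -mulrA MM -mulrDl subrK mul1r.
Qed.

Hypothesis sepX : separable (X := X).

(** The geodesic between the uniform measures on A and B is at time s
concentrated on the l-neighbourhood of A; compare the convexity of the entropy
along it with the smallest entropy possible on that neighbourhood. Only the
neighbourhood of A appears, and not the set of s-intermediate points, because
B will be a ball of radius tending to infinity. *)
Lemma brunn_minkowski_CD N A B (x1 x2 : X) (r1 r2 D s l a b M : R) :
  1 < N -> CD0 m N ->
  measurable A -> measurable B -> A `<=` ball x1 r1 -> B `<=` ball x2 r2 ->
  m A = a%:E -> m B = b%:E -> 0 < a -> 0 < b ->
  (forall x y : X, A x -> B y -> mdist x y <= D) ->
  0 < s -> s < 1 -> s * D < l -> m (enlargement (A : set X) l) = M%:E ->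
  (1 - s) * a `^ N^-1 + s * b `^ N^-1 <= M `^ N^-1.
Proof.
move=> N1 cd mA mB Ar Br mAa mBb a0 b0 AB s0 s1 sDl mM.
have [nuA nuAE] := uniform_probability mA mAa a0.
have [nuB nuBE] := uniform_probability mB mBb b0.
have PA := uniform_P2_ac mA mAa a0 Ar nuAE.
have PB := uniform_P2_ac mB mBb b0 Br nuBE.
have [G [G0 G1 geoG _ entG]] := cd N (lexx N) nuA nuB PA PB.
have GA : G 0 A = 1%E by rewrite G0// nuAE// setIid mAa -EFinM mulVf ?gt_eqF.
have GB : G 1 B = 1%E by rewrite G1// nuBE// setIid mBb -EFinM mulVf ?gt_eqF.
have supp := geodesic_intermediate_support sepX x0 geoG mA mB GA GB AB s0 s1 sDl.
have M0 : 0 < M.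
  rewrite -lte_fin -mM; apply: (@lt_le_trans _ _ (m A)); first by rewrite mAa lte_fin.
  rewrite le_measure ?inE//; first exact: measurable_enlargement.
  move=> x Ax; exists x => //; rewrite ballEmdist /= mdistxx.
  apply: le_lt_trans sDl; rewrite mulr_ge0 ?(ltW s0)//.
  have /set0P[y By] : B != set0.
    by apply/eqP => B0; move: mBb; rewrite B0 measure0 => -[] h; rewrite -h ltxx in b0.
  exact: le_trans (mdist_ge0 _ _) (AB _ _ Ax By).
have ins : s \in `[0, 1] by rewrite in_itv/= (ltW s0) (ltW s1).
have := le_trans (entropy_support_le N1 (measurable_enlargement _ _) mM M0 supp) (entG s ins).
rewrite (uniform_entropy N1 mA mAa a0 nuAE) (uniform_entropy N1 mB mBb b0 nuBE).
rewrite -!EFinM -EFinD lee_fin => h; lra.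
Qed.

End entropy.

(** * The Gamma integral *)

Section gamma.
Context {R : realType}.
Notation leb := (@lebesgue_measure R).

Lemma powR_le_expR (a b t : R) : 0 < a -> 0 < b -> 0 <= t -> t `^ a <= (a / b) `^ a * expR (b * t).
Proof.
move=> a0 b0 t0.
have h : t <= a / b * expR (b * t / a).
  have h0 : b * t / a <= expR (b * t / a) by apply: le_trans (expR_ge1Dx _); rewrite lerDr.
  rewrite mulrC -ler_pdivrMr ?divr_gt0//; apply: le_trans h0.
  by rewrite le_eqVlt; apply/orP; left; apply/eqP; field; rewrite !gt_eqF.
have ab0 : 0 <= a / b by rewrite divr_ge0 ?(ltW a0) ?(ltW b0).
apply: (@le_trans _ _ ((a / b * expR (b * t / a)) `^ a)).
  by apply: ge0_ler_powR; rewrite ?nnegrE ?(ltW a0)// mulr_ge0 ?expR_ge0.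
rewrite powRM ?expR_ge0// [X in _ * X]/powR gt_eqF ?expR_gt0// expRK.
by have -> : a * (b * t / a) = b * t by field; rewrite gt_eqF.
Qed.

Lemma gamma_spec (a : R) : 0 < a -> exists2 g : R, 0 < g &
  euler_gamma (a + 1) = g /\
  (\int[leb]_v ((\1_`]0%R, +oo[%classic v : R) * (v `^ a * expR (- v)))%:E = g%:E)%E.
Proof.
move=> a0.
pose f (v : R) : R := (\1_(`]0%R, +oo[%classic : set R) v : R) * (v `^ a * expR (- v)).
have f0 v : 0 <= f v by rewrite /f !mulr_ge0 ?powR_ge0 ?expR_ge0.
have mexpN (c : R) : measurable_fun [set: measurableTypeR R] (fun v : R => expR (c * v)).
  by apply: measurableT_comp => //; exact: measurable_funM.
have mf : measurable_fun [set: measurableTypeR R] f.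
  apply: measurable_funM; first exact: measurable_indic.
  apply: measurable_funM; first exact: measurable_powR.
  by rewrite (_ : (fun v : R => _) = (fun v : R => expR (-1 * v))) //; apply/funext => v; rewrite mulN1r.
have mEf : measurable_fun [set: measurableTypeR R] (EFin \o f) by exact/measurable_EFinP.
pose C := (a / 2^-1) `^ a.
have fin : (\int[leb]_v (f v)%:E <= (C * 2)%:E)%E.
  have mg : measurable_fun [set: measurableTypeR R] (fun v : R => ((\1_(`]0%R, +oo[%classic : set R) v : R) * expR (- 2^-1 * v))%:E).
    by apply/measurable_EFinP; apply: measurable_funM => //.
  apply: (@le_trans _ _ (\int[leb]_v (C%:E * ((\1_(`]0%R, +oo[%classic : set R) v : R) * expR (- 2^-1 * v))%:E))%E).
    apply: ge0_le_integral => //; first by move=> v _; rewrite lee_fin.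
      exact: measurable_funeM.
    move=> v _; rewrite -EFinM lee_fin /f indicE.
    have [v0|] := boolP (v \in _); last by rewrite !mul0r mulr0.
    rewrite !mul1r; have {}v0 : 0 < v by move: v0; rewrite inE/= in_itv/= andbT.
    have -> : expR (- 2^-1 * v) = expR (2^-1 * v) * expR (- v).
      by rewrite -expRD; congr expR; field.
    rewrite mulrA ler_pM2r ?expR_gt0//; apply: powR_le_expR => //; exact: ltW.
  rewrite ge0_integralZl//; last by rewrite lee_fin powR_ge0.
  by rewrite integral_expRNM// invrK -EFinM.
have gpos : (0 < \int[leb]_v (f v)%:E)%E.
  apply: (@lt_le_trans _ _ (\int[leb]_(v in `]1%R, 2%R]) (cst (expR (- 2))%:E v))%E).
    rewrite integral_cst//= lebesgue_measure_itv/= lte_fin ltr1n -EFinM lte_fin mulr_gt0 ?expR_gt0//; lra.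
  apply: (@le_trans _ _ (\int[leb]_(v in `]1%R, 2%R]) (f v)%:E)%E).
    apply: ge0_le_integral => //.
    - by move=> v _; rewrite lee_fin expR_ge0.
    - exact: measurable_funTS.
    move=> v /=; rewrite in_itv/= => /andP[v1 v2]; rewrite lee_fin /f indicE mem_set; last first.
      by rewrite /= in_itv/= andbT (lt_trans _ v1).
    rewrite mul1r -[leLHS]mul1r ler_pM ?expR_ge0 ?ler_expR ?lerN2//.
    have {1}<- : 1 `^ a = 1 :> R by rewrite powR1.
    by apply: ge0_ler_powR; rewrite ?nnegrE ?(ltW a0) ?(ltW v1)//; lra.
  by apply: ge0_subset_integral => // v _; rewrite lee_fin.
pose g := fine (\int[leb]_v (f v)%:E)%E.
have gE : (\int[leb]_v (f v)%:E = g%:E)%E.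
  rewrite /g fineK// ge0_fin_numE; first by apply: le_lt_trans fin _; exact: ltry.
  exact: ltW.
exists g; first by rewrite -lte_fin -gE.
split => //.
rewrite /euler_gamma /Rintegral /g; congr fine.
rewrite integral_mkcond; apply: eq_integral => v _.
by rewrite patchE /f indicE addrK; case: ifP => _; rewrite ?mul1r ?mul0r.
Qed.

Lemma sigma_const_gt0 (N : R) : 0 < N -> 0 < sigma_const N.
Proof.
move=> N0; have N2 : 0 < N / 2 by rewrite divr_gt0.
have [g g0 [gE _]] := gamma_spec N2.
by rewrite /sigma_const gE divr_gt0 ?powR_gt0 ?pi_gt0.
Qed.

End gamma.

(** * Volume growth and enlargement of sets *)
Section bishop_gromov.
Context {R : realType} {X : completeMetricType R}.
Variable m : {measure set (borel X) -> \bar R}.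
Variables (N : R) (x0 : X).
Hypothesis N1 : 1 < N.
Hypothesis mms : metric_measure_space m.
Hypothesis cd : CD0 m N.

Let sepX : separable (X := X). Proof. by case: mms. Qed.
Let N0 : 0 < N. Proof. exact: lt_trans N1. Qed.
Let Ni0 : 0 < N^-1. Proof. by rewrite invr_gt0. Qed.

Lemma metric_measure_sigma_finite : sigma_finite setT m.
Proof.
have [_ lf _] := mms.
have [e eP] := dense_sequence x0 sepX.
pose U (p : nat * nat) : set (borel X) := ball (e p.1) p.2.+1%:R^-1.
pose F i : set (borel X) := if unpickle i is Some p then
  if (m (U p) < +oo)%E then U p else set0 else set0.
exists F.
  apply/esym/seteqP; split => // x _.
  have [r r0 mr] := lf x.
  have [k kr] : exists k, k.+1%:R^-1 < r / 2.
    have r20 : 0 < r / 2 by rewrite divr_gt0.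
    by have [k _ hk] := near_infty_natSinv_lt (PosNum r20); exists k; have := hk k (leqnn k).
  have k0 : 0 < k.+1%:R^-1 :> R by rewrite invr_gt0 ltr0n.
  have [n hn] := eP x _ k0.
  exists (pickle (n, k)) => //; rewrite /F pickleK.
  have Ux : U (n, k) `<=` ball x r.
    move=> y; rewrite /U !ballEmdist /= => hy.
    have := metric_triangle x (e n) y; rewrite (metric_sym x (e n)).
    have aux (a b c d : R) : a < d -> b < d -> d < r / 2 -> c <= a + b -> c < r by lra.
    exact: aux hn hy kr.
  rewrite ifT; first by rewrite /U ballEmdist.
  apply: le_lt_trans mr; apply: le_measure => //; rewrite inE; exact: measurable_ball_borel.
move=> i; rewrite /F; case: (unpickle i) => [p|]; last by rewrite measure0; split.
case: ifP => [h|_]; last by rewrite measure0; split.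
by split => //; exact: measurable_ball_borel.
Qed.

Let mball r : measurable (ball x0 r : set (borel X)). Proof. exact: measurable_ball_borel. Qed.

Lemma ball_gt0 r : 0 < r -> (0 < m (ball x0 r : set (borel X)))%E.
Proof.
move=> r0; have [_ _ sm] := mms.
have : msupport m x0 by rewrite sm.
by apply; [exact: open_ball|exact: ballxx].
Qed.

(** Brunn-Minkowski from a small ball around x0 towards the ball of radius r',
at time s. The larger ball is not yet known to have finite measure, so it is
first cut by an exhaustion F k of the space by sets of finite measure. *)
Lemma bishop_gromov_strict s r r' : 0 < s -> s < 1 -> 0 < r' -> s * r' < r ->
  (m (ball x0 r : set (borel X)) < +oo)%E ->
  ((s `^ N)%:E * m (ball x0 r' : set (borel X)) <= m (ball x0 r : set (borel X)))%E.
Proof.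
move=> s0 s1 r'0 sr mrfin.
have /sigma_finiteP[F [FT ndF finF]] := metric_measure_sigma_finite.
pose eps := (r - s * r') / 4.
have eps0 : 0 < eps by rewrite divr_gt0// subr_gt0.
have seps : s * eps < eps by rewrite gtr_pMl.
have [v vE] : exists v, m (ball x0 r : set (borel X)) = v%:E.
  by exists (fine (m (ball x0 r : set (borel X)))); rewrite fineK// ge0_fin_numE.
have subm (A B : set (borel X)) : measurable A -> measurable B -> A `<=` B -> (m A <= m B)%E.
  by move=> mA mB AB; apply: le_measure; rewrite ?inE.
have [a aE] : exists a, m (ball x0 eps : set (borel X)) = a%:E.
  exists (fine (m (ball x0 eps : set (borel X)))); rewrite fineK// ge0_fin_numE//.
  apply: le_lt_trans mrfin; apply: subm => //; apply: le_ball; rewrite /eps in seps *.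
  have : 0 < s * r' by rewrite mulr_gt0.
  lra.
have a0 : 0 < a by rewrite -lte_fin -aE ball_gt0.
have enl : enlargement (ball x0 eps) (r - eps) `<=` ball x0 r.
  move=> z [y]; rewrite !ballEmdist /= => h1 h2.
  have := metric_triangle x0 y z; lra.
have main k : ((s `^ N)%:E * m (ball x0 r' `&` F k) <= v%:E)%E.
  have [mFk finFk] := finF k.
  have mB : measurable (ball x0 r' `&` F k : set (borel X)) by exact: measurableI.
  have [b bE] : exists b, m (ball x0 r' `&` F k) = b%:E.
    exists (fine (m (ball x0 r' `&` F k))); rewrite fineK// ge0_fin_numE//.
    by apply: le_lt_trans finFk; apply: subm.
  have b0 : 0 <= b by rewrite -lee_fin -bE.
  have v0 : 0 <= v by rewrite -lee_fin -vE.
  rewrite bE; have [->|bn0] := eqVneq b 0; first by rewrite mule0 lee_fin.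
  have {}b0 : 0 < b by rewrite lt_neqAle eq_sym bn0.
  have [M ME] : exists M, m (enlargement (ball x0 eps) (r - eps)) = M%:E.
    exists (fine (m (enlargement (ball x0 eps) (r - eps)))); rewrite fineK// ge0_fin_numE//.
    by apply: le_lt_trans mrfin; apply: subm => //; exact: measurable_enlargement.
  have Mv : M <= v.
    by rewrite -lee_fin -ME -vE; apply: subm => //; exact: measurable_enlargement.
  have M0 : 0 <= M by rewrite -lee_fin -ME.
  have := @brunn_minkowski_CD R X m x0 sepX N (ball x0 eps) (ball x0 r' `&` F k) x0 x0 eps r'
    (eps + r') s (r - eps) a b M N1 cd (mball _) mB (@subset_refl _ _) (@subIsetl _ _ _) aE bE a0 b0.
  move=> /(_ _ s0 s1 _ ME) h.
  have {}h : (1 - s) * a `^ N^-1 + s * b `^ N^-1 <= M `^ N^-1.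
    apply: h.
    - move=> x y; rewrite !ballEmdist /= => h1 [h2 _].
      have := metric_triangle x x0 y; rewrite (metric_sym x x0) => h3; lra.
    - rewrite mulrDr /eps in seps *; lra.
  have h2 : s * b `^ N^-1 <= M `^ N^-1.
    apply: le_trans h; rewrite lerDr mulr_ge0 ?powR_ge0// subr_ge0 ltW//.
  rewrite -EFinM lee_fin; apply: le_trans Mv.
  have -> : s `^ N * b = (s * b `^ N^-1) `^ N.
    by rewrite powRM ?powR_ge0 ?(ltW s0)// -powRrM mulVf ?gt_eqF// powRr1 ?(ltW b0).
  have -> : M = (M `^ N^-1) `^ N by rewrite -powRrM mulVf ?gt_eqF// powRr1.
  by apply: ge0_ler_powR; rewrite ?nnegrE ?powR_ge0 ?mulr_ge0 ?powR_ge0 ?(ltW N0) ?(ltW s0).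
rewrite vE.
have cv : m (ball x0 r' `&` F k) @[k --> \oo] --> m (ball x0 r' : set (borel X)).
  have {2}-> : (ball x0 r' : set (borel X)) = \bigcup_k (ball x0 r' `&` F k).
    by rewrite -setI_bigcupr -FT setIT.
  apply: nondecreasing_cvg_mu.
  - by move=> k; apply: measurableI => //; exact: (finF k).1.
  - by apply: bigcupT_measurable => k; apply: measurableI => //; exact: (finF k).1.
  - by move=> i j ij; apply/subsetPset; apply: setIS; exact/subsetPset/ndF.
rewrite -(cvg_lim _ cv)// -limeMl//; last by apply/cvg_ex; eexists; exact: cv.
apply: lime_le; first by apply: is_cvgeMl => //; apply/cvg_ex; eexists; exact: cv.
by apply: nearW => k; exact: main.
Qed.

(** A ball around x0 which has finite measure exists by local finiteness, and
any ball can be contracted into it. *)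
Lemma ball_finite r : (m (ball x0 r : set (borel X)) < +oo)%E.
Proof.
have [_ lf _] := mms; have [r0 r00 mr0] := lf x0.
pose r' := Num.max r 1.
have r'0 : 0 < r' by rewrite lt_max ltr01 orbT.
pose s := Num.min (1 / 2) (r0 / (2 * r')).
have s0 : 0 < s by rewrite lt_min !divr_gt0 ?mulr_gt0.
have s1 : s < 1 by rewrite gt_min; apply/orP; left; lra.
have sr : s * r' < r0.
  have h : s <= r0 / (2 * r') by rewrite ge_min lexx orbT.
  apply: (@le_lt_trans _ _ (r0 / (2 * r') * r')); first by rewrite ler_pM2r.
  have -> : r0 / (2 * r') * r' = r0 / 2 by field; rewrite gt_eqF.
  lra.
have := bishop_gromov_strict s0 s1 r'0 sr mr0.
have sN : 0 < s `^ N by rewrite powR_gt0.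
move=> h; apply: (@le_lt_trans _ _ (m (ball x0 r' : set (borel X)))).
  by apply: le_measure; rewrite ?inE//; apply: le_ball; rewrite le_max lexx.
have := le_lt_trans h mr0; have := measure_ge0 m (ball x0 r' : set (borel X)).
move: (m _) => [t| |] // _.
  by move=> _; exact: ltry.
by rewrite gt0_muley ?lte_fin// ltxx.
Qed.

Definition volume (r : R) : R := fine (m (ball x0 r : set (borel X))).

Lemma volumeE r : m (ball x0 r : set (borel X)) = (volume r)%:E.
Proof. by rewrite /volume fineK// ge0_fin_numE// ball_finite. Qed.

Lemma volume_gt0 r : 0 < r -> 0 < volume r.
Proof. by move=> r0; rewrite -lte_fin -volumeE ball_gt0. Qed.

Lemma le_volume r r' : r <= r' -> volume r <= volume r'.
Proof.
by move=> rr'; rewrite -lee_fin -!volumeE; apply: le_measure; rewrite ?inE//; exact: le_ball.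
Qed.

(** The strict version holds with any factor s < r / r'; let s tend to r / r'. *)
Lemma bishop_gromov r r' : 0 < r -> r <= r' -> volume r' / r' `^ N <= volume r / r `^ N.
Proof.
move=> r0; rewrite le_eqVlt => /orP[/eqP->//|rr'].
have r'0 : 0 < r' := lt_trans r0 rr'.
have rN : 0 < r `^ N by rewrite powR_gt0.
have r'N : 0 < r' `^ N by rewrite powR_gt0.
have tau t : 0 < t -> t < 1 -> t * (volume r' / r' `^ N) <= volume r / r `^ N.
  move=> t0 t1.
  pose th := t `^ N^-1.
  have th0 : 0 < th by rewrite powR_gt0.
  have th1 : th < 1.
    have <- : 1 `^ N^-1 = 1 :> R by rewrite powR1.
    by apply: gt0_ltr_powR => //; rewrite nnegrE ?(ltW t0).
  pose s := th * (r / r').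
  have s0 : 0 < s by rewrite mulr_gt0// divr_gt0.
  have s1 : s < 1.
    apply: lt_trans th1; rewrite gtr_pMr// ltr_pdivrMr// mul1r//.
  have sr : s * r' < r.
    by rewrite /s -mulrA divfK ?gt_eqF// gtr_pMl.
  have := bishop_gromov_strict s0 s1 r'0 sr (ball_finite r).
  rewrite !volumeE -EFinM lee_fin /s powRM ?divr_ge0 ?(ltW th0) ?(ltW r0) ?(ltW r'0)//.
  rewrite powR_div ?(ltW r0)// {1}/th -powRrM mulVf ?gt_eqF// powRr1 ?(ltW t0)// => h.
  rewrite ler_pdivlMr//; apply: le_trans h.
  by rewrite le_eqVlt; apply/orP; left; apply/eqP; field; rewrite gt_eqF.
have c0 : 0 < volume r' / r' `^ N by rewrite divr_gt0// volume_gt0.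
have d0 : 0 < volume r / r `^ N by rewrite divr_gt0// volume_gt0.
move: c0 d0 tau; move: (volume r' / _) (volume r / _) => c d c0 d0 tau.
rewrite leNgt; apply/negP => dc.
have := tau ((d + c) / (2 * c)).
rewrite divr_gt0 ?addr_gt0 ?mulr_gt0// => /(_ isT).
rewrite ltr_pdivrMr ?mulr_gt0// mul1r.
have -> : (d + c) / (2 * c) * c = (d + c) / 2 by field; rewrite gt_eqF.
have h1 : d + c < 2 * c by lra.
move=> /(_ h1); lra.
Qed.

(** The asymptotic volume ratio without its normalization by sigma_N. As the
ratio is nonincreasing, the infimum over all radii is the limit at infinity. *)
Definition asymptotic_density : R := inf [set volume r / r `^ N | r in [set r | 0 < r]].

Let density_has_inf : has_inf [set volume r / r `^ N | r in [set r | 0 < r]].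
Proof.
split; first by exists (volume 1 / 1 `^ N), 1 => //=.
by exists 0 => _ [r /= r0 <-]; rewrite divr_ge0 ?powR_ge0// ltW// volume_gt0.
Qed.

Lemma volume_ge r : 0 < r -> asymptotic_density * r `^ N <= volume r.
Proof.
move=> r0; rewrite -ler_pdivlMr ?powR_gt0//.
by apply: ge_inf; [case: density_has_inf | exists r].
Qed.

Lemma volume_asymptotic dl : 0 < dl -> exists2 rho, 0 < rho &
  forall r, rho <= r -> volume r <= (asymptotic_density + dl) * r `^ N.
Proof.
move=> dl0; have [_ [rho /= rho0 <-] h] := inf_adherent dl0 density_has_inf.
exists rho => // r rr; rewrite -ler_pdivrMr ?powR_gt0 ?(lt_le_trans rho0)//.
exact: le_trans (bishop_gromov rho0 rr) (ltW h).
Qed.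

Lemma asymptotic_density_ge0 : 0 <= asymptotic_density.
Proof.
apply: lb_le_inf; first by case: density_has_inf.
by move=> _ [r /= r0 <-]; rewrite divr_ge0 ?powR_ge0// ltW// volume_gt0.
Qed.

Lemma AVR_asymptotic_density : AVR m N x0 = (asymptotic_density / sigma_const N)%:E.
Proof.
have s0 := sigma_const_gt0 N0.
rewrite /AVR; apply: cvg_lim => //.
have cv : volume r / r `^ N / sigma_const N @[r --> +oo] --> asymptotic_density / sigma_const N.
  apply: cvgM; last exact: cvg_cst.
  apply/cvgrPdist_le => e e0.
  have [rho rho0 h] := volume_asymptotic e0.
  near=> r.
  have rr : rho <= r by near: r; apply: nbhs_pinfty_ge; exact: num_real.
  have r0 : 0 < r := lt_le_trans rho0 rr.
  have h1 := volume_ge r0; have h2 := h r rr.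
  have rN : 0 < r `^ N by rewrite powR_gt0.
  rewrite distrC ger0_norm; last by rewrite subr_ge0 ler_pdivlMr.
  by rewrite lerBlDl ler_pdivrMr.
apply: cvg_EFin; first by near=> r; rewrite volumeE -EFinM.
apply: cvg_trans cv; apply: near_eq_cvg; near=> r.
rewrite /= volumeE -EFinM /=.
have r0 : 0 < r by near: r; apply: nbhs_pinfty_gt; exact: num_real.
by field; rewrite !gt_eqF// powR_gt0.
Unshelve. all: by end_near. Qed.

(** The isoperimetric input with the sharp constant: Brunn-Minkowski between A
and the ball of radius r at time s = lam / r. As r tends to infinity, the
weight of A tends to 1 and s m(B_r)^(1/N) tends to at least lam w^(1/N), where
w is the asymptotic density. *)
Lemma enlargement_measure A (D a M lam lam' : R) : 
  measurable (A : set (borel X)) -> A `<=` ball x0 D -> m (A : set (borel X)) = a%:E -> 0 < a ->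
  0 <= lam -> lam < lam' -> m (enlargement A lam' : set (borel X)) = M%:E -> 
  a `^ N^-1 + lam * asymptotic_density `^ N^-1 <= M `^ N^-1.
Proof.
move=> mA AD aE a0 lam0 lamlam' ME.
have AE : A `<=` enlargement A lam'.
  by move=> x Ax; exists x => //; apply: ballxx; exact: le_lt_trans lamlam'.
have aM : a <= M.
  rewrite -lee_fin -aE -ME; apply: le_measure; rewrite ?inE//; exact: measurable_enlargement.
have aM' : a `^ N^-1 <= M `^ N^-1.
  by apply: ge0_ler_powR; rewrite ?nnegrE ?(ltW Ni0) ?(ltW a0)// (le_trans (ltW a0)).
move: lam0; rewrite le_eqVlt => /orP[/eqP<-|lam0]; first by rewrite mul0r addr0.
have D0 : 0 < D.
  have /set0P[x Ax] : A != set0 by apply/eqP => A0; move: aE; rewrite A0 measure0 => -[] h; rewrite -h ltxx in a0.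
  by have := AD _ Ax; rewrite ballEmdist /=; apply: le_lt_trans; exact: mdist_ge0.
apply/ler_addgt0Pr => eps eps0.
pose rt := a `^ N^-1.
have rt0 : 0 <= rt by exact: powR_ge0.
(* the three terms give s < 1, s (D + r) < lam' and s m(A)^(1/N) <= eps *)
pose r := lam + lam * D / (lam' - lam) + lam * rt / eps + 1.
have g0 : 0 < lam' - lam by rewrite subr_gt0.
have t1 : 0 <= lam * D / (lam' - lam) by rewrite divr_ge0 ?mulr_ge0 ?(ltW lam0) ?(ltW D0) ?(ltW g0).
have t2 : 0 <= lam * rt / eps by rewrite divr_ge0 ?mulr_ge0 ?(ltW lam0) ?(ltW eps0).
have r0 : 0 < r by rewrite /r; lra.
pose s := lam / r.
have s0 : 0 < s by rewrite divr_gt0.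
have s1 : s < 1 by rewrite ltr_pdivrMr// mul1r /r; lra.
have sD : s * (D + r) < lam'.
  have -> : s * (D + r) = lam * D / r + lam by rewrite /s; field; rewrite gt_eqF.
  rewrite -ltrBrDr ltr_pdivrMr// [ltRHS]mulrC -ltr_pdivrMr// /r; lra.
have := @brunn_minkowski_CD R X m x0 sepX N A (ball x0 r) x0 x0 D r (D + r) s lam' a (volume r) M
  N1 cd mA (mball r) AD (@subset_refl _ _) aE (volumeE r) a0 (volume_gt0 r0).
move=> h; have {}h : (1 - s) * rt + s * volume r `^ N^-1 <= M `^ N^-1.
  apply: h => // x y Ax; rewrite ballEmdist /= => h2.
  have := AD _ Ax; rewrite ballEmdist /= => h1.
  have := metric_triangle x x0 y; rewrite (metric_sym x x0); lra.
have vr : r * asymptotic_density `^ N^-1 <= volume r `^ N^-1.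
  have -> : r * asymptotic_density `^ N^-1 = (asymptotic_density * r `^ N) `^ N^-1.
    by rewrite powRM ?asymptotic_density_ge0 ?powR_ge0// -powRrM mulfV ?gt_eqF// powRr1 ?(ltW r0)// mulrC.
  apply: ge0_ler_powR; rewrite ?nnegrE ?(ltW Ni0)//.
  - by rewrite mulr_ge0 ?powR_ge0// asymptotic_density_ge0.
  - by rewrite ltW// volume_gt0.
  - exact: volume_ge.
have sv : lam * asymptotic_density `^ N^-1 <= s * volume r `^ N^-1.
  apply: (@le_trans _ _ (s * (r * asymptotic_density `^ N^-1))); last by rewrite ler_pM2l.
  by rewrite mulrA /s divfK ?gt_eqF.
have sr : s * rt <= eps.
  rewrite /s mulrAC ler_pdivrMr// [leRHS]mulrC -ler_pdivrMr// /r; lra.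
rewrite -/rt; lra.
Qed.

End bishop_gromov.

(** * Superlevel sets under infimal convolution *)

Section scaled_gamma.
Context {R : realType}.
Notation leb := (@lebesgue_measure R).

(** Change of variable v := - s v; the half line of negative levels is the one on
which the kernel is supported below. *)
Lemma gamma_scaled (th s g : R) : 0 < s ->
  (\int[leb]_v ((\1_`]0%R, +oo[%classic v : R) * (v `^ th * expR (- v)))%:E = g%:E)%E ->
  (\int[leb]_v ((\1_`]0%R, +oo[%classic (- v)%R : R) * ((- v) `^ th * expR (v / s)))%:E =
    (s `^ th * s * g)%:E)%E.
Proof.
move=> s0 gE.
pose f (v : R) : R := (\1_(`]0%R, +oo[%classic : set R) v : R) * (v `^ th * expR (- v)).
have mf : measurable_fun [set: measurableTypeR R] f.
  apply: measurable_funM; first exact: measurable_indic.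
  apply: measurable_funM; first exact: measurable_powR.
  by apply: measurableT_comp => //; exact: oppr_measurable.
have f0 v : 0 <= f v by rewrite /f !mulr_ge0 ?powR_ge0 ?expR_ge0.
have si0 : 0 < s^-1 by rewrite invr_gt0.
have mEf : measurable_fun [set: measurableTypeR R] (EFin \o f) by exact/measurable_EFinP.
have mEfs : measurable_fun [set: measurableTypeR R] (fun v : R => (f (s^-1 * v + 0))%:E).
  by apply: (measurableT_comp mEf (measurable_affine s^-1 0)).
have h := ge0_integral_affine 0 si0 mEf (fun v => f0 v).
rewrite /= -/f in gE h; rewrite gE invrK in h.
have h2 := ge0_integral_opp mEfs (fun v => f0 _).
rewrite h in h2.
transitivity ((s `^ th)%:E * \int[leb]_v (f (s^-1 * - v + 0))%:E)%E; last first.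
  by rewrite h2 -!EFinM mulrA.
rewrite -ge0_integralZl//; last 3 first.
- by apply: (measurableT_comp mEfs); exact: oppr_measurable.
- by move=> v _; rewrite lee_fin.
- by rewrite lee_fin powR_ge0.
apply: eq_integral => v _; rewrite -EFinM /f addr0 !indicE; congr EFin.
have E : (s^-1 * - v \in (`]0%R, +oo[%classic : set R)) = (- v \in (`]0%R, +oo[%classic : set R)).
  by apply/idP/idP; rewrite !inE/= !in_itv/= !andbT pmulr_rgt0.
rewrite E; have [v0|] := boolP (_ \in _); last by rewrite !mul0r mulr0.
have {}v0 : 0 < - v by move: v0; rewrite inE/= in_itv/= andbT.
rewrite !mul1r mulrA; congr (_ * expR _); last by rewrite mulrN opprK mulrC.
rewrite -powRM ?(ltW s0) ?mulr_ge0 ?(ltW si0) ?(ltW v0)//.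
by rewrite mulrA mulfV ?gt_eqF// mul1r.
Qed.

End scaled_gamma.

Section level_sets.
Context {R : realType} {X : completeMetricType R}.
Variable m : {measure set (borel X) -> \bar R}.
Variables (N : R) (x0 : X).
Hypothesis N1 : 1 < N.
Hypothesis mms : metric_measure_space m.
Hypothesis cd : CD0 m N.
Let w := asymptotic_density m N x0.
Let N0 : 0 < N. Proof. exact: lt_trans N1. Qed.
Let Ni0 : 0 < N^-1. Proof. by rewrite invr_gt0. Qed.
Let w0 : 0 <= w. Proof. exact: asymptotic_density_ge0. Qed.

Variables (u : X -> R) (Q : X -> \bar R) (K q : R).
Hypothesis mu_ : measurable_fun setT (u : borel X -> R).
Hypothesis mQ : measurable_fun setT (Q : borel X -> \bar R).
Hypothesis K0 : 0 < K.
Hypothesis q1 : 1 < q.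
Hypothesis Qu : forall x z, (Q x <= (u z + K * mdist x z `^ q)%:E)%E.
Let q0 : 0 < q. Proof. exact: lt_trans q1. Qed.

Let Qle x : (Q x <= (u x)%:E)%E.
Proof. by apply: le_trans (Qu x x) _; rewrite mdistxx powR0 ?gt_eqF// mulr0 addr0. Qed.

Let mlevu c : measurable ([set x | c < u x] : set (borel X)).
Proof.
rewrite -[X in measurable X]setTI.
by have := @measurable_fun_ltr _ _ R setT (cst c) (u : borel X -> R) (measurable_cst _) mu_ measurableT [set true] I.
Qed.

Let mlevQ c : measurable ([set x | (c%:E < Q x)%E] : set (borel X)).
Proof. by rewrite -[X in measurable X]setTI; apply: measurable_lte. Qed.

(** If Q x > c and d(x,z) < lam, then u z > c - K lam^q, so the superlevel set of u
contains the lam-neighbourhood of that of Q. *)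
Lemma level_enlargement c lam (a b : R) : 0 <= lam ->
  m [set x | (c%:E < Q x)%E] = a%:E -> 0 < a ->
  m [set x | c - K * lam `^ q < u x] = b%:E ->
  a `^ N^-1 + lam * w `^ N^-1 <= b `^ N^-1.
Proof.
move=> lam0 aE a0 bE.
have b0 : 0 <= b by rewrite -lee_fin -bE.
pose A k : set (borel X) := [set x | (c%:E < Q x)%E] `&` ball x0 k%:R.
have mA k : measurable (A k) by apply: measurableI => //; exact: measurable_ball_borel.
have Aa k : (m (A k) <= a%:E)%E.
  by rewrite -aE; apply: le_measure; rewrite ?inE//; exact: subIsetl.
have [ak akE] : exists ak, forall k, m (A k) = (ak k)%:E.
  exists (fun k => fine (m (A k))) => k; rewrite fineK// ge0_fin_numE//.
  by apply: le_lt_trans (Aa k) _; exact: ltry.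
have cv : m (A k) @[k --> \oo] --> m [set x | (c%:E < Q x)%E].
  have -> : [set x | (c%:E < Q x)%E] = \bigcup_k A k.
    rewrite -setI_bigcupr; apply/seteqP; split => [x Qx|x []//]; split => //.
    exists (Num.truncn (mdist x0 x)).+1 => //; rewrite ballEmdist /=.
    exact: truncnS_gt.
  apply: nondecreasing_cvg_mu => //; first exact: bigcupT_measurable.
  by move=> i j ij; apply/subsetPset; apply: setIS; apply: le_ball; rewrite ler_nat.
have main k : 0 < ak k -> ak k `^ N^-1 + lam * w `^ N^-1 <= b `^ N^-1.
  move=> ak0; move: lam0; rewrite le_eqVlt => /orP[/eqP lamE|lam0].
    rewrite -lamE mul0r addr0; apply: ge0_ler_powR; rewrite ?nnegrE ?(ltW Ni0) ?(ltW ak0)//.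
    rewrite -lee_fin -akE -bE; apply: le_measure; rewrite ?inE//.
    move=> x [/= Qx _]; rewrite -lamE powR0 ?gt_eqF// mulr0 subr0.
    by rewrite -lte_fin; exact: lt_le_trans Qx (Qle x).
  have sub : enlargement (A k) lam `<=` [set x | c - K * lam `^ q < u x].
    move=> z [x [/= Qx _]]; rewrite ballEmdist /= => xz.
    have := lt_le_trans Qx (Qu x z); rewrite lte_fin.
    have : K * mdist x z `^ q <= K * lam `^ q.
      rewrite ler_pM2l//; apply: ge0_ler_powR; rewrite ?nnegrE ?mdist_ge0 ?(ltW q0) ?(ltW lam0) ?(ltW xz)//.
    move=> h1 h2; lra.
  have [M ME] : exists M, m (enlargement (A k) lam) = M%:E.
    exists (fine (m (enlargement (A k) lam))); rewrite fineK// ge0_fin_numE//.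
    apply: (@le_lt_trans _ _ b%:E); last exact: ltry.
    by rewrite -bE; apply: le_measure; rewrite ?inE//; exact: measurable_enlargement.
  have M0 : 0 <= M by rewrite -lee_fin -ME.
  have Mb : M <= b.
    by rewrite -lee_fin -ME -bE; apply: le_measure; rewrite ?inE//; exact: measurable_enlargement.
  have Mb' : M `^ N^-1 <= b `^ N^-1.
    by apply: ge0_ler_powR; rewrite ?nnegrE ?(ltW Ni0).
  apply: le_trans Mb'.
  apply/ler_addgt0Pr => eps eps0.
  have wN0 : 0 <= w `^ N^-1 by exact: powR_ge0.
  pose d := Num.min lam (eps / (w `^ N^-1 + 1)).
  have d0 : 0 < d by rewrite lt_min lam0 divr_gt0// ltr_wpDl.
  have dlam : d <= lam by rewrite /d ge_min lexx.
  have dw : d * w `^ N^-1 <= eps.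
    apply: (@le_trans _ _ (eps / (w `^ N^-1 + 1) * w `^ N^-1)).
      by rewrite ler_wpM2r// /d ge_min lexx orbT.
    rewrite mulrAC ler_pdivrMr ?ltr_wpDl// ler_pM2l//; lra.
  have ld : lam - d < lam by lra.
  have ld0 : 0 <= lam - d by lra.
  have := @enlargement_measure R X m N x0 N1 mms cd (A k) k%:R (ak k) M (lam - d) lam
    (mA k) (@subIsetr _ _ _) (akE k) ak0 ld0 ld ME.
  rewrite -/w mulrBl; lra.
have [k1 ak1] : exists k, 0 < ak k.
  apply: contrapT => nk.
  have E : (fun k => m (A k)) = cst 0%E.
    apply/funext => k /=; rewrite akE; congr EFin; apply/eqP.
    rewrite eq_le -[X in _ && X]lee_fin -akE measure_ge0 andbT leNgt; apply/negP => h.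
    by apply: nk; exists k.
  move: cv; rewrite E aE => cv0.
  have : a%:E = 0%E by rewrite -(cvg_lim _ cv0)//; apply: cvg_lim => //; exact: cvg_cst.
  by move=> -[] h; move: a0; rewrite h ltxx.
pose T := b `^ N^-1 - lam * w `^ N^-1.
have T0 : 0 <= T.
  rewrite subr_ge0; apply: le_trans (main _ ak1).
  by rewrite lerDr powR_ge0.
have akT k : ak k <= T `^ N.
  have ak0 : 0 <= ak k by rewrite -lee_fin -akE.
  move: ak0; rewrite le_eqVlt => /orP[/eqP<-|ak0]; first exact: powR_ge0.
  have -> : ak k = (ak k `^ N^-1) `^ N by rewrite -powRrM mulVf ?gt_eqF// powRr1 ?(ltW ak0).
  apply: ge0_ler_powR; rewrite ?nnegrE ?(ltW N0) ?powR_ge0//.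
  by rewrite /T lerBrDr; exact: main.
have aT : a <= T `^ N.
  rewrite -lee_fin -aE -(cvg_lim _ cv)//; apply: lime_le.
    by apply/cvg_ex; eexists; exact: cv.
  by apply: nearW => k; rewrite akE lee_fin.
rewrite -lerBrDr -/T.
have -> : T = (T `^ N) `^ N^-1 by rewrite -powRrM mulfV ?gt_eqF// powRr1.
by apply: ge0_ler_powR; rewrite ?nnegrE ?(ltW Ni0) ?(ltW a0) ?powR_ge0.
Qed.

End level_sets.

(** * The integral form of hypercontractivity *)

Section brunn_minkowski_to_product.
Context {R : realType}.

(** The sum is a mean with weights 1 - s and s once its terms are divided by these
weights, and it dominates the geometric mean. *)
Lemma brunn_minkowski_product (N s a b lam w : R) : 0 < N -> 0 < s -> s < 1 ->
  0 <= a -> 0 <= b -> 0 <= lam -> 0 <= w ->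
  a `^ N^-1 + lam * w `^ N^-1 <= b `^ N^-1 ->
  (a / (1 - s) `^ N) `^ (1 - s) * (w * lam `^ N / s `^ N) `^ s <= b.
Proof.
move=> N0 s0 s1 a0 b0 lam0 w0 h.
have s1' : 0 < 1 - s by rewrite subr_gt0.
have NN (c : R) : 0 <= c -> (c `^ N) `^ N^-1 = c.
  by move=> c0; rewrite -powRrM mulfV ?gt_eqF// powRr1.
have NN' (c : R) : 0 <= c -> (c `^ N^-1) `^ N = c.
  by move=> c0; rewrite -powRrM mulVf ?gt_eqF// powRr1.
set A := a / (1 - s) `^ N; set W := w * lam `^ N / s `^ N.
have A0 : 0 <= A by rewrite divr_ge0 ?powR_ge0.
have W0 : 0 <= W by rewrite divr_ge0 ?mulr_ge0 ?powR_ge0.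
have AE : A `^ N^-1 = a `^ N^-1 / (1 - s).
  by rewrite /A powR_div ?powR_gt0// NN// ltW.
have WE : W `^ N^-1 = lam * w `^ N^-1 / s.
  rewrite /W powR_div ?powR_gt0 ?mulr_ge0 ?powR_ge0// (NN s (ltW s0)).
  by rewrite (powRM _ w0 (powR_ge0 _ _)) (NN _ lam0) (mulrC lam).
clearbody A W.
have := weighted_AMGM s0 s1 (powR_ge0 A N^-1) (powR_ge0 W N^-1).
have -> : (1 - s) * A `^ N^-1 + s * W `^ N^-1 = a `^ N^-1 + lam * w `^ N^-1.
  by rewrite AE WE; field; rewrite !gt_eqF.
move=> /le_trans/(_ h) h2.
have -> : A `^ (1 - s) * W `^ s = ((A `^ N^-1) `^ (1 - s) * (W `^ N^-1) `^ s) `^ N.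
  have e r : N^-1 * r * N = r by field; rewrite gt_eqF.
  rewrite [RHS](@powRM R ((A `^ N^-1) `^ (1 - s)) ((W `^ N^-1) `^ s)) ?powR_ge0//.
  by rewrite -!(powRrM A) -!(powRrM W) !e.
rewrite -[leRHS](NN' _ b0).
by apply: ge0_ler_powR; rewrite ?nnegrE ?(ltW N0) ?mulr_ge0 ?powR_ge0.
Qed.

End brunn_minkowski_to_product.

(** Rescaling by 1 gives a structure to which the sigma-finiteness can be
attached without changing the underlying function. *)
Lemma sigma_finite_pack {R : realType} d (T : measurableType d) (mu : {measure set T -> \bar R}) :
  sigma_finite setT mu -> exists nu : {sigma_finite_measure set T -> \bar R}, (nu : set T -> \bar R) = mu.
Proof.
move=> h.
have E : mscale (NngNum (@ler01 R)) mu = mu.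
  by apply/funext => A; rewrite /mscale/= mul1e.
have h' : sigma_finite setT (mscale (NngNum (@ler01 R)) mu) by rewrite E.
pose sf := Measure_isSigmaFinite.Build _ _ _ (mscale (NngNum (@ler01 R)) mu) h'.
pose sm : {sigma_finite_measure set T -> \bar R} := HB.pack (mscale (NngNum (@ler01 R)) mu) sf.
by exists sm.
Qed.

Section integral_hypercontractivity.
Context {R : realType} {X : completeMetricType R}.
Notation leb := (@lebesgue_measure R).
Variable m : {measure set (borel X) -> \bar R}.
Variables (N : R) (x0 : X).
Hypothesis N1 : 1 < N.
Hypothesis mms : metric_measure_space m.
Hypothesis cd : CD0 m N.
Let w := asymptotic_density m N x0.
Let N0 : 0 < N. Proof. exact: lt_trans N1. Qed.
Let w_ge0 : 0 <= w. Proof. exact: asymptotic_density_ge0. Qed.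

(** Prekopa-Leindler in the level variable. With v a level of al Q, the
functions are F v = e^(v be/al) m(al Q > v), H v = e^v m(al u > v) and, for v < 0,
G v = e^(v/s) w lam(v)^N, where lam(v) is the radius with al K lam(v)^q = -v: going
from x to x + y (y < 0) in the level of al u corresponds to enlarging the set
by lam(y). The weights s and 1 - s = al / be make the exponentials multiply to
e^(x+y). The integrals of F and H are those in the statement by the layer cake
formula, and the one of G is a Gamma integral. *)
Lemma integral_hypercontractivity (u : X -> R) (Q : X -> \bar R) (K q al be h g : R) :
  measurable_fun setT (u : borel X -> R) ->
  measurable_fun setT (Q : borel X -> \bar R) ->
  0 < K -> 1 < q -> 0 < al -> al < be -> 0 < w ->
  (forall x z, (Q x <= (u z + K * mdist x z `^ q)%:E)%E) ->
  (\int[m]_x (expR (al * u x))%:E = h%:E)%E ->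
  0 < g ->
  (\int[leb]_v ((\1_`]0%R, +oo[%classic v : R) * (v `^ (N / q) * expR (- v)))%:E = g%:E)%E ->
  forall s : R, s = 1 - al / be ->
  (\int[m]_x expeR (be%:E * Q x) <=
    ((al / be) `^ N * (h / (w / (al * K) `^ (N / q) / s `^ N * (s `^ (N / q) * g)) `^ s) `^ (be / al))%:E)%E.
Proof.
move=> mu_ mQ K0 q1 al0 albe w0 Qu hE g0 gE s sE.
have q0 : 0 < q by exact: lt_trans q1.
have be0 : 0 < be := lt_trans al0 albe.
have s1E : 1 - s = al / be by rewrite sE; ring.
have s1' : 0 < 1 - s by rewrite s1E divr_gt0.
have s0 : 0 < s by rewrite sE subr_gt0 ltr_pdivrMr// mul1r.
have s1 : s < 1 by rewrite -subr_gt0.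
have s1i : (1 - s)^-1 = be / al by rewrite s1E invf_div.
have [sm smE] := sigma_finite_pack (metric_measure_sigma_finite x0 mms).
have ismE (f : borel X -> \bar R) : (\int[sm]_x f x = \int[m]_x f x)%E.
  by apply: eq_measure_integral => A _ _; rewrite -smE.
have mau : measurable_fun setT (fun x : borel X => (al * u x)%:E : \bar R).
  by apply/measurable_EFinP; exact: measurable_funM.
have maQ : measurable_fun setT (fun x : borel X => (al%:E * Q x)%E : \bar R).
  exact: measurable_funeM.
have Qle x : (Q x <= (u x)%:E)%E.
  by apply: le_trans (Qu x x) _; rewrite mdistxx powR0 ?gt_eqF// mulr0 addr0.
pose Lu (v : R) : set (borel X) := [set x | (v%:E < (al * u x)%:E)%E].
pose LQ (v : R) : set (borel X) := [set x | (v%:E < al%:E * Q x)%E].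
have mLu v : measurable (Lu v).
  by rewrite -[Lu v]setTI; exact: (measurable_lte measurableT (measurable_cst _) mau).
have mLQ v : measurable (LQ v).
  by rewrite -[LQ v]setTI; exact: (measurable_lte measurableT (measurable_cst _) maQ).
have LQu v : (m (LQ v) <= m (Lu v))%E.
  apply: le_measure; rewrite ?inE//.
  move=> x /lt_le_trans; apply; rewrite EFinM; apply: lee_wpmul2l; first by rewrite lee_fin ltW.
  exact: Qle.
have mexpu : measurable_fun setT (fun x : borel X => (expR (al * u x))%:E : \bar R).
  by apply/measurable_EFinP; apply: measurableT_comp => //; exact/measurable_EFinP.
have Lufin v : (m (Lu v) < +oo)%E.
  have : ((expR v)%:E * m (Lu v) <= h%:E)%E.
    rewrite -hE -integral_cst//.
    apply: (@le_trans _ _ (\int[m]_(x in Lu v) (expR (al * u x))%:E)%E).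
      apply: ge0_le_integral => //.
      - by move=> x _; rewrite lee_fin expR_ge0.
      - exact: measurable_funTS.
      by move=> x; rewrite /Lu /= lte_fin => vu; rewrite lee_fin ler_expR ltW.
    apply: ge0_subset_integral => //.
  move: (m (Lu v)) (measure_ge0 m (Lu v)) => [r| |] //.
    by move=> _ _; exact: ltry.
  by move=> _; rewrite gt0_muley// lte_fin expR_gt0.
pose bb v := fine (m (Lu v)); pose aa v := fine (m (LQ v)).
have bbE v : m (Lu v) = (bb v)%:E by rewrite /bb fineK// ge0_fin_numE.
have aaE v : m (LQ v) = (aa v)%:E.
  by rewrite /aa fineK// ge0_fin_numE//; exact: le_lt_trans (LQu v) (Lufin v).
have bb0 v : 0 <= bb v by rewrite -lee_fin -bbE.
have aa0 v : 0 <= aa v by rewrite -lee_fin -aaE.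
have mbb : measurable_fun [set: measurableTypeR R] bb.
  have := @measurable_superlevel_measure R _ _ sm _ mau.
  by rewrite smE => h1; exact: (measurableT_comp (fine_measurable measurableT) h1).
have maa : measurable_fun [set: measurableTypeR R] aa.
  have := @measurable_superlevel_measure R _ _ sm _ maQ.
  by rewrite smE => h1; exact: (measurableT_comp (fine_measurable measurableT) h1).
have mexp (k : R) : measurable_fun [set: measurableTypeR R] (fun v : R => expR (k * v)).
  by apply: measurableT_comp => //; exact: measurable_funM.
pose lam (v : R) : R := ((- v) / (al * K)) `^ q^-1.
pose F (v : measurableTypeR R) : R := expR ((be / al) * v) * (aa v / (1 - s) `^ N).
pose H (v : measurableTypeR R) : R := expR (1 * v) * bb v.
pose I (v : R) : R := (\1_(`]0%R, +oo[%classic : set R) (- v) : R).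
pose G (v : measurableTypeR R) : R := I v * (expR (s^-1 * v) * (w * lam v `^ N / s `^ N)).
have lamE v : lam v `^ N = ((- v) / (al * K)) `^ (N / q) by rewrite /lam -powRrM (mulrC q^-1).
have mopp : measurable_fun [set: measurableTypeR R] (fun v : R => - v) by exact: oppr_measurable.
have mI : measurable_fun [set: measurableTypeR R] I.
  have mi : measurable_fun [set: measurableTypeR R] (\1_(`]0%R, +oo[%classic : set R) : R -> R).
    exact: measurable_indic.
  exact: (measurableT_comp mi mopp).
have mF : measurable_fun setT F.
  by apply: measurable_funM => //; exact: measurable_funM.
have mH : measurable_fun setT H by exact: measurable_funM.
have mG : measurable_fun setT G.
  apply: measurable_funM => //; apply: measurable_funM => //; apply: measurable_funM => //.
  apply: measurable_funM => //.
  apply: (measurableT_comp (@measurable_powR R N)).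
  apply: (measurableT_comp (@measurable_powR R q^-1)).
  by apply: measurable_funM => //; exact: oppr_measurable.
have I0 v : 0 <= I v by [].
have F0 v : 0 <= F v by rewrite mulr_ge0 ?expR_ge0// divr_ge0 ?powR_ge0.
have H0 v : 0 <= H v by rewrite mulr_ge0 ?expR_ge0.
have G0 v : 0 <= G v by rewrite mulr_ge0// mulr_ge0 ?expR_ge0// divr_ge0 ?mulr_ge0 ?powR_ge0.
have alK : 0 < al * K by rewrite mulr_gt0.
have Nq0 : 0 < N / q by rewrite divr_gt0.
pose C0 := w / (al * K) `^ (N / q) / s `^ N.
have C00 : 0 < C0 by rewrite !divr_gt0// powR_gt0.
have GE v : G v = C0 * (I v * ((- v) `^ (N / q) * expR (v / s))).
  rewrite /G lamE /I indicE; have [v0|] := boolP (_ \in _); last by rewrite !mul0r mulr0.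
  have {}v0 : 0 < - v by move: v0; rewrite inE/= in_itv/= andbT.
  rewrite powR_div ?(ltW v0)// !mul1r (mulrC v) /C0.
  by field; rewrite !gt_eqF// powR_gt0.
have Gb : exists MG, forall v, G v <= MG.
  exists (C0 * ((N / q) / s^-1) `^ (N / q)) => v.
  rewrite GE ler_pM2l// /I indicE.
  have [v0|] := boolP (_ \in _); last by rewrite mul0r powR_ge0.
  have {}v0 : 0 < - v by move: v0; rewrite inE/= in_itv/= andbT.
  have si0 : 0 < s^-1 by rewrite invr_gt0.
  have := powR_le_expR Nq0 si0 (ltW v0).
  rewrite mul1r => hh.
  apply: (@le_trans _ _ ((N / q / s^-1) `^ (N / q) * expR (s^-1 * - v) * expR (v / s))).
    by rewrite ler_pM2r ?expR_gt0.
  by rewrite -mulrA -expRD mulrN (mulrC s^-1) addrC subrr expR0 mulr1.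
have [MG GM] := Gb.
have FGH x y : F x `^ (1 - s) * G y `^ s <= H (x + y).
  have [y0|y0] := ltP y 0; last first.
    have -> : G y = 0.
      rewrite /G /I indicE memNset ?mul0r//= in_itv/= andbT oppr_gt0.
      by apply/negP; rewrite -leNgt.
    by rewrite powR0 ?gt_eqF// mulr0.
  have := aa0 x; rewrite le_eqVlt => /orP[/eqP ax|ax].
    have -> : F x = 0 by rewrite /F -ax mul0r mulr0.
    by rewrite powR0 ?gt_eqF// mul0r.
  have lam0 : 0 <= lam y by exact: powR_ge0.
  have lamq : K * lam y `^ q = - y / al.
    rewrite /lam -powRrM mulVf ?gt_eqF// powRr1; last by rewrite divr_ge0 ?(ltW alK)// oppr_ge0 ltW.
    by field; rewrite !gt_eqF.
  have LQE : LQ x = [set z | ((x / al)%:E < Q z)%E].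
    apply/seteqP; split => z /=; rewrite /LQ /=.
      by rewrite muleC EFinM lte_pdivrMr.
    by rewrite muleC EFinM lte_pdivrMr.
  have LuE : Lu (x + y) = [set z | x / al - K * lam y `^ q < u z].
    have -> : x / al - K * lam y `^ q = (x + y) / al by rewrite lamq; field; rewrite gt_eqF.
    apply/seteqP; split => z /=; rewrite /Lu /= lte_fin ltr_pdivrMr//; by rewrite mulrC.
  have a1 := aaE x; have b1 := bbE (x + y); rewrite LQE in a1; rewrite LuE in b1.
  have lv := level_enlargement x0 N1 mms cd mu_ mQ K0 q1 Qu lam0 a1 ax b1.
  have := brunn_minkowski_product N0 s0 s1 (aa0 x) (bb0 (x + y)) lam0 w_ge0 lv.
  move=> prod.
  rewrite /F /G /H /I indicE mem_set; last by rewrite /= in_itv/= andbT oppr_gt0.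
  rewrite !mul1r powRM ?expR_ge0 ?divr_ge0 ?powR_ge0//.
  rewrite (@powRM _ (expR _)) ?expR_ge0 ?divr_ge0 ?mulr_ge0 ?powR_ge0//.
  rewrite mulrACA.
  have -> : expR (be / al * x) `^ (1 - s) * expR (s^-1 * y) `^ s = expR (x + y).
    rewrite /powR !gt_eqF ?expR_gt0// !expRK -expRD s1E; congr expR.
    by field; rewrite !gt_eqF.
  by rewrite ler_pM2l ?expR_gt0.
have HE : (\int[leb]_v (H v)%:E = h%:E)%E.
  transitivity (\int[leb]_v ((expR (1 * v))%:E * sm (Lu v)))%E.
    by apply: eq_integral => v _; rewrite /H EFinM -bbE smE.
  rewrite (@layer_cake_exp R _ _ sm _ 1 ltr01 mau) invr1 mul1e ismE -hE.
  by apply: eq_integral => x _; rewrite mul1e.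
have gGE : (\int[leb]_v (G v)%:E = (C0 * (s `^ (N / q) * s * g))%:E)%E.
  have mg1 : measurable_fun [set: measurableTypeR R] (fun v : R => expR (v / s)).
    rewrite (_ : (fun v : R => _) = (fun v : R => expR (s^-1 * v)))//.
    by apply/funext => v; rewrite mulrC.
  have mg2 : measurable_fun [set: measurableTypeR R] (fun v : R => (- v) `^ (N / q)).
    exact: (measurableT_comp (@measurable_powR R (N / q)) mopp).
  have mg3 : measurable_fun [set: measurableTypeR R] (fun v : R => (I v * ((- v) `^ (N / q) * expR (v / s)))%:E).
    by apply/measurable_EFinP; apply: measurable_funM => //; exact: measurable_funM.
  transitivity (\int[leb]_v (C0%:E * (I v * ((- v) `^ (N / q) * expR (v / s)))%:E))%E.
    by apply: eq_integral => v _; rewrite GE EFinM.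
  rewrite (ge0_integralZl leb measurableT mg3); last 2 first.
  - by move=> v _; rewrite lee_fin !mulr_ge0 ?powR_ge0 ?expR_ge0.
  - by rewrite lee_fin ltW.
  by rewrite (gamma_scaled s0 gE) -EFinM.
have gG0 : 0 < C0 * (s `^ (N / q) * s * g) by rewrite mulr_gt0// mulr_gt0// mulr_gt0// powR_gt0.
have PL := prekopa_leindler s0 s1 mF mG mH F0 G0 H0 GM FGH gGE gG0 HE.
have FE : (\int[leb]_v (F v)%:E = ((1 - s) / (1 - s) `^ N)%:E * \int[m]_x expeR (be%:E * Q x))%E.
  transitivity (((1 - s) `^ N)^-1%:E * \int[leb]_v ((expR (be / al * v))%:E * sm (LQ v)))%E.
    have mFs : measurable_fun [set: measurableTypeR R] (fun v : R => (expR (be / al * v))%:E * sm (LQ v))%E.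
      apply: emeasurable_funM; first exact/measurable_EFinP.
      exact: (@measurable_superlevel_measure R _ _ sm _ maQ).
    rewrite -(ge0_integralZl leb measurableT mFs); last 2 first.
    - by move=> v _; rewrite mule_ge0 ?lee_fin ?expR_ge0.
    - by rewrite lee_fin invr_ge0 powR_ge0.
    apply: eq_integral => v _; rewrite /F smE aaE -!EFinM; congr EFin.
    by ring.
  have bal : 0 < be / al by rewrite divr_gt0.
  rewrite (@layer_cake_exp R _ _ sm _ _ bal maQ) ismE muleA -EFinM.
  rewrite invf_div -s1E [X in (X%:E * _)%E]mulrC; congr (_ * _)%E.
  apply: eq_integral => x _; congr expeR.
  by rewrite muleA -EFinM divfK ?gt_eqF.
move: PL; rewrite FE s1i.
have -> : C0 * (s `^ (N / q) * s * g) / s = C0 * (s `^ (N / q) * g).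
  by field; rewrite gt_eqF.
have rN : 0 < (1 - s) / (1 - s) `^ N by rewrite divr_gt0// powR_gt0.
rewrite -lee_pdivlMl// -EFinM => PL; apply: le_trans PL _.
rewrite lee_fin -s1E -/C0 le_eqVlt; apply/orP; left; apply/eqP.
by field; rewrite !gt_eqF// powR_gt0.
Qed.

End integral_hypercontractivity.

(** * The algebra of the sharp constant *)

Section constants_algebra.
Context {R : realType}.

Lemma ln_inv (x : R) : 0 < x -> ln x^-1 = - ln x.
Proof. by move=> x0; rewrite lnV. Qed.

Lemma ln_mul (x y : R) : 0 < x -> 0 < y -> ln (x * y) = ln x + ln y.
Proof. by move=> x0 y0; rewrite lnM. Qed.

Lemma ln_powR_mul (a x y : R) : 0 < x -> 0 < y -> ln (x `^ a * y) = a * ln x + ln y.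
Proof. by move=> x0 y0; rewrite ln_mul ?powR_gt0// ln_powR. Qed.

Lemma ln_eq (x y : R) : 0 < x -> 0 < y -> ln x = ln y -> x = y.
Proof. by move=> x0 y0 h; apply: ln_inj; rewrite ?posrE. Qed.

Lemma ln_potential_scale (q t : R) : 0 < q -> 0 < t ->
  ln (q * t `^ (q - 1))^-1 = - (ln q + (q - 1) * ln t).
Proof.
move=> q0 t0; have tq : 0 < t `^ (q - 1) by rewrite powR_gt0.
by rewrite (ln_inv (mulr_gt0 q0 tq)) (ln_mul q0 tq) ln_powR.
Qed.

Lemma ln_gaussian_mass (A sg c k r g : R) : 0 < A -> 0 < sg -> 0 < c -> 0 < k -> 0 < g ->
  0 < A * sg / (c * k) `^ r * g /\
  ln (A * sg / (c * k) `^ r * g) = ln A + ln sg - r * (ln c + ln k) + ln g.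
Proof.
move=> A0 sg0 c0 k0 g0; have ck : 0 < c * k := mulr_gt0 c0 k0.
have P0 : 0 < ((c * k) `^ r)^-1 by rewrite invr_gt0 powR_gt0.
have Asg := mulr_gt0 A0 sg0; have AP := mulr_gt0 Asg P0.
split; first exact: mulr_gt0.
rewrite (ln_mul AP g0) (ln_mul Asg P0) (ln_mul A0 sg0) ln_inv ?powR_gt0//.
by rewrite ln_powR (ln_mul c0 k0).
Qed.

(** The constant of the theorem as a function of the asymptotic volume ratio A,
of sg = sigma_N and of g = Gamma(N/p'+1). *)
Definition K0_formula (N p A sg g : R) : R :=
  p / N * ((p - 1) / expR 1) `^ (p - 1) * (sg * g) `^ (- (p / N)) * A `^ (- (p / N))
  * (N * expR (p - 1) / p `^ p).

Lemma K0_formula_gt0 (N p A sg g : R) : 0 < N -> 1 < p -> 0 < A -> 0 < sg -> 0 < g ->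
  0 < K0_formula N p A sg g.
Proof.
move=> N0 p1 A0 sg0 g0; have p0 : 0 < p by rewrite (lt_trans _ p1).
have p10 : 0 < p - 1 by rewrite subr_gt0.
by rewrite /K0_formula !mulr_gt0 ?powR_gt0 ?divr_gt0 ?mulr_gt0 ?expR_gt0 ?invr_gt0 ?powR_gt0.
Qed.

Lemma ln_K0_formula (N p A sg g : R) : 0 < N -> 1 < p -> 0 < A -> 0 < sg -> 0 < g ->
  ln (K0_formula N p A sg g) =
    (1 - p) * (ln p - ln (p - 1)) - p / N * (ln A + ln sg + ln g).
Proof.
move=> N0 p1 A0 sg0 g0; have p0 : 0 < p by rewrite (lt_trans _ p1).
have p10 : 0 < p - 1 by rewrite subr_gt0.
rewrite /K0_formula !lnM ?posrE ?mulr_gt0 ?powR_gt0 ?divr_gt0 ?mulr_gt0 ?expR_gt0 ?invr_gt0 ?powR_gt0//.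
rewrite !ln_powR !lnM ?posrE ?invr_gt0 ?expR_gt0 ?powR_gt0//.
rewrite !ln_inv ?expR_gt0 ?powR_gt0// !expRK ln_powR.
by field; rewrite !gt_eqF.
Qed.

Lemma ln_hc_factor (N p al be t K : R) : 1 < p -> 0 < al -> al < be -> 0 < t -> 0 < K ->
  0 < hc_factor N p al be t K /\
  ln (hc_factor N p al be t K) =
    N / p * ((be - al) / (al * be)) * (ln (be - al) - ln t)
    + N / (al * be) * (al / p + be / conj_exp p) * ln al
    - N / (al * be) * (be / p + al / conj_exp p) * ln be
    + N / p * ((be - al) / (al * be)) * ln K.
Proof.
move=> p1 al0 albe t0 K0; have be0 : 0 < be := lt_trans al0 albe.
have ba : 0 < be - al by rewrite subr_gt0.
have bat : 0 < (be - al) / t by rewrite divr_gt0.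
rewrite /hc_factor; split.
  by rewrite !mulr_gt0 ?powR_gt0 ?invr_gt0 ?powR_gt0.
rewrite !lnM ?posrE ?mulr_gt0 ?invr_gt0 ?powR_gt0//.
rewrite ln_inv ?powR_gt0// !ln_powR lnM ?posrE ?invr_gt0//.
by rewrite ln_inv//; ring.
Qed.

(** The left-hand side is what Prekopa-Leindler yields. Both sides are positive,
and their logarithms agree as rational expressions in the logarithms of the
parameters. *)
Lemma hc_constant (N p al be t A sg g : R) : 0 < N -> 1 < p -> 0 < al -> al < be -> 0 < t ->
  0 < A -> 0 < sg -> 0 < g ->
  forall q s K : R, q = conj_exp p -> s = 1 - al / be -> K = (q * t `^ (q - 1))^-1 ->
  ((al / be) `^ N) `^ be^-1
    * ((A * sg / (al * K) `^ (N / q) / s `^ N * (s `^ (N / q) * g)) `^ s) `^ (- al^-1)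
  = hc_factor N p al be t (K0_formula N p A sg g).
Proof.
move=> N0 p1 al0 albe t0 A0 sg0 g0 q s K qE sE' KE.
have p0 : 0 < p by rewrite (lt_trans _ p1).
have p10 : 0 < p - 1 by rewrite subr_gt0.
have be0 : 0 < be := lt_trans al0 albe.
have ba : 0 < be - al by rewrite subr_gt0.
have q0 : 0 < q by rewrite qE /conj_exp divr_gt0.
have sE : s = (be - al) / be by rewrite sE'; field; rewrite gt_eqF.
have s0 : 0 < s by rewrite sE divr_gt0.
have K0 : 0 < K by rewrite KE invr_gt0 mulr_gt0// powR_gt0.
have alK : 0 < al * K by rewrite mulr_gt0.
have AK := K0_formula_gt0 N0 p1 A0 sg0 g0.
have [] := ln_hc_factor N p1 al0 albe t0 AK.
rewrite (ln_K0_formula N0 p1 A0 sg0 g0).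
move: (hc_factor _ _ _ _ _ _) => H hc0 hcE.
have sN0 : 0 < (s `^ N)^-1 by rewrite invr_gt0 powR_gt0.
have sNq0 : 0 < s `^ (N / q) by rewrite powR_gt0.
have -> : A * sg / (al * K) `^ (N / q) / s `^ N * (s `^ (N / q) * g) =
    A * sg / (al * K) `^ (N / q) * g * (s `^ (N / q) / s `^ N) by ring.
have [G0 GE] := ln_gaussian_mass (N / q) A0 sg0 al0 K0 g0.
have W0 : 0 < s `^ (N / q) / s `^ N := mulr_gt0 sNq0 sN0.
have ab0 : 0 < al / be by rewrite divr_gt0.
have L0 : 0 < ((al / be) `^ N) `^ be^-1 by rewrite !powR_gt0.
have M0 (x : R) : 0 < x -> 0 < (x `^ s) `^ (- al^-1) by move=> x0; rewrite !powR_gt0.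
have GW := mulr_gt0 G0 W0.
apply: ln_eq => //; first exact: mulr_gt0 L0 (M0 _ GW).
have lnab (x : R) : 0 < x -> ln (x / be) = ln x - ln be.
  by move=> x0; rewrite ln_mul ?invr_gt0// ln_inv.
have lnL : ln ((al / be) `^ N) = N * (ln al - ln be) by rewrite ln_powR lnab.
have lnW : ln (s `^ (N / q) / s `^ N) = N / q * ln s - N * ln s.
  by rewrite (ln_mul sNq0 sN0) ln_inv ?powR_gt0// !ln_powR.
have lnG := etrans (ln_powR _ s) (congr1 (fun z => s * z) (ln_mul G0 W0)).
apply: etrans (ln_powR_mul _ _ (M0 _ GW)) _; first by rewrite powR_gt0.
rewrite lnL ln_powR lnG GE lnW hcE.
rewrite KE ln_potential_scale// sE !lnab// qE /conj_exp.
rewrite (ln_mul p0) ?invr_gt0// ln_inv//.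
have pp : p - (p - 1) = 1 by ring.
field.
by rewrite ?pp !gt_eqF ?oner_neq0.
Qed.

(** The equality case: for the potentials - k1 d^q and - k2 d^q, of time scales tau
and tau - t, on a cone of density A sg, the integrals of e^(al u) and
e^(be Q_t u) are the two quantities raised to the powers 1/al and 1/be here.
The scale tau is the one for which they agree up to the factor of the theorem. *)
Lemma hc_extremal (N p al be t tau A sg g : R) : 0 < N -> 1 < p -> 0 < al -> al < be -> 0 < t ->
  0 < A -> 0 < sg -> 0 < g -> tau = t * be / (be - al) ->
  forall q k1 k2 : R, q = conj_exp p ->
  k1 = (q * tau `^ (q - 1))^-1 -> k2 = (q * (tau - t) `^ (q - 1))^-1 ->
  (A * sg / (be * k2) `^ (N / q) * g) `^ be^-1 =
  (A * sg / (al * k1) `^ (N / q) * g) `^ al^-1 * hc_factor N p al be t (K0_formula N p A sg g).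
Proof.
move=> N0 p1 al0 albe t0 A0 sg0 g0 tauE q k1 k2 qE k1E k2E.
have p0 : 0 < p by rewrite (lt_trans _ p1).
have p10 : 0 < p - 1 by rewrite subr_gt0.
have be0 : 0 < be := lt_trans al0 albe.
have ba : 0 < be - al by rewrite subr_gt0.
have q0 : 0 < q by rewrite qE /conj_exp divr_gt0.
have tau0 : 0 < tau by rewrite tauE divr_gt0// mulr_gt0.
have taut : tau - t = t * al / (be - al) by rewrite tauE; field; rewrite gt_eqF.
have taut0 : 0 < tau - t by rewrite taut divr_gt0// mulr_gt0.
have k10 : 0 < k1 by rewrite k1E invr_gt0 mulr_gt0// powR_gt0.
have k20 : 0 < k2 by rewrite k2E invr_gt0 mulr_gt0// powR_gt0.
have AK := K0_formula_gt0 N0 p1 A0 sg0 g0.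
have [] := ln_hc_factor N p1 al0 albe t0 AK.
rewrite (ln_K0_formula N0 p1 A0 sg0 g0).
move: (hc_factor _ _ _ _ _ _) => H hc0 hcE.
have [P1 E1] := ln_gaussian_mass (N / q) A0 sg0 al0 k10 g0.
have [P2 E2] := ln_gaussian_mass (N / q) A0 sg0 be0 k20 g0.
have P1al : 0 < (A * sg / (al * k1) `^ (N / q) * g) `^ al^-1 by rewrite powR_gt0.
apply: ln_eq; [by rewrite powR_gt0|exact: mulr_gt0|].
apply: etrans (ln_powR _ _) _; apply: etrans _ (esym (ln_powR_mul _ P1 hc0)).
rewrite E1 E2 hcE.
rewrite k1E k2E !ln_potential_scale// taut tauE.
have lnt (x : R) : 0 < x -> ln (t * x / (be - al)) = ln t + ln x - ln (be - al).
  by move=> x0; rewrite ln_mul ?invr_gt0 ?mulr_gt0// ln_mul// ln_inv.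
rewrite !lnt// qE /conj_exp (ln_mul p0) ?invr_gt0// ln_inv//.
have pp : p - (p - 1) = 1 by ring.
field.
by rewrite ?pp !gt_eqF ?oner_neq0.
Qed.

End constants_algebra.

(** * Hypercontractivity of the Hopf-Lax semigroup *)

Section hopf_lax_facts.
Context {R : realType} {X : completeMetricType R}.
Variable m : {measure set (borel X) -> \bar R}.
Implicit Types (u : X -> R) (p t : R).

Lemma locally_lipschitz_continuous u : locally_lipschitz u -> continuous u.
Proof.
move=> lu x; have [r [L [r0 uL]]] := lu x.
apply/cvgrPdist_lt => e e0.
pose L' := `|L| + 1.
have L'0 : 0 < L' by rewrite /L' ltr_wpDl.
apply/nbhs_ballP; exists (Num.min r (e / L')); first by rewrite /= lt_min r0 divr_gt0.
move=> y; rewrite ballEmdist /= lt_min => /andP[xyr xye].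
have yr : ball x r y by rewrite ballEmdist.
apply: le_lt_trans (uL x y (ballxx _ r0) yr) _.
apply: (@le_lt_trans _ _ (L' * mdist x y)).
  rewrite ler_wpM2r ?mdist_ge0//; apply: le_trans (ler_norm _) _; rewrite /L'; lra.
by rewrite mulrC -ltr_pdivlMr.
Qed.

Lemma conj_exp_gt1 p : 1 < p -> 1 < conj_exp p.
Proof.
move=> p1; rewrite /conj_exp ltr_pdivlMr ?subr_gt0// mul1r; lra.
Qed.

Lemma hopf_lax_le p t u x z : t != 0 ->
  (hopf_lax p t u x <= (u z + (conj_exp p * t `^ (conj_exp p - 1))^-1 * mdist x z `^ conj_exp p)%:E)%E.
Proof.
move=> t0; rewrite /hopf_lax (negbTE t0).
by apply: ereal_inf_lbound; exists z => //; rewrite [in LHS]mulrC.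
Qed.

(** An infimum over an uncountable family, but of upper semicontinuous functions. *)
Lemma measurable_hopf_lax p t u : 1 < p -> 0 < t -> 
  measurable_fun setT (hopf_lax p t u : borel X -> \bar R).
Proof.
move=> p1 t0; apply: usc_measurable => c.
have q1 := conj_exp_gt1 p1; set q := conj_exp p in q1.
have q0 : 0 < q by exact: lt_trans q1.
have Kp : 0 < q * t `^ (q - 1) by rewrite mulr_gt0// powR_gt0.
rewrite (_ : [set x | _] = \bigcup_(z in setT)
   [set x : X | u z + mdist x z `^ q / (q * t `^ (q - 1)) < c]); last first.
  apply/seteqP; split => x /=; rewrite /hopf_lax gt_eqF//.
    by move=> /ereal_inf_lt[_ [z _ <-]]; rewrite lte_fin => h; exists z.
  move=> [z _ h]; apply: (@le_lt_trans _ _ (u z + mdist x z `^ q / (q * t `^ (q - 1)))%:E).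
    by apply: ereal_inf_lbound; exists z.
  by rewrite lte_fin.
apply: bigcup_open => z _.
have [cz|zc] := leP (c - u z) 0.
  rewrite (_ : [set x | _] = set0); first exact: open0.
  apply/seteqP; split => x //=.
  have : 0 <= mdist x z `^ q / (q * t `^ (q - 1)) by rewrite divr_ge0 ?powR_ge0 ?(ltW Kp).
  move=> h1 h2; lra.
rewrite (_ : [set x | _] = [set x | mdist z x < ((c - u z) * (q * t `^ (q - 1))) `^ q^-1]).
  exact: open_mdist_lt.
have czK : 0 < (c - u z) * (q * t `^ (q - 1)) by rewrite mulr_gt0.
have E (x : X) : (mdist x z `^ q) `^ q^-1 = mdist z x.
  by rewrite -powRrM mulfV ?gt_eqF// powRr1 ?mdist_ge0// metric_sym.
have E2 : (((c - u z) * (q * t `^ (q - 1))) `^ q^-1) `^ q = (c - u z) * (q * t `^ (q - 1)).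
  by rewrite -powRrM mulVf ?gt_eqF// powRr1 ?(ltW czK).
apply/seteqP; split => x /=; rewrite -ltrBrDl ltr_pdivrMr// => h.
  rewrite -(E x); apply: gt0_ltr_powR; rewrite ?invr_gt0 ?nnegrE ?powR_ge0 ?(ltW czK)//.
by rewrite -E2 (metric_sym x); apply: gt0_ltr_powR; rewrite ?nnegrE ?mdist_ge0 ?powR_ge0.
Qed.

Lemma Lnorm_expR (be : R) u : be != 0 ->
  ('N[m]_(be%:E)[(fun x : borel X => (expR (u x))%:E)] =
   (\int[m]_x (expR (be * u x))%:E) `^ be^-1)%E.
Proof.
move=> be0; rewrite unlock; congr (_ `^ _)%E; apply: eq_integral => x _.
rewrite gee0_abs ?lee_fin ?expR_ge0// poweR_EFin; congr EFin.
by rewrite /powR gt_eqF ?expR_gt0// expRK.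
Qed.

Lemma Lnorm_expeR (be : R) (Q : X -> \bar R) : 0 < be ->
  ('N[m]_(be%:E)[(fun x : borel X => expeR (Q x))] =
   (\int[m]_x expeR (be%:E * Q x)) `^ be^-1)%E.
Proof.
move=> be0; rewrite unlock; congr (_ `^ _)%E; apply: eq_integral => x _.
rewrite gee0_abs ?expeR_ge0//; case: (Q x) => [r| |].
- rewrite /= ; congr EFin.
  by rewrite /powR gt_eqF ?expR_gt0// expRK.
- by rewrite gt0_muley ?lte_fin// poweRyr ?gt_eqF.
- by rewrite gt0_muleNy ?lte_fin// poweR0r ?gt_eqF.
Qed.

End hopf_lax_facts.

Section upper_bound.
Context {R : realType} {X : completeMetricType R}.
Variable m : {measure set (borel X) -> \bar R}.

Lemma admissible_integral p al (x0 : X) (u : X -> R) : 0 < al -> locally_lipschitz u ->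
  admissible m p al x0 u -> exists2 h, 0 <= h & (\int[m]_x (expR (al * u x))%:E = h%:E)%E.
Proof.
move=> al0 lu [/integrableP[mi fi] _].
have mu_ := continuous_measurable_borel (locally_lipschitz_continuous lu).
have mexpu : measurable_fun setT (fun x : borel X => (expR (al * u x))%:E : \bar R).
  by apply/measurable_EFinP; apply: measurableT_comp => //; exact: measurable_funM.
have i0 : (0 <= \int[m]_x (expR (al * u x))%:E)%E by apply: integral_ge0 => x _; rewrite lee_fin expR_ge0.
exists (fine (\int[m]_x (expR (al * u x))%:E)%E); first exact: fine_ge0.
rewrite fineK// ge0_fin_numE//; apply: le_lt_trans fi.
apply: ge0_le_integral => //.
- exact: measurableT_comp.
move=> x _; rewrite /= lee_fin ger0_norm; last first.
  by rewrite mulr_ge0 ?expR_ge0// addr_ge0 ?powR_ge0.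
by rewrite ler_peMl ?expR_ge0// lerDl powR_ge0.
Qed.

Lemma K0_constE N p (x0 : X) g : 0 < N -> 
  euler_gamma (N / conj_exp p + 1) = g ->
  K0_const m N p x0 = K0_formula N p (fine (AVR m N x0)) (sigma_const N) g.
Proof. by move=> N0 gE; rewrite /K0_const /L_const /K0_formula gE. Qed.

(** For al < be this is the integral inequality raised to the power 1/be. For
al = be it reduces to Q_t u <= u. *)
Lemma hypercontractive_bound (N t0 : R) (x0 : X) :
  1 < N -> metric_measure_space m -> CD0 m N ->
  (0 < AVR m N x0)%E -> 0 < t0 ->
  forall (p al be t : R) (u : X -> R),
     1 < p -> 0 < al -> al <= be -> 0 < t -> t < t0 ->
     class_F p t0 x0 u -> admissible m p al x0 u ->
     hypercontractive m N p al be t u (K0_const m N p x0).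
Proof.
move=> N1 mms cd A0 t00 p al be t u p1 al0 albe t_gt0 tt0 uF adm.
have N0 : 0 < N by exact: lt_trans N1.
have lu : locally_lipschitz u by case: uF => -[].
have [h h0 hE] := admissible_integral al0 lu adm.
have mu_ := continuous_measurable_borel (locally_lipschitz_continuous lu).
have be0 : 0 < be := lt_le_trans al0 albe.
have tn0 : t != 0 by rewrite gt_eqF.
have mQ := measurable_hopf_lax u p1 t_gt0.
have q1 := conj_exp_gt1 p1; have q0 : 0 < conj_exp p by exact: lt_trans q1.
rewrite /hypercontractive Lnorm_expeR// Lnorm_expR ?gt_eqF// hE.
have Qle x : (hopf_lax p t u x <= (u x)%:E)%E.
  by apply: le_trans (hopf_lax_le p u x x tn0) _; rewrite mdistxx powR0 ?gt_eqF// mulr0 addr0.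
move: albe; rewrite le_eqVlt => /orP[/eqP albe|albe].
  rewrite -albe /hc_factor subrr !mul0r mulr0 !powRr0 mul1r mulr1.
  have -> : al / p + al / conj_exp p = al.
    by rewrite /conj_exp; field; rewrite subr_eq0 !gt_eqF// (lt_trans _ p1).
  rewrite divff ?gt_eqF ?powR_gt0// mule1 -hE.
  apply: gt0_ler_poweR; rewrite ?in_itv/= ?leey ?andbT ?integral_ge0//.
  - by rewrite invr_ge0 ltW.
  - by move=> x _; exact: expeR_ge0.
  apply: ge0_le_integral => //.
  - by move=> x _; exact: expeR_ge0.
  - by apply: (measurableT_comp measurable_expeR); exact: measurable_funeM.
  - by apply/measurable_EFinP; apply: measurableT_comp => //; exact: measurable_funM.
  move=> x _; rewrite (_ : (expR (al * u x))%:E = expeR (al * u x)%:E)// lee_expeR EFinM.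
  by apply: lee_wpmul2l; [rewrite lee_fin ltW|exact: Qle].
have Nq0 : 0 < N / conj_exp p by rewrite divr_gt0.
have [g g0 [gE gI]] := gamma_spec Nq0.
have sg0 := sigma_const_gt0 N0.
rewrite (K0_constE x0 N0 gE).
have AE := AVR_asymptotic_density x0 N1 mms cd.
move: A0; rewrite AE lte_fin => A0 /=.
set A := _ / sigma_const N.
have wE : asymptotic_density m N x0 = A * sigma_const N by rewrite /A divfK// gt_eqF.
pose K := (conj_exp p * t `^ (conj_exp p - 1))^-1.
have K0 : 0 < K by rewrite invr_gt0 mulr_gt0// powR_gt0.
have w0 : 0 < asymptotic_density m N x0 by rewrite wE mulr_gt0.
pose s := 1 - al / be.
have main := integral_hypercontractivity N1 mms cd mu_ mQ K0 q1 al0 albe w0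
  (fun x z => hopf_lax_le p u x z tn0) hE g0 gI (erefl s).
have i0 : (0 <= \int[m]_x expeR (be%:E * hopf_lax p t u x))%E by apply: integral_ge0 => x _; exact: expeR_ge0.
apply: (le_trans (gt0_ler_poweR _ _ _ main)).
- by rewrite invr_ge0 ltW.
- by rewrite in_itv/= leey andbT.
- by rewrite in_itv/= leey andbT (le_trans i0 main).
rewrite !poweR_EFin -EFinM lee_fin le_eqVlt; apply/orP; left; apply/eqP.
rewrite wE -(hc_constant N0 p1 al0 albe t_gt0 A0 sg0 g0 (erefl _) (erefl s) (erefl K)).
set G := _ * (s `^ _ * g).
have Gs0 : 0 <= G `^ s by exact: powR_ge0.
have ab0 : 0 <= (al / be) `^ N by exact: powR_ge0.
rewrite (@powRM R ((al / be) `^ N) ((h / G `^ s) `^ (be / al)) be^-1 ab0 (powR_ge0 _ _)).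
rewrite -(powRrM (h / G `^ s)).
have -> : be / al * be^-1 = al^-1 by field; rewrite !gt_eqF.
have Gpos : 0 < G.
  have sE : s = (be - al) / be by rewrite /s; field; rewrite gt_eqF.
  have s0 : 0 < s by rewrite sE divr_gt0// subr_gt0.
  have alK : 0 < al * K by rewrite mulr_gt0.
  have Asg : 0 < A * sigma_const N by rewrite -wE.
  apply: mulr_gt0; last by apply: mulr_gt0 => //; exact: powR_gt0.
  by apply: divr_gt0; [apply: divr_gt0 => //|]; exact: powR_gt0.
have Gsp : 0 < G `^ s by rewrite powR_gt0.
by rewrite (powR_div _ Gsp h0) powRN mulrA mulrCA mulrA.
Qed.

End upper_bound.

(** * Convexity inequalities for powers *)

Section power_inequalities.
Context {R : realType}.
Implicit Types a b q t tau kap : R.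

(** The graph of the convex function x^q is above its tangent at b. *)
Lemma powR_tangent q a b : 1 < q -> 0 <= a -> 0 <= b ->
  q * a * b `^ (q - 1) <= a `^ q + (q - 1) * b `^ q.
Proof.
move=> q1 a0 b0; have q0 : 0 < q by exact: lt_trans q1.
have s0 : 0 < 1 - q^-1 by rewrite subr_gt0 invf_lt1.
have s1 : 1 - q^-1 < 1 by rewrite ltrBlDr ltrDl invr_gt0.
have := weighted_AMGM s0 s1 (powR_ge0 a q) (powR_ge0 b q).
have -> : 1 - (1 - q^-1) = q^-1 by ring.
rewrite -!powRrM mulfV ?gt_eqF// powRr1//.
have -> : q * (1 - q^-1) = q - 1 by field; rewrite gt_eqF.
rewrite -(ler_pM2l q0) => h; apply: le_trans (le_trans h _); first by rewrite mulrA.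
by rewrite le_eqVlt; apply/orP; left; apply/eqP; field; rewrite gt_eqF.
Qed.

Lemma powR_split q b : 1 < q -> 0 <= b -> b * b `^ (q - 1) = b `^ q.
Proof. by move=> q1 b0; rewrite mulr_powRB1// (lt_trans _ q1). Qed.

(** Convexity of the perspective function (x, r) |-> x^q / r^(q-1): add its tangent
inequalities along the direction (a + b, tau). *)
Lemma powR_perspective q a b t tau : 1 < q -> 0 <= a -> 0 <= b -> 0 < t -> t < tau ->
  (a + b) `^ q / tau `^ (q - 1) <= a `^ q / (tau - t) `^ (q - 1) + b `^ q / t `^ (q - 1).
Proof.
move=> q1 a0 b0 t0 ttau.
have tau0 : 0 < tau := lt_trans t0 ttau.
have r0 : 0 < tau - t by rewrite subr_gt0.
pose c := (a + b) / tau.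
have c0 : 0 <= c by rewrite divr_ge0 ?addr_ge0// ltW.
have aux (x r : R) : 0 <= x -> 0 < r -> q * x * c `^ (q - 1) - (q - 1) * (r * c `^ q) <= x `^ q / r `^ (q - 1).
  move=> x0 {}r0; have rp : 0 < r `^ (q - 1) by rewrite powR_gt0.
  have rc0 : 0 <= r * c by rewrite mulr_ge0// ltW.
  rewrite ler_pdivlMr// mulrBl lerBlDr.
  have e1 : (r * c) `^ (q - 1) = r `^ (q - 1) * c `^ (q - 1) by rewrite powRM// ltW.
  have e2 : (r * c) `^ q = r * r `^ (q - 1) * c `^ q by rewrite powRM ?(ltW r0)// -(powR_split q1 (ltW r0)).
  have := powR_tangent q1 x0 rc0; rewrite e1 e2 => h; lra.
have h1 := aux a (tau - t) a0 r0; have h2 := aux b t b0 t0.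
apply: le_trans (lerD h1 h2).
have E : a + b = tau * c by rewrite /c mulrC divfK// gt_eqF.
have e2 : (a + b) `^ q = tau * tau `^ (q - 1) * (c * c `^ (q - 1)).
  by rewrite E powRM ?(ltW tau0)// -(powR_split q1 (ltW tau0)) -(powR_split q1 c0).
have -> : a = tau * c - b by rewrite -E addrK.
rewrite (_ : tau * c - b + b = a + b); last by rewrite subrK.
rewrite e2 -(powR_split q1 c0).
have tp : 0 < tau `^ (q - 1) by rewrite powR_gt0.
by rewrite le_eqVlt; apply/orP; left; apply/eqP; field; rewrite gt_eqF.
Qed.

(** By the tangent inequality at the point B where kap q B^(q-1) = mm. *)
Lemma expR_powR_dominated q kap mm : 1 < q -> 0 < kap -> 0 < mm ->
  exists2 C, 0 < C & forall a, 0 <= a -> expR (- (kap * a `^ q)) <= C * expR (- (mm * a)).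
Proof.
move=> q1 k0 m0; have q0 : 0 < q by exact: lt_trans q1.
have q10 : 0 < q - 1 by rewrite subr_gt0.
pose B := (mm / (kap * q)) `^ (q - 1)^-1.
have B0 : 0 <= B by exact: powR_ge0.
have BE : B `^ (q - 1) = mm / (kap * q).
  by rewrite /B -powRrM mulVf ?gt_eqF// powRr1// divr_ge0 ?mulr_ge0 ?ltW.
exists (expR (kap * ((q - 1) * B `^ q))); first exact: expR_gt0.
move=> a a0; rewrite -expRD ler_expR.
have := powR_tangent q1 a0 B0; rewrite BE.
rewrite -(ler_pM2l k0).
have -> : kap * (q * a * (mm / (kap * q))) = mm * a by field; rewrite !gt_eqF.
rewrite mulrDr => h; lra.
Qed.

(** The derivative kap q a^(q-1) e^(-kap a^q) decays faster than e^(-a). The decay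
is what makes the slope of the test functions p-integrable. *)
Lemma expR_powR_lipschitz q kap : 1 < q -> 0 < kap ->
  exists2 C, 0 < C & forall a b, 0 <= a -> 0 <= b -> `|a - b| <= 1 ->
    `|expR (- (kap * a `^ q)) - expR (- (kap * b `^ q))| <= C * expR (- a) * `|a - b|.
Proof.
move=> q1 k0; have q0 : 0 < q by exact: lt_trans q1.
have q10 : 0 < q - 1 by rewrite subr_gt0.
have [C2 C20 C2P] := expR_powR_dominated q1 k0 (ltr0Sn R 1).
pose C1 := ((q - 1) / 1) `^ (q - 1).
have C10 : 0 < C1 by rewrite powR_gt0// divr_gt0.
pose C := kap * q * C1 * expR 1 * C2 * expR 1.
have C0 : 0 < C by rewrite /C !mulr_gt0 ?expR_gt0.
exists C => //.
have main lo hi : 0 <= lo -> lo <= hi -> hi <= lo + 1 ->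
    expR (- (kap * lo `^ q)) - expR (- (kap * hi `^ q)) <= kap * q * C1 * expR 1 * C2 * expR (- lo) * (hi - lo).
  move=> lo0 lohi hilo; have hi0 : 0 <= hi := le_trans lo0 lohi.
  have h1 : expR (- (kap * lo `^ q)) - expR (- (kap * hi `^ q)) <=
     expR (- (kap * lo `^ q)) * (kap * (hi `^ q - lo `^ q)).
    have := expR_ge1Dx (- (kap * (hi `^ q - lo `^ q))).
    rewrite -(ler_pM2l (expR_gt0 (- (kap * lo `^ q)))) -expRD.
    have -> : - (kap * lo `^ q) + - (kap * (hi `^ q - lo `^ q)) = - (kap * hi `^ q) by ring.
    rewrite mulrDr mulr1 mulrN => h; lra.
  have h2 : hi `^ q - lo `^ q <= q * hi `^ (q - 1) * (hi - lo).
    have := powR_tangent q1 lo0 hi0; rewrite -(powR_split q1 hi0) => h; lra.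
  have h3 : hi `^ (q - 1) <= C1 * (expR 1 * expR lo).
    have := powR_le_expR q10 ltr01 hi0; rewrite mul1r -/C1 => /le_trans; apply.
    by rewrite ler_pM2l// -expRD ler_expR addrC.
  have h4 := C2P _ lo0.
  apply: (le_trans h1).
  apply: (@le_trans _ _ (C2 * expR (- (2 * lo)) * (kap * (q * (C1 * (expR 1 * expR lo)) * (hi - lo))))).
    apply: ler_pM => //; rewrite ?expR_ge0//.
      rewrite mulr_ge0 ?(ltW k0)// subr_ge0.
      by apply: ge0_ler_powR; rewrite ?nnegrE ?(ltW q0).
    rewrite ler_pM2l//; apply: (le_trans h2).
    by rewrite ler_wpM2r ?subr_ge0// ler_pM2l.
  have -> : expR (- lo) = expR (- (2 * lo)) * expR lo by rewrite -expRD; congr expR; ring.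
  by rewrite le_eqVlt; apply/orP; left; apply/eqP; ring.
have step lo a' : lo <= a' -> a' <= lo + 1 -> expR (- lo) <= expR 1 * expR (- a').
  by move=> h1 h2; rewrite -expRD ler_expR; lra.
have K1 : 0 <= kap * q * C1 * expR 1 * C2.
  by rewrite !mulr_ge0 ?expR_ge0 ?(ltW k0) ?(ltW q0) ?(ltW C10) ?(ltW C20).
have anti lo hi : 0 <= lo -> lo <= hi -> expR (- (kap * hi `^ q)) <= expR (- (kap * lo `^ q)).
  move=> lo0 lohi; rewrite ler_expR lerN2 ler_pM2l//.
  by apply: ge0_ler_powR; rewrite ?nnegrE ?(ltW q0)// (le_trans lo0).
move=> a b a0 b0 ab.
have [leab|ltba] := leP a b.
  have ba : b <= a + 1 by move: ab; rewrite ler_norml => /andP[h1 h2]; lra.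
  rewrite ger0_norm ?subr_ge0 ?anti//; apply: (le_trans (main _ _ a0 leab ba)).
  rewrite distrC ger0_norm ?subr_ge0// ler_wpM2r ?subr_ge0//.
  rewrite /C -(mulrA _ (expR 1) (expR (- a))) ler_wpM2l//.
  by apply: step => //; rewrite lerDl.
have aba : a <= b + 1 by move: ab; rewrite ler_norml => /andP[h1 h2]; lra.
rewrite distrC ger0_norm ?subr_ge0 ?anti ?(ltW ltba)//.
apply: (le_trans (main _ _ b0 (ltW ltba) aba)).
rewrite ger0_norm ?subr_ge0 ?(ltW ltba)// ler_wpM2r ?subr_ge0 ?(ltW ltba)//.
rewrite /C -(mulrA _ (expR 1) (expR (- a))) ler_wpM2l//.
by apply: step => //; exact: ltW.
Qed.

End power_inequalities.

(** * Exponential integrals of the distance *)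

Section distance_integrals.
Context {R : realType} {X : completeMetricType R}.
Notation leb := (@lebesgue_measure R).
Variable m : {measure set (borel X) -> \bar R}.
Variables (N : R) (x0 : X).
Hypothesis N1 : 1 < N.
Hypothesis mms : metric_measure_space m.
Hypothesis cd : CD0 m N.
Let w := asymptotic_density m N x0.
Let N0 : 0 < N. Proof. exact: lt_trans N1. Qed.
Let w_ge0 : 0 <= w. Proof. exact: asymptotic_density_ge0. Qed.

Let measurable_dist_pow q kap : measurable_fun setT (fun x : borel X => - (kap * mdist x0 (x : X) `^ q)).
Proof.
apply: measurable_funN; apply: measurable_funM => //.
exact: (measurableT_comp (@measurable_powR R q) (measurable_mdistr x0)).
Qed.

Let I (v : R) : R := (\1_(`]0%R, +oo[%classic : set R) (- v) : R).

Let mI : measurable_fun [set: measurableTypeR R] I.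
Proof.
have mopp : measurable_fun [set: measurableTypeR R] (fun v : R => - v) by exact: oppr_measurable.
have mi : measurable_fun [set: measurableTypeR R] (\1_(`]0%R, +oo[%classic : set R) : R -> R).
  exact: measurable_indic.
exact: (measurableT_comp mi mopp).
Qed.

(** Superlevel sets of - kap d^q are balls; levels are negative, hence the indicator. *)
Lemma dist_integral_layer q kap : 0 < q -> 0 < kap ->
  (\int[m]_x (expR (- (kap * mdist x0 (x : X) `^ q)))%:E =
   \int[leb]_v (I v * (expR v * volume m x0 ((- v / kap) `^ q^-1)))%:E)%E.
Proof.
move=> q0 k0.
have [sm smE] := sigma_finite_pack (metric_measure_sigma_finite x0 mms).
have mf : measurable_fun setT (fun x : borel X => (- (kap * mdist x0 (x : X) `^ q))%:E : \bar R).
  exact/measurable_EFinP.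
have := @layer_cake_exp R _ _ sm _ 1 ltr01 mf.
rewrite invr1 mul1e (_ : \int[sm]_x _ = \int[m]_x (expR (- (kap * mdist x0 (x : X) `^ q)))%:E)%E; last first.
  rewrite (eq_measure_integral m); last by move=> A _ _; rewrite -smE.
  by apply: eq_integral => x _; rewrite mul1e.
move=> <-; apply: eq_integral => v _; rewrite smE mul1r /I indicE.
have [v0|v0] := boolP (_ \in _).
  have {}v0 : 0 < - v by move: v0; rewrite inE/= in_itv/= andbT.
  rewrite mul1r EFinM -(volumeE x0 N1 mms cd); congr (_ * m _)%E.
  have vk : 0 <= - v / kap by rewrite divr_ge0 ?(ltW v0) ?(ltW k0).
  have E : ((- v / kap) `^ q^-1) `^ q = - v / kap by rewrite -powRrM mulVf ?gt_eqF// powRr1.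
  have E2 (x : X) : (mdist x0 x `^ q) `^ q^-1 = mdist x0 x.
    by rewrite -powRrM mulfV ?gt_eqF// powRr1 ?mdist_ge0.
  apply/seteqP; split => x; rewrite ballEmdist /= lte_fin ltrNr (mulrC kap) => h.
    rewrite -(E2 x); apply: gt0_ltr_powR; rewrite ?invr_gt0 ?nnegrE ?powR_ge0//.
    by rewrite ltr_pdivlMr.
  rewrite -ltr_pdivlMr// -E; apply: gt0_ltr_powR; rewrite ?nnegrE ?powR_ge0 ?mdist_ge0//.
rewrite mul0r; have {}v0 : 0 <= v.
  by move: v0; rewrite notin_setE /= in_itv/= andbT oppr_gt0 => /negP; rewrite -leNgt.
rewrite (_ : [set x | _] = set0) ?measure0 ?mule0//.
apply/seteqP; split => x //=; rewrite lte_fin => h.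
have : 0 <= kap * mdist x0 x `^ q by rewrite mulr_ge0 ?powR_ge0// ltW.
move=> h1; lra.
Qed.

Let measurable_volume q kap : measurable_fun [set: measurableTypeR R]
  (fun v : R => volume m x0 ((- v / kap) `^ q^-1)).
Proof.
have mv : measurable_fun [set: measurableTypeR R] (volume m x0).
  by apply: nondecreasing_measurable => // a b ab; exact: (le_volume x0 N1 mms cd ab).
have mopp : measurable_fun [set: measurableTypeR R] (fun v : R => - v / kap).
  by apply: measurable_funM => //; exact: oppr_measurable.
exact: (measurableT_comp mv (measurableT_comp (@measurable_powR R q^-1) mopp)).
Qed.

(** The right-hand constants are the value on a cone of density w. The lower bound
is m(B_r) >= w r^N for all r. The upper bound uses m(B_r) <= (w + dl) r^N for
r >= rho only; smaller balls contribute at most m(B_rho), whatever kap is. *)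
Lemma dist_integral_bounds q g : 0 < q ->
  (\int[leb]_v ((\1_`]0%R, +oo[%classic v : R) * (v `^ (N / q) * expR (- v)))%:E = g%:E)%E ->
  (forall kap, 0 < kap -> ((w / kap `^ (N / q) * g)%:E <=
      \int[m]_x (expR (- (kap * mdist x0 (x : X) `^ q)))%:E)%E) /\
  (forall dl, 0 < dl -> exists2 M, 0 <= M & forall kap, 0 < kap ->
     (\int[m]_x (expR (- (kap * mdist x0 (x : X) `^ q)))%:E <=
       ((w + dl) / kap `^ (N / q) * g + M)%:E)%E).
Proof.
move=> q0 gE.
have gS : (\int[leb]_v (I v * ((- v) `^ (N / q) * expR v))%:E = g%:E)%E.
  have := gamma_scaled (@ltr01 R) gE; rewrite powR1 !mul1r => <-.
  by apply: eq_integral => v _; rewrite divr1.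
have mexp : measurable_fun [set: measurableTypeR R] (fun v : R => expR v) by exact: measurable_expR.
have mopp : measurable_fun [set: measurableTypeR R] (fun v : R => - v) by exact: oppr_measurable.
have mg : measurable_fun [set: measurableTypeR R] (fun v : R => (I v * ((- v) `^ (N / q) * expR v))%:E).
  apply/measurable_EFinP; apply: measurable_funM => //; apply: measurable_funM => //.
  exact: (measurableT_comp (@measurable_powR R (N / q)) mopp).
have I0 v : 0 <= I v by [].
have cI c : 0 <= c -> (\int[leb]_v (c%:E * (I v * ((- v) `^ (N / q) * expR v))%:E) = (c * g)%:E)%E.
  move=> c0; rewrite (ge0_integralZl leb measurableT mg) ?gS//.
  by move=> v _; rewrite lee_fin !mulr_ge0 ?powR_ge0 ?expR_ge0.
have mV q' kap : measurable_fun [set: measurableTypeR R]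
   (fun v : R => (I v * (expR v * volume m x0 ((- v / kap) `^ q'^-1)))%:E).
  by apply/measurable_EFinP; apply: measurable_funM => //; apply: measurable_funM.
have V0 r : 0 <= volume m x0 r by exact: fine_ge0.
have pw kap v : 0 < kap -> 0 < - v -> ((- v / kap) `^ q^-1) `^ N = (- v) `^ (N / q) / kap `^ (N / q).
  by move=> k0 v0; rewrite -powRrM (mulrC q^-1) powR_div ?(ltW v0).
split.
  move=> kap k0; rewrite dist_integral_layer//.
  have c0 : 0 <= w / kap `^ (N / q) by rewrite divr_ge0 ?powR_ge0.
  rewrite -(cI _ c0).
  apply: ge0_le_integral => //.
  - by move=> v _; rewrite -EFinM lee_fin mulr_ge0// mulr_ge0// mulr_ge0 ?powR_ge0 ?expR_ge0.
  - exact: measurable_funeM.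
  move=> v _; rewrite -EFinM lee_fin /I indicE.
  have [v0|v0] := boolP (_ \in _); last by rewrite !mul0r mulr0.
  have {}v0 : 0 < - v by move: v0; rewrite inE/= in_itv/= andbT.
  have r0 : 0 < (- v / kap) `^ q^-1 by rewrite powR_gt0// divr_gt0.
  rewrite !mul1r; have := volume_ge x0 N1 mms cd r0; rewrite -/w pw// => h.
  rewrite -(ler_pM2l (expR_gt0 v)) in h; apply: le_trans h.
  by rewrite le_eqVlt; apply/orP; left; apply/eqP; ring.
move=> dl dl0; have [rho rho0 hrho] := volume_asymptotic x0 N1 mms cd dl0.
exists (volume m x0 rho) => // kap k0; rewrite dist_integral_layer//.
have c0 : 0 <= (w + dl) / kap `^ (N / q) by rewrite divr_ge0 ?powR_ge0// addr_ge0// ltW.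
have mexpI : measurable_fun [set: measurableTypeR R] (fun v : R => (I v * expR v)%:E).
  by apply/measurable_EFinP; exact: measurable_funM.
have expI : (\int[leb]_v (I v * expR v)%:E = 1)%E.
  have := @integral_expRM_itv R 1 0 ltr01; rewrite mulr0 expR0 divr1 => <-.
  rewrite [RHS]integral_mkcond; apply: eq_integral => v _; rewrite patchE mul1r /I indicE.
  case: ifPn => [/set_mem /= vw|/negP vw].
    by rewrite mem_set/= ?in_itv/= ?andbT ?oppr_gt0 ?mul1r.
  rewrite memNset ?mul0r//= in_itv/= andbT oppr_gt0 => h.
  by apply: vw; exact: mem_set.
apply: (@le_trans _ _ (\int[leb]_v (((w + dl) / kap `^ (N / q))%:E * (I v * ((- v) `^ (N / q) * expR v))%:E
   + (volume m x0 rho)%:E * (I v * expR v)%:E))%E).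
  apply: ge0_le_integral => //.
  - by move=> v _; rewrite lee_fin !mulr_ge0 ?expR_ge0.
  - by apply: emeasurable_funD; exact: measurable_funeM.
  move=> v _; rewrite -!EFinM -EFinD lee_fin /I indicE.
  have [v0|v0] := boolP (_ \in _); last by rewrite !mul0r !mulr0 addr0.
  have {}v0 : 0 < - v by move: v0; rewrite inE/= in_itv/= andbT.
  set r := (- v / kap) `^ q^-1.
  have bound : volume m x0 r <= (w + dl) * r `^ N + volume m x0 rho.
    have [rr|rr] := leP rho r; first by rewrite (le_trans (hrho _ rr))// lerDl.
    by rewrite (le_trans (le_volume x0 N1 mms cd (ltW rr)))// lerDr mulr_ge0 ?powR_ge0// addr_ge0// ltW.
  rewrite !mul1r; rewrite /r pw// -/r in bound.
  rewrite -(ler_pM2l (expR_gt0 v)) in bound; apply: (le_trans bound).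
  by rewrite le_eqVlt; apply/orP; left; apply/eqP; ring.
rewrite ge0_integralD//; last 4 first.
- by move=> v _; rewrite -EFinM lee_fin mulr_ge0// mulr_ge0// mulr_ge0 ?powR_ge0 ?expR_ge0.
- exact: measurable_funeM.
- by move=> v _; rewrite -EFinM lee_fin mulr_ge0// mulr_ge0 ?expR_ge0.
- exact: measurable_funeM.
rewrite (cI _ c0) (ge0_integralZl leb measurableT mexpI) ?lee_fin//; last first.
  by move=> v _; rewrite lee_fin mulr_ge0 ?expR_ge0.
by rewrite expI mule1 -EFinD.
Qed.

Lemma integral_exp_dist_finite mm : 0 < mm -> (\int[m]_x (expR (- (mm * mdist x0 (x : X))))%:E < +oo)%E.
Proof.
move=> m0.
have N10 : 0 < N / 1 by rewrite divr_gt0.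
have [g g0 [_ gE]] := gamma_spec N10.
have [_ /(_ _ ltr01)[M M0 /(_ _ m0)]] := dist_integral_bounds ltr01 gE.
rewrite (eq_integral (fun x : borel X => (expR (- (mm * mdist x0 (x : X))))%:E)); last first.
  by move=> x _; rewrite powRr1 ?mdist_ge0.
by move=> h; apply: le_lt_trans h _; exact: ltry.
Qed.

End distance_integrals.

(** * The extremal potentials *)

Section monotone_integral.
Context {R : realType} d (T : measurableType d) (mu : {measure set T -> \bar R}).

(** Without measurability, since the slope of a function is only bounded
pointwise; the integral is a supremum over simple functions below. *)
Lemma ge0_le_integral_nonmeasurable (f g : T -> \bar R) :
  (forall x, 0 <= f x)%E -> (forall x, f x <= g x)%E ->
  (\int[mu]_x f x <= \int[mu]_x g x)%E.
Proof.
move=> f0 fg; have g0 x : (0 <= g x)%E by exact: le_trans (f0 x) (fg x).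
rewrite !ge0_integralTE//.
apply: le_ereal_sup => _ [h hf <-]; exists h => // x.
exact: le_trans (hf x) (fg x).
Qed.

End monotone_integral.

Section test_function.
Context {R : realType} {X : completeMetricType R}.
Variable m : {measure set (borel X) -> \bar R}.
Variables (N : R) (x0 : X).
Hypothesis N1 : 1 < N.
Hypothesis mms : metric_measure_space m.
Hypothesis cd : CD0 m N.

(** The potentials reproduced by the Hopf-Lax semigroup on a cone; for q = 2 their
exponentials are Gaussians. *)
Definition gaussian (q k : R) : X -> R := fun x => - (k * mdist x0 x `^ q).

Let measurable_gaussian q k : measurable_fun setT (gaussian q k : borel X -> R).
Proof.
apply: measurable_funN; apply: measurable_funM => //.
exact: (measurableT_comp (@measurable_powR R q) (measurable_mdistr x0)).
Qed.

Lemma gaussian_locally_lipschitz q k : 1 < q -> 0 < k -> locally_lipschitz (gaussian q k).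
Proof.
move=> q1 k0 x; have q0 : 0 < q by exact: lt_trans q1.
have q10 : 0 <= q - 1 by rewrite subr_ge0 ltW.
pose D := mdist x0 x + 1.
exists 1, (k * (q * D `^ (q - 1))); split => // y z; rewrite !ballEmdist /= => xy xz.
have main a b : 0 <= a -> a <= b -> b <= D -> k * b `^ q - k * a `^ q <= k * (q * D `^ (q - 1)) * (b - a).
  move=> a0 ab bD; have b0 : 0 <= b := le_trans a0 ab.
  have := powR_tangent q1 a0 b0; rewrite -(powR_split q1 b0) => h.
  have h2 : b `^ (q - 1) <= D `^ (q - 1).
    by apply: ge0_ler_powR; rewrite ?nnegrE// (le_trans b0).
  have h3 : q * b `^ (q - 1) * (b - a) <= q * D `^ (q - 1) * (b - a).
    by rewrite ler_wpM2r ?subr_ge0// ler_pM2l.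
  have h4 : b `^ q - a `^ q <= q * D `^ (q - 1) * (b - a) by rewrite -(powR_split q1 b0); lra.
  rewrite -mulrBr; apply: (@le_trans _ _ (k * (q * D `^ (q - 1) * (b - a)))); last by rewrite !mulrA.
  by rewrite ler_pM2l // (powR_split q1 b0).
have yD : mdist x0 y <= D by have := metric_triangle x0 x y; rewrite /D; lra.
have zD : mdist x0 z <= D by have := metric_triangle x0 x z; rewrite /D; lra.
have K0 : 0 <= k * (q * D `^ (q - 1)) by rewrite !mulr_ge0 ?powR_ge0 ?(ltW k0) ?(ltW q0).
apply: (@le_trans _ _ (k * (q * D `^ (q - 1)) * `|mdist x0 y - mdist x0 z|)); last first.
  by rewrite ler_wpM2l// mdist_lip.
have mono a b : 0 <= a -> a <= b -> k * a `^ q <= k * b `^ q.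
  move=> a0 ab; rewrite ler_pM2l//; apply: ge0_ler_powR; rewrite ?nnegrE ?(ltW q0)//.
  exact: le_trans ab.
have absm a b : 0 <= a -> a <= b -> b <= D ->
    `|k * b `^ q - k * a `^ q| <= k * (q * D `^ (q - 1)) * `|b - a|.
  move=> a0 ab bD; have h1 : 0 <= k * b `^ q - k * a `^ q by rewrite subr_ge0 mono.
  have h2 : 0 <= b - a by rewrite subr_ge0.
  by rewrite (ger0_norm h1) (ger0_norm h2); exact: main.
rewrite /gaussian opprK addrC.
have [yz|zy] := leP (mdist x0 y) (mdist x0 z).
  by rewrite (distrC (mdist x0 y)); apply: absm; rewrite ?mdist_ge0.
by rewrite (distrC (k * _)); apply: absm; rewrite ?mdist_ge0 ?(ltW zy).
Qed.

(** For k below 1 / (q t0^(q-1)) the Hopf-Lax transform at time t0 is finite at x0: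
this restricts the time scale of the potential to be larger than t0. *)
Lemma gaussian_class_F p t0 k : 1 < p -> 0 < t0 -> 0 < k ->
  k < (conj_exp p * t0 `^ (conj_exp p - 1))^-1 ->
  class_F p t0 x0 (gaussian (conj_exp p) k).
Proof.
move=> p1 t00 k0 kt; have q1 := conj_exp_gt1 p1; set q := conj_exp p in q1 kt *.
have q0 : 0 < q by exact: lt_trans q1.
have Kp : 0 < q * t0 `^ (q - 1) by rewrite mulr_gt0// powR_gt0.
split.
- split; first exact: gaussian_locally_lipschitz.
  exists x0, 1 => x /=; rewrite in_itv/= andbT ballEmdist /= /gaussian oppr_ge0 pmulr_rle0// => h.
  have : mdist x0 x `^ q == 0 by rewrite eq_le h powR_ge0.
  by rewrite powR_eq0 => /andP[/eqP -> _].
- rewrite /hopf_lax gt_eqF//; apply: (@lt_le_trans _ _ 0%E); first exact: ltNyr.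
  apply: le_ereal_inf_tmp => _ [y _ <-]; rewrite lee_fin /gaussian -/q.
  have : mdist x0 y `^ q * k <= mdist x0 y `^ q * (q * t0 `^ (q - 1))^-1.
    by rewrite ler_wpM2l ?powR_ge0// ltW.
  by move=> h; rewrite (mulrC k); lra.
- exists 0, k^-1; split; first by rewrite -/q -[ltLHS]invrK ltf_pV2 ?posrE ?invr_gt0.
  by move=> x; rewrite invrK sub0r /gaussian mulrC (metric_sym x).
Qed.

Lemma slope_le_const (v : X -> R) x c : 0 <= c ->
  (forall y, mdist x y <= 1 -> `|v y - v x| <= c * mdist x y) -> (slope v x <= c%:E)%E.
Proof.
move=> c0 h; rewrite /slope limf_esupE.
apply: (@le_trans _ _ (ereal_sup ((fun y : X => (`|v y - v x| / mdist x y)%:E) @` (ball x 1)))).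
  by apply: ereal_inf_lbound; exists (ball x 1) => //; exact: nbhsx_ballx.
apply: ge_ereal_sup => _ [y xy <-]; rewrite lee_fin.
have xy1 : mdist x y <= 1 by move: xy; rewrite ballEmdist /= => /ltW.
have := mdist_ge0 x y; rewrite le_eqVlt => /orP[/eqP xy0|xy0].
  by rewrite -xy0 invr0 mulr0.
by rewrite ler_pdivrMr// h.
Qed.

Lemma slope_ge0 (v : X -> R) x : (0 <= slope v x)%E.
Proof.
apply: limf_esup_ge0.
  by move=> h; have := nbhs_singleton h.
by move=> y; rewrite lee_fin divr_ge0 ?mdist_ge0.
Qed.

(** The function e^(al u / p) is Lipschitz, hence a constant sequence is an admissible
approximation, and its slope is bounded by a multiple of e^(-d), which is
p-integrable because the volume growth is polynomial. *)
Lemma gaussian_admissible p al k : 1 < p -> 0 < al -> 0 < k ->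
  admissible m p al x0 (gaussian (conj_exp p) k).
Proof.
have dist01 (a b : R) : 0 <= a <= 1 -> 0 <= b <= 1 -> `|a - b| <= 1.
  by move=> /andP[a0 a1] /andP[b0 b1]; rewrite ler_norml; apply/andP; split; lra.
move=> p1 al0 k0; have q1 := conj_exp_gt1 p1; set q := conj_exp p in q1 *.
have q0 : 0 < q by exact: lt_trans q1.
have p0 : 0 < p by exact: lt_trans p1.
have mgu := measurable_gaussian q k.
have md : measurable_fun setT (fun x : borel X => mdist x0 (x : X)) := measurable_mdistr x0.
have mexpd (c : R) : measurable_fun setT (fun x : borel X => expR (- (c * mdist x0 (x : X)))).
  by apply: measurableT_comp => //; apply: measurable_funN; exact: measurable_funM.
have fin1 c : 0 < c -> (\int[m]_x (expR (- (c * mdist x0 (x : X))))%:E < +oo)%E.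
  by move=> c0; exact: (integral_exp_dist_finite x0 N1 mms cd c0).
have finC C c : 0 <= C -> 0 < c -> (\int[m]_x (C * expR (- (c * mdist x0 (x : X))))%:E < +oo)%E.
  move=> C0 c0; rewrite (eq_integral (fun x : borel X => (C%:E * (expR (- (c * mdist x0 (x : X))))%:E)%E)); last first.
    by move=> x _; rewrite EFinM.
  rewrite ge0_integralZl//; last exact/measurable_EFinP.
  by apply: lte_mul_pinfty; rewrite ?lee_fin//; exact: fin1.
have alk : 0 < al * k by rewrite mulr_gt0.
have eE (c : R) (x : X) : expR (c * gaussian q k x) = expR (- ((c * k) * mdist x0 x `^ q)).
  by congr expR; rewrite /gaussian; ring.
have int1 : m.-integrable setT (fun x : borel X =>
    ((1 + mdist x0 (x : X) `^ q) * expR (al * gaussian q k x))%:E).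
  have mF : measurable_fun setT (fun x : borel X =>
    ((1 + mdist x0 (x : X) `^ q) * expR (al * gaussian q k x))).
    apply: measurable_funM.
      by apply: measurable_funD => //; exact: (measurableT_comp (@measurable_powR R q) md).
    by apply: measurableT_comp => //; exact: measurable_funM.
  apply/integrableP; split; first exact/measurable_EFinP.
  have [C2 C20 C2P] := expR_powR_dominated q1 alk (ltr0Sn R 1).
  pose C1 := (q / 1) `^ q.
  have C10 : 0 <= C1 by exact: powR_ge0.
  have C0 : 0 <= (1 + C1) * C2 by rewrite mulr_ge0 ?(ltW C20)// addr_ge0.
  apply: le_lt_trans (finC _ _ C0 ltr01).
  apply: ge0_le_integral_nonmeasurable => [x|x]; first exact: abse_ge0.
  rewrite gee0_abs lee_fin; last first.
    by rewrite mulr_ge0 ?expR_ge0// addr_ge0 ?powR_ge0.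
  have d0 := mdist_ge0 x0 (x : X); set d := mdist x0 _ in d0 *.
  have h1 := C2P _ d0.
  have h2 := powR_le_expR q0 ltr01 d0; rewrite mul1r -/C1 in h2.
  have h3 : 1 <= expR d by rewrite -expR0 ler_expR.
  rewrite eE -/d mul1r.
  apply: (@le_trans _ _ (((1 + C1) * expR d) * (C2 * expR (- (2 * d))))).
    apply: ler_pM; rewrite ?expR_ge0 ?addr_ge0 ?powR_ge0//.
    by rewrite mulrDl mul1r lerD.
  have -> : expR (- (2 * d)) = expR (- d) * expR (- d) by rewrite -expRD; congr expR; ring.
  have e1 : expR d * expR (- d) = 1 by rewrite -expRD subrr expR0.
  rewrite le_eqVlt; apply/orP; left; apply/eqP.
  transitivity ((1 + C1) * C2 * (expR d * expR (- d)) * expR (- d)); first by ring.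
  by rewrite e1 mulr1.
pose v : X -> R := fun x => expR (al * gaussian q k x / p).
have alkp : 0 < al / p * k by rewrite mulr_gt0// divr_gt0.
have vE x : v x = expR (- ((al / p * k) * mdist x0 x `^ q)).
  by rewrite /v -eE; congr expR; field; rewrite gt_eqF.
have mv : measurable_fun setT (v : borel X -> R).
  by apply: measurableT_comp => //; apply: measurable_funM => //; exact: measurable_funM.
have Lpv : Lp m p v.
  rewrite /Lp /=; apply/andP; split; rewrite inE//=.
  rewrite /finite_norm.
  rewrite (_ : 'N[m]_p%:E[EFin \o v] = 'N[m]_(p%:E)[(fun x : borel X => (expR ((al / p) * gaussian q k x))%:E)])%E; last first.
    apply: eq_Lnorm => x /=; congr EFin; rewrite /v; congr expR; field; rewrite gt_eqF//.
  rewrite Lnorm_expR ?gt_eqF//; apply: poweR_lty.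
  rewrite (eq_integral (fun x : borel X => (expR (- ((al * k) * mdist x0 (x : X) `^ q)))%:E)); last first.
    by move=> x _; rewrite -eE; congr (expR _)%:E; field; rewrite gt_eqF.
  have [C2 C20 C2P] := expR_powR_dominated q1 alk ltr01.
  apply: le_lt_trans (finC _ _ (ltW C20) ltr01).
  apply: ge0_le_integral_nonmeasurable => x; rewrite lee_fin ?expR_ge0//.
  by apply: C2P; exact: mdist_ge0.
have [C C0 CP] := expR_powR_lipschitz q1 alkp.
have vlip y z : `|mdist x0 y - mdist x0 z| <= 1 -> `|v y - v z| <= C * expR (- mdist x0 y) * mdist y z.
  move=> yz; rewrite !vE; apply: le_trans (CP _ _ (mdist_ge0 _ _) (mdist_ge0 _ _) yz) _.
  by rewrite ler_wpM2l ?mulr_ge0 ?expR_ge0 ?(ltW C0)// mdist_lip.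
have v01 x : 0 <= v x <= 1.
  rewrite vE expR_ge0/= -expR0 ler_expR oppr_le0 mulr_ge0 ?powR_ge0//; exact: ltW.
split => //; split => //.
have slv x : (slope v x <= (C * expR (- mdist x0 x))%:E)%E.
  apply: slope_le_const; first by rewrite mulr_ge0 ?expR_ge0// ltW.
  move=> y xy; rewrite distrC; apply: vlip.
  exact: le_trans (mdist_lip _ _ _) xy.
have approx : lip_approx m p v (fun=> v).
  split.
    move=> _; split => //; exists (Num.max C 1) => y z.
    have [yz|yz] := leP `|mdist x0 y - mdist x0 z| 1.
      apply: (le_trans (vlip _ _ yz)); rewrite ler_wpM2r ?mdist_ge0//.
      apply: (@le_trans _ _ C); last by rewrite le_max lexx.
      by rewrite ler_piMr ?(ltW C0)// -expR0 ler_expR oppr_le0 mdist_ge0.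
    have yz1 : 1 <= mdist y z by apply: le_trans (ltW yz) (mdist_lip _ _ _).
    apply: (@le_trans _ _ 1).
      exact: dist01.
    by rewrite -[leLHS]mulr1 ler_pM// le_max lexx orbT.
  rewrite /cvg_Lp (_ : (fun n : nat => _) = cst 0%E); first exact: cvg_cst.
  apply/funext => n /=; rewrite -[RHS](@Lnorm0 _ _ R m p%:E) ?eqe ?gt_eqF//.
  by apply: eq_Lnorm => x; rewrite subrr.
apply: (@le_lt_trans _ _ (\int[m]_x (slope v x `^ p)%E)%E).
  apply: ereal_inf_lbound; exists (fun=> v) => //.
  have cc : (fun _ : nat => (\int[m]_x (slope v x `^ p))%E) @ \oo --> (\int[m]_x (slope v x `^ p))%E.
    exact: cvg_cst.
  by rewrite (cvg_limn_einf_sup cc).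
have Cp0 : 0 <= C `^ p by exact: powR_ge0.
apply: le_lt_trans (finC _ _ Cp0 p0).
apply: ge0_le_integral_nonmeasurable => x; first exact: poweR_ge0.
apply: (@le_trans _ _ ((C * expR (- mdist x0 (x : X)))%:E `^ p)%E).
  apply: gt0_ler_poweR; rewrite ?in_itv/= ?leey ?andbT ?(ltW p0) ?slope_ge0//.
  by rewrite lee_fin mulr_ge0 ?expR_ge0// ltW.
rewrite poweR_EFin lee_fin powRM ?expR_ge0 ?(ltW C0)//.
by rewrite [X in _ * X <= _]/powR gt_eqF ?expR_gt0// expRK mulrN.
Qed.

(** By the triangle inequality and the convexity of the perspective function. *)
Lemma hopf_lax_gaussian_ge p t tau x : 1 < p -> 0 < t -> t < tau ->
  forall q, q = conj_exp p ->
  ((gaussian q (q * (tau - t) `^ (q - 1))^-1 x)%:E <=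
    hopf_lax p t (gaussian q (q * tau `^ (q - 1))^-1) x)%E.
Proof.
move=> p1 t0 ttau q qE; have q1 : 1 < q by rewrite qE conj_exp_gt1.
have q0 : 0 < q by exact: lt_trans q1.
have tau0 : 0 < tau := lt_trans t0 ttau.
have r0 : 0 < tau - t by rewrite subr_gt0.
rewrite /hopf_lax gt_eqF//; apply: le_ereal_inf_tmp => _ [y _ <-]; rewrite lee_fin /gaussian -qE.
have := powR_perspective q1 (mdist_ge0 x0 x) (mdist_ge0 x y) t0 ttau.
have : mdist x0 y `^ q <= (mdist x0 x + mdist x y) `^ q.
  apply: ge0_ler_powR; rewrite ?nnegrE ?addr_ge0 ?mdist_ge0 ?(ltW q0)//.
  exact: metric_triangle.
have T0 : 0 < tau `^ (q - 1) by rewrite powR_gt0.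
have T1 : 0 < t `^ (q - 1) by rewrite powR_gt0.
have T2 : 0 < (tau - t) `^ (q - 1) by rewrite powR_gt0.
rewrite -(ler_pM2r (_ : 0 < (tau `^ (q - 1))^-1)) ?invr_gt0// => h1 h2.
have := le_trans h1 h2.
have qi : 0 < q^-1 by rewrite invr_gt0.
rewrite -(ler_pM2l qi) !invfM => h; lra.
Qed.

End test_function.

(** * Sharpness *)

Section sharpness.
Context {R : realType} {X : completeMetricType R}.
Variable m : {measure set (borel X) -> \bar R}.

Lemma hc_factorM (N p al be t K r : R) : 0 <= K -> 0 <= r ->
  hc_factor N p al be t (K * r) =
  hc_factor N p al be t K * r `^ (N / p * ((be - al) / (al * be))).
Proof. by move=> K0 r0; rewrite /hc_factor (@powRM _ K r)// !mulrA. Qed.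

(** The inequality with constant K for the Gaussian potential of time scale 2 t0
at time t0 / 2, with be = 4/3 al; these ratios satisfy the relation of the
equality case. Compared with that case it says that the Gaussian integral exceeds its value on
a cone by a factor of at least a power of K0 / K whose exponent does not depend on al. *)
Lemma gaussian_defect (N t0 : R) (x0 : X) (p K al g : R) :
  1 < N -> metric_measure_space m -> CD0 m N ->
  0 < asymptotic_density m N x0 -> 0 < t0 -> 1 < p -> 0 < K -> 0 < al ->
  0 < g ->
  euler_gamma (N / conj_exp p + 1) = g ->
  (\int[@lebesgue_measure R]_v ((\1_`]0%R, +oo[%classic v : R) * (v `^ (N / conj_exp p) * expR (- v)))%:E = g%:E)%E ->
  let k1 := (conj_exp p * (2 * t0) `^ (conj_exp p - 1))^-1 in
  let u := gaussian x0 (conj_exp p) k1 in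
  hypercontractive m N p al (4 / 3 * al) (t0 / 2) u K ->
  ((asymptotic_density m N x0 / (al * k1) `^ (N / conj_exp p) * g)%:E <=
   \int[m]_x (expR (- ((al * k1) * mdist x0 (x : X) `^ conj_exp p)))%:E
   * ((K / K0_const m N p x0) `^ (N / (4 * p)))%:E)%E.
Proof.
move=> N1 mms cd w0 t00 p1 Kp al0 g0 gE gI k1 u.
have N0 : 0 < N by exact: lt_trans N1.
have p0 : 0 < p by exact: lt_trans p1.
have sg0 := sigma_const_gt0 N0.
rewrite (K0_constE m x0 N0 gE) (AVR_asymptotic_density x0 N1 mms cd) /=.
set A := _ / sigma_const N.
have wE : asymptotic_density m N x0 = A * sigma_const N by rewrite /A divfK// gt_eqF.
have A0 : 0 < A by rewrite divr_gt0.
have K00 := K0_formula_gt0 N0 p1 A0 sg0 g0; set K0 := K0_formula _ _ _ _ _ in K00 *.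
set be := 4 / 3 * al; set t := t0 / 2.
have be0 : 0 < be by rewrite mulr_gt0// divr_gt0.
have t_gt0 : 0 < t by rewrite divr_gt0.
have albe : al < be by rewrite /be; lra.
have ttau : t < 2 * t0 by rewrite /t; lra.
have tauE : 2 * t0 = t * be / (be - al).
  by rewrite /t /be; field; apply/eqP => h; lra.
have q1 := conj_exp_gt1 p1.
have q0 : 0 < conj_exp p by exact: lt_trans q1.
pose k2 := (conj_exp p * (2 * t0 - t) `^ (conj_exp p - 1))^-1.
have k10 : 0 < k1 by rewrite invr_gt0 mulr_gt0// powR_gt0// mulr_gt0.
have k20 : 0 < k2 by rewrite invr_gt0 mulr_gt0// powR_gt0// subr_gt0.
have adm := gaussian_admissible x0 N1 mms cd p1 al0 k10.
have [h h0 hE] := admissible_integral al0 (gaussian_locally_lipschitz x0 q1 k10) adm.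
rewrite /hypercontractive Lnorm_expeR// Lnorm_expR ?gt_eqF// hE => hyp.
have eE (x : X) : expR (al * u x) = expR (- ((al * k1) * mdist x0 x `^ conj_exp p)).
  by rewrite /u /gaussian mulrN mulrA.
rewrite (eq_integral (fun x : borel X => (expR (al * u x))%:E)); last by move=> x _; rewrite eE.
rewrite hE -EFinM lee_fin.
have [lower _] := dist_integral_bounds x0 N1 mms cd q0 gI.
have bek2 : 0 < be * k2 by rewrite mulr_gt0.
have Vbe : ((A * sigma_const N / (be * k2) `^ (N / conj_exp p) * g)%:E <=
    \int[m]_x expeR (be%:E * hopf_lax p t u x))%E.
  rewrite -wE; apply: le_trans (lower _ bek2) _.
  apply: ge0_le_integral_nonmeasurable => x; first by rewrite lee_fin expR_ge0.
  rewrite -[leLHS]/(expeR (- (be * k2 * mdist x0 x `^ conj_exp p))%:E) lee_expeR.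
  have := hopf_lax_gaussian_ge x0 x p1 t_gt0 ttau (erefl (conj_exp p)).
  move=> /(lee_wpmul2l (_ : 0 <= be%:E)%E); rewrite lee_fin => /(_ (ltW be0)).
  by apply: le_trans; rewrite -EFinM lee_fin /gaussian mulrN mulrA.
have Vbe0 : 0 < A * sigma_const N / (be * k2) `^ (N / conj_exp p) * g.
  by apply: mulr_gt0 => //; apply: divr_gt0; [exact: mulr_gt0|exact: powR_gt0].
have i0 : (0 <= \int[m]_x expeR (be%:E * hopf_lax p t u x))%E.
  by apply: integral_ge0 => x _; exact: expeR_ge0.
have bi0 : 0 <= be^-1 by rewrite invr_ge0 ltW.
have inI (y : \bar R) : (0 <= y)%E -> y \in `[0%E, +oo%E] by rewrite in_itv/= leey andbT.
have := le_trans (gt0_ler_poweR bi0 (inI _ _) (inI _ i0) Vbe) hyp.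
rewrite lee_fin => /(_ (ltW Vbe0)).
rewrite !poweR_EFin -EFinM lee_fin.
rewrite (hc_extremal N0 p1 al0 albe t_gt0 A0 sg0 g0 tauE (erefl _) (erefl k1) (erefl k2)) -/K0.
rewrite -wE; set V := asymptotic_density _ _ _ / _ * g.
have V0 : 0 <= V by rewrite mulr_ge0 ?divr_ge0 ?powR_ge0 ?(ltW w0) ?(ltW g0).
have KK : 0 < K / K0 by rewrite divr_gt0.
have {1}-> : K = K0 * (K / K0) by rewrite mulrC divfK// gt_eqF.
rewrite hc_factorM ?(ltW K00) ?(ltW KK)//.
have [] := ln_hc_factor N p1 al0 albe t_gt0 K00.
move: (hc_factor _ _ _ _ _ _) => H H0 _; rewrite (mulrCA _ H) (mulrC _ H) ler_pM2l//.
set r := K / K0 => main.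
have := ge0_ler_powR (ltW al0) (powR_ge0 _ _) (mulr_ge0 (powR_ge0 _ _) (powR_ge0 _ _)) main.
rewrite (powRM _ (powR_ge0 _ _) (powR_ge0 _ _)) -!powRrM mulVf ?gt_eqF// !powRr1//.
congr (_ <= _ * _ `^ _); rewrite /be; field.
by rewrite !gt_eqF//= subr_gt0.
Qed.

(** As al tends to 0 the Gaussian sees only large balls and its integral, divided by
the value on a cone, tends to 1; hence K / K0 is at least 1. *)
Lemma sharp_constant (N t0 : R) (x0 : X) :
  1 < N -> metric_measure_space m -> CD0 m N ->
  (0 < AVR m N x0)%E -> 0 < t0 ->
  forall p K : R, 1 < p -> 0 < K ->
  (forall (alpha beta t : R) (u : X -> R),
     0 < alpha -> alpha < beta -> 0 < t -> t < t0 ->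
     class_F p t0 x0 u -> admissible m p alpha x0 u ->
     hypercontractive m N p alpha beta t u K) ->
  K0_const m N p x0 <= K.
Proof.
move=> N1 mms cd A0 t00 p K p1 Kp hyp.
have N0 : 0 < N by exact: lt_trans N1.
have p0 : 0 < p by exact: lt_trans p1.
have q1 := conj_exp_gt1 p1.
have q0 : 0 < conj_exp p by exact: lt_trans q1.
have Nq0 : 0 < N / conj_exp p by rewrite divr_gt0.
have [g g0 [gE gI]] := gamma_spec Nq0.
have sg0 := sigma_const_gt0 N0.
have w0 : 0 < asymptotic_density m N x0.
  move: A0; rewrite (AVR_asymptotic_density x0 N1 mms cd) lte_fin => A0.
  by move: A0; rewrite pmulr_lgt0 // invr_gt0.
have K00 : 0 < K0_const m N p x0.
  rewrite (K0_constE m x0 N0 gE) (AVR_asymptotic_density x0 N1 mms cd) /=.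
  by apply: K0_formula_gt0 => //; rewrite divr_gt0.
pose k1 := (conj_exp p * (2 * t0) `^ (conj_exp p - 1))^-1.
have k10 : 0 < k1 by rewrite invr_gt0 mulr_gt0// powR_gt0// mulr_gt0.
have k1t : k1 < (conj_exp p * t0 `^ (conj_exp p - 1))^-1.
  have t20 : t0 < 2 * t0 by lra.
  have K1 : 0 < conj_exp p * t0 `^ (conj_exp p - 1) by rewrite mulr_gt0 ?powR_gt0.
  have K2 : 0 < conj_exp p * (2 * t0) `^ (conj_exp p - 1).
    by apply: mulr_gt0 => //; apply: powR_gt0; exact: lt_trans t20.
  rewrite /k1 (ltf_pV2 K2 K1) (ltr_pM2l q0).
  by apply: gt0_ltr_powR; rewrite ?nnegrE ?subr_gt0 ?mulr_ge0 ?(ltW t00)//; lra.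
set K0 := K0_const m N p x0 in K00 *.
pose r := (K / K0) `^ (N / (4 * p)).
have r0 : 0 <= r by exact: powR_ge0.
have e0 : 0 < N / (4 * p) by rewrite divr_gt0// mulr_gt0.
have step eta : 0 < eta -> 1 <= (1 + eta) * r.
  move=> eta0; set w := asymptotic_density m N x0 in w0.
  have [_ upper] := dist_integral_bounds x0 N1 mms cd q0 gI.
  have dl0 : 0 < w * (eta / 2) by rewrite !mulr_gt0.
  have [M M0 {}upper] := upper _ dl0.
  (* al is chosen so that the value on a cone is 2 (M + 1) / eta, which makes
     the bounded contribution M of small balls at most eta / 2 times it *)
  pose c := w * g * eta / (2 * (M + 1)).
  have M10 : 0 < M + 1 by rewrite ltr_wpDl.
  have c0 : 0 < c by rewrite /c divr_gt0 ?mulr_gt0.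
  pose al := c `^ (conj_exp p / N) / k1.
  have al0 : 0 < al by rewrite divr_gt0// powR_gt0.
  have alk : 0 < al * k1 by rewrite mulr_gt0.
  have alkE : (al * k1) `^ (N / conj_exp p) = c.
    rewrite /al divfK ?gt_eqF// -powRrM mulrA mulfVK ?gt_eqF//.
    by rewrite mulfV ?gt_eqF// powRr1// ltW.
  have albe : al < 4 / 3 * al by lra.
  have t2 : 0 < t0 / 2 by rewrite divr_gt0.
  have tt0 : t0 / 2 < t0 by lra.
  have := gaussian_defect N1 mms cd w0 t00 p1 Kp al0 g0 gE gI
    (hyp _ _ _ _ al0 albe t2 tt0 (gaussian_class_F x0 p1 t00 k10 k1t)
      (gaussian_admissible x0 N1 mms cd p1 al0 k10)).
  rewrite -/k1 -/K0 -/r alkE => h.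
  have := le_trans h (lee_wpmul2r _ (upper _ alk)).
  rewrite lee_fin -EFinM lee_fin alkE => /(_ r0).
  set V := asymptotic_density _ _ _ / c * g.
  have VE : V = 2 * (M + 1) / eta.
    rewrite /V /c -/w; field.
    by rewrite !gt_eqF.
  have V0 : 0 < V by rewrite VE divr_gt0// mulr_gt0.
  have VM : M <= eta / 2 * V.
    have -> : eta / 2 * V = M + 1 by rewrite VE; field; rewrite gt_eqF.
    by rewrite lerDl.
  have -> : (w + w * (eta / 2)) / c * g = (1 + eta / 2) * V by rewrite /V -/w; ring.
  move=> h2; rewrite -(ler_pM2l V0) mulr1; apply: le_trans h2 _.
  rewrite (mulrA V); apply: ler_wpM2r => //; clear -VM; lra.
have r1 : 1 <= r.
  rewrite leNgt; apply/negP => r1.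
  have eta0 : 0 < (1 - r) / 2 by lra.
  have := step _ eta0; nra.
rewrite leNgt; apply/negP => KK.
have : r < 1.
  have -> : (1 : R) = 1 `^ (N / (4 * p)) by rewrite powR1.
  apply: gt0_ltr_powR; rewrite ?nnegrE//.
    by rewrite divr_ge0// ltW.
  by rewrite ltr_pdivrMr// mul1r.
by rewrite ltNge r1.
Qed.

End sharpness.

Theorem theorem1p2 (R : realType) (X : completeMetricType R)
  (m : {measure set (borel X) -> \bar R}) (N t0 : R) (x0 : X)
  (hN : 1 < N) (hX : metric_measure_space m) (hCD : CD0 m N)
  (hAVR : (0 < AVR m N x0)%E) (ht0 : 0 < t0) :
  (forall (p alpha beta t : R) (u : X -> R),
     1 < p -> 0 < alpha -> alpha <= beta -> 0 < t -> t < t0 ->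
     class_F p t0 x0 u -> admissible m p alpha x0 u ->
     hypercontractive m N p alpha beta t u (K0_const m N p x0))
  /\
  (forall p K : R, 1 < p -> 0 < K ->
     (forall (alpha beta t : R) (u : X -> R),
        0 < alpha -> alpha < beta -> 0 < t -> t < t0 ->
        class_F p t0 x0 u -> admissible m p alpha x0 u ->
        hypercontractive m N p alpha beta t u K) ->
     K0_const m N p x0 <= K).
Proof.
split; first exact: hypercontractive_bound.
exact: sharp_constant.
Qed.
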